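(* Let $d=1$. Assume that $K_{ij}>0$ and $K_{ij}=K_{ji}$ for all $0\le i\ne j\le n$, and that $K>2n\kappa$. Let $u^0\in [H^1(\Omega)]^{n+1}$ be such that $u^0(x)\in\overline{\mathcal P}$ for almost all $x\in\Omega$. Let $\tilde u$ be a weak solution and let $u\in [L^2((0,T),H^2(\Omega))\cap H^1((0,T),L^2(\Omega))]^{n+1}$ be a strong solution with initial datum $u^0$ (both in the sense defined in the context) of the system $$\partial_t u_i-\nabla\cdot\Big[\sum_{j=0,\,j\ne i}^n K_{ij}(u_j\nabla u_i-u_i\nabla u_j)\Big]=0\ \text{ in }(0,T)\times\Omega,\qquad \nabla u_i\cdot\mathbf n=0\ \text{ on }(0,T)\times\partial\Omega,\qquad i=0,\dots,n.$$ If the initial data $u(0,\cdot)$ and $\tilde u(0,\cdot)$ agree a.e. on $\Omega$, then $$u=\tilde u\quad\text{a.e. in }\Omega\times(0,T).$$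
   Context: Here $T>0$, $n\ge1$ is an integer, $\Omega\subset\mathbb R^d$ is a bounded regular (smooth) domain with unit outward normal $\mathbf n$ (for $d=1$, a bounded interval), and $(K_{ij})_{0\le i\ne j\le n}$ are real coefficients. Set $$K^+:=\max_{0\le i\ne j\le n}K_{ij},\quad K^-:=\min_{0\le i\ne j\le n}K_{ij},\quad K:=\frac{K^++K^-}{2},\quad \kappa:=\frac{K^+-K^-}{2}.$$ $\overline{\mathcal P}:=\{(u_0,\dots,u_n)\in[0,\infty)^{n+1}:\ \sum_{i=0}^n u_i=1\}$. Weak solution: $\tilde u=(\tilde u_0,\dots,\tilde u_n)$ with $\tilde u\in L^2_{\rm loc}((0,T);H^1(\Omega;\mathbb R^{n+1}))$, $\partial_t\tilde u\in L^2_{\rm loc}((0,T);(H^1(\Omega;\mathbb R^{n+1}))')$, $\tilde u(t,x)\in\overline{\mathcal P}$ for almost all $(t,x)\in(0,T)\times\Omega$, and, for each $i=0,\dots,n$, every $\varphi\in H^1(\Omega)$ and a.e. $t\in(0,T)$, $$\langle\partial_t\tilde u_i,\varphi\rangle+\int_\Omega\sum_{j\ne i}K_{ij}(\tilde u_j\nabla\tilde u_i-\tilde u_i\nabla\tilde u_j)\cdot\nabla\varphi\,dx=0$$ (the no-flux boundary condition being incorporated in this formulation). Its initial value $\tilde u(0,\cdot)$ is attained in the sense of $(H^1(\Omega;\mathbb R^{n+1}))'$ as $t\to0^+$. Strong solution: $u\in[L^2((0,T),H^2(\Omega))\cap H^1((0,T),L^2(\Omega))]^{n+1}$ with $u(t,x)\in\overline{\mathcal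 P}$ for almost all $(t,x)$, satisfying the equations a.e. in $(0,T)\times\Omega$, the boundary conditions a.e. on $(0,T)\times\partial\Omega$, and $u(0,\cdot)=u^0$ (well-defined since such $u$ lies in $C([0,T];H^1(\Omega))^{n+1}$). *)

(* Defs.v *)
From HB Require Import structures.
From mathcomp Require Import all_boot all_order all_algebra.
From mathcomp Require Import all_classical all_reals all_analysis.

Set Implicit Arguments.
Unset Strict Implicit.
Unset Printing Implicit Defensive.

Import Order.TTheory GRing.Theory Num.Theory.
Import numFieldNormedType.Exports.
Local Open Scope classical_set_scope.
Local Open Scope ring_scope.

(* MathComp-Analysis throughout.  Lebesgue measure lives on the Borel sets of  *)
(* R, so "measurable" means Borel; every Lebesgue class has a Borel            *)
(* representative, and [\ae] only asks for a Borel null superset.              *)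

Notation lmeas R := (@lebesgue_measure R).
Notation lmeas2 R := (lmeas R \x lmeas R)%E.

(* C_c^oo(]a, b[) *)
Definition test_fun (R : realType) (a b : R) (phi : R -> R) : Prop :=
  (forall (k : nat) (x : R), derivable (derive1n k phi) x 1) /\
  exists c d : R, [/\ a < c, d < b & forall x, phi x != 0 -> c <= x <= d].

Definition is_wderiv (R : realType) (a b : R) (f g : R -> R) : Prop :=
  [/\ locally_integrable `]a, b[ f, locally_integrable `]a, b[ g &
   forall phi, test_fun a b phi ->
     \int[lmeas R]_(x in `]a, b[) (f x * derive1 phi x) =
     - \int[lmeas R]_(x in `]a, b[) (g x * phi x)].

(* A chosen representative of the weak derivative, unique up to null sets      *)
(* (and 0 if there is none).                                                   *)
Definition wderiv (R : realType) (a b : R) (f : R -> R) : R -> R :=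
  xget (fun=> 0) [set g | is_wderiv a b f g].

Definition L2sq (R : realType) (a b : R) (f : R -> R) : \bar R :=
  (\int[lmeas R]_(x in `]a, b[) (f x ^+ 2)%:E)%E.

Definition in_L2 (R : realType) (a b : R) (f : R -> R) : Prop :=
  measurable_fun `]a, b[ f /\ (L2sq a b f < +oo)%E.

Definition in_H1 (R : realType) (a b : R) (f : R -> R) : Prop :=
  [/\ in_L2 a b f, is_wderiv a b f (wderiv a b f) & in_L2 a b (wderiv a b f)].

Definition in_H2 (R : realType) (a b : R) (f : R -> R) : Prop :=
  in_H1 a b f /\ in_H1 a b (wderiv a b f).

Definition L2norm (R : realType) (a b : R) (f : R -> R) : \bar R :=
  sqrte (L2sq a b f).

Definition H1norm (R : realType) (a b : R) (f : R -> R) : \bar R :=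
  sqrte (L2sq a b f + L2sq a b (wderiv a b f))%E.

Definition H2norm (R : realType) (a b : R) (f : R -> R) : \bar R :=
  sqrte (L2sq a b f + L2sq a b (wderiv a b f)
         + L2sq a b (wderiv a b (wderiv a b f)))%E.

(* (H^1)': functionals are total on R -> R, but only their restriction to H^1  *)
(* matters.                                                                    *)
Definition H1dual_norm (R : realType) (a b : R) (G : (R -> R) -> R) : \bar R :=
  ereal_sup [set `|G phi|%:E | phi in
    [set phi | in_H1 a b phi /\ (H1norm a b phi <= 1)%E]].

Definition in_H1dual (R : realType) (a b : R) (G : (R -> R) -> R) : Prop :=
  (forall (c : R) (f g : R -> R), in_H1 a b f -> in_H1 a b g ->
     G (fun x => c * f x + g x) = c * G f + G g) /\
  (H1dual_norm a b G < +oo)%E.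

(* The embedding of L^2 into (H^1)' (and of L^2 into its own dual). *)
Definition L2pair (R : realType) (a b : R) (f phi : R -> R) : R :=
  \int[lmeas R]_(x in `]a, b[) (f x * phi x).

(* Bochner spaces L^2(J; X).  X is a set of functions on S, closed under the   *)
(* pointwise linear operations and (semi)normed by N: S := R for function      *)
(* spaces on an interval, S := R -> R for the dual space.                      *)

Definition simple_valued (R : realType) (S : Type) (X : set (S -> R))
    (s : R -> S -> R) : Prop :=
  exists (m : nat) (A : 'I_m -> set R) (v : 'I_m -> S -> R),
    [/\ forall l, measurable (A l), forall l, X (v l) &
        forall t y, s t y = \sum_(l < m) \1_(A l) t * v l y].

Definition strongly_measurable (R : realType) (S : Type) (X : set (S -> R))
    (N : (S -> R) -> \bar R) (J : set R) (u : R -> S -> R) : Prop :=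
  (\forall t \ae lmeas R, J t -> X (u t)) /\
  exists s : nat -> R -> S -> R,
    (forall k, simple_valued X (s k)) /\
    (\forall t \ae lmeas R, J t ->
       (fun k => N (fun y => s k t y - u t y)) @ \oo --> (0 : \bar R)%E).

Definition bochner_L2 (R : realType) (S : Type) (X : set (S -> R))
    (N : (S -> R) -> \bar R) (J : set R) (u : R -> S -> R) : Prop :=
  strongly_measurable X N J u /\
  (\int[lmeas R]_(t in J) (N (u t) * N (u t)) < +oo)%E.

Definition bochner_L2loc (R : realType) (S : Type) (X : set (S -> R))
    (N : (S -> R) -> \bar R) (T : R) (u : R -> S -> R) : Prop :=
  forall r s : R, 0 < r -> r < s -> s < T -> bochner_L2 X N `[r, s] u.

(* V is the distributional time derivative of U on ]0, T[: the identity        *)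
(*   int_0^T U eta' dt = - int_0^T V eta dt    for all eta in C_c^oo(]0, T[)   *)
(* between functionals on Y is read after evaluation at each element of Y.     *)
Definition is_time_deriv (R : realType) (T : R) (Y : set (R -> R))
    (U V : R -> (R -> R) -> R) : Prop :=
  forall phi, Y phi -> is_wderiv 0 T (fun t => U t phi) (fun t => V t phi).

(* u has a representative that is continuous on J with values in (X, N) and    *)
(* that takes the value u0 at time 0 (used with 0 in J).                       *)
Definition has_initial_value (R : realType) (S : Type) (X : set (S -> R))
    (N : (S -> R) -> \bar R) (J : set R) (u : R -> S -> R) (u0 : S -> R)
    : Prop :=
  exists U : R -> S -> R,
    [/\ forall t, J t -> X (U t),
        forall t, J t -> forall e : R, 0 < e -> exists2 d : R, 0 < d &
          forall s, J s -> `|s - t| < d ->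
            (N (fun y => U s y - U t y)%R < e%:E)%E,
        \forall t \ae lmeas R, J t ->
          X (u t) /\ N (fun y => U t y - u t y) = 0%E &
        X u0 /\ N (fun y => U 0%R y - u0 y) = 0%E].

(* ]0, T[ x Omega with Omega = ]a, b[ *)
Definition cylinder (R : realType) (T a b : R) : set (R * R) :=
  `]0, T[ `*` `]a, b[.

(* Functions of (t, x) are curried, time first. *)
Definition joint_measurable (R : realType) (T a b : R) (u : R -> R -> R)
    : Prop :=
  measurable_fun (cylinder T a b)
    (fun z : measurableTypeR R * measurableTypeR R => u z.1 z.2).

(* p is a measurable representative on the cylinder of the spatial weak        *)
(* derivative of u ([wderiv], chosen separately at each t, need not be         *)
(* measurable in (t, x)).                                                      *)
Definition is_spatial_deriv (R : realType) (T a b : R) (u p : R -> R -> R)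
    : Prop :=
  joint_measurable T a b p /\
  (\forall t \ae lmeas R, 0 < t < T -> is_wderiv a b (u t) (p t)).

(* The traces at a and b vanish; on the boundary of an interval the outward    *)
(* normal is -1 or 1, so this is also the vanishing of the normal component.   *)
Definition zero_trace (R : realType) (a b : R) (f : R -> R) : Prop :=
  exists g : R -> R,
    [/\ {within `[a, b], continuous g},
        \forall x \ae lmeas R, a < x < b -> f x = g x, g a = 0 & g b = 0].

Definition in_simplex (R : realType) (n : nat) (y : 'I_n.+1 -> R) : Prop :=
  (forall i, 0 <= y i) /\ \sum_i y i = 1.

(* K is a total function, but its diagonal is never used.  For n >= 1 the      *)
(* starting value K_{0n} of the max and the min is one of the K_ij, i <> j.    *)
Definition Kplus (R : realType) (n : nat) (K : 'I_n.+1 -> 'I_n.+1 -> R) : R :=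
  \big[Num.max/K ord0 ord_max]_(ij : 'I_n.+1 * 'I_n.+1 | ij.1 != ij.2)
    K ij.1 ij.2.

Definition Kminus (R : realType) (n : nat) (K : 'I_n.+1 -> 'I_n.+1 -> R) : R :=
  \big[Num.min/K ord0 ord_max]_(ij : 'I_n.+1 * 'I_n.+1 | ij.1 != ij.2)
    K ij.1 ij.2.

Definition Kmean (R : realType) (n : nat) (K : 'I_n.+1 -> 'I_n.+1 -> R) : R :=
  (Kplus K + Kminus K) / 2.

Definition Kgap (R : realType) (n : nat) (K : 'I_n.+1 -> 'I_n.+1 -> R) : R :=
  (Kplus K - Kminus K) / 2.

(* p stands for the spatial gradient of u *)
Definition flux (R : realType) (n : nat) (K : 'I_n.+1 -> 'I_n.+1 -> R)
    (u p : 'I_n.+1 -> R -> R -> R) (i : 'I_n.+1) (t x : R) : R :=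
  \sum_(j | j != i) K i j * (u j t x * p i t x - u i t x * p j t x).

(* Below, vector-valued spaces are products of scalar ones and are spelled out *)
(* componentwise: H^1(Omega; R^(n+1)) = H^1(Omega)^(n+1), and likewise for the *)
(* dual.                                                                       *)

(* Weak solution u with initial value u0; p = grad u, G = d_t u. *)
Definition weak_solution (R : realType) (n : nat) (T a b : R)
    (K : 'I_n.+1 -> 'I_n.+1 -> R) (u : 'I_n.+1 -> R -> R -> R)
    (u0 : 'I_n.+1 -> R -> R) : Prop :=
  exists (p : 'I_n.+1 -> R -> R -> R) (G : 'I_n.+1 -> R -> (R -> R) -> R),
    (forall i, [/\ joint_measurable T a b (u i),
       bochner_L2loc (in_H1 a b) (H1norm a b) T (u i) &
       is_spatial_deriv T a b (u i) (p i)]) /\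
    (forall i, bochner_L2loc (in_H1dual a b) (H1dual_norm a b) T (G i) /\
       is_time_deriv T (in_H1 a b) (fun t => L2pair a b (u i t)) (G i)) /\
    (\forall z \ae lmeas2 R, cylinder T a b z ->
       in_simplex (fun i => u i z.1 z.2)) /\
    (forall i phi, in_H1 a b phi ->
       \forall t \ae lmeas R, 0 < t < T ->
         G i t phi + \int[lmeas R]_(x in `]a, b[)
           (flux K u p i t x * wderiv a b phi x) = 0) /\
    (forall i, in_L2 a b (u0 i) /\
       has_initial_value (in_H1dual a b) (H1dual_norm a b) `[0, T[
         (fun t => L2pair a b (u i t)) (L2pair a b (u0 i))).

(* Strong solution u with initial value u0; p = grad u, v = d_t u and q is the *)
(* divergence of the flux.                                                     *)
Definition strong_solution (R : realType) (n : nat) (T a b : R)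
    (K : 'I_n.+1 -> 'I_n.+1 -> R) (u : 'I_n.+1 -> R -> R -> R)
    (u0 : 'I_n.+1 -> R -> R) : Prop :=
  exists p v q : 'I_n.+1 -> R -> R -> R,
    (forall i, [/\ joint_measurable T a b (u i),
       bochner_L2 (in_H2 a b) (H2norm a b) `]0, T[ (u i) &
       is_spatial_deriv T a b (u i) (p i)]) /\
    (forall i, [/\ joint_measurable T a b (v i),
       bochner_L2 (in_L2 a b) (L2norm a b) `]0, T[ (u i),
       bochner_L2 (in_L2 a b) (L2norm a b) `]0, T[ (v i) &
       is_time_deriv T (in_L2 a b) (fun t => L2pair a b (u i t))
         (fun t => L2pair a b (v i t))]) /\
    (\forall z \ae lmeas2 R, cylinder T a b z ->
       in_simplex (fun i => u i z.1 z.2)) /\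
    (forall i, is_spatial_deriv T a b (flux K u p i) (q i)) /\
    (forall i, \forall z \ae lmeas2 R, cylinder T a b z ->
       v i z.1 z.2 - q i z.1 z.2 = 0) /\
    (forall i, \forall t \ae lmeas R, 0 < t < T -> zero_trace a b (p i t)) /\
    (forall i, has_initial_value (in_H1 a b) (H1norm a b) `[0, T]
       (u i) (u0 i)).

(* Main.v *)
(* Let [w = u - ut], let [p], [pt] be the gradients of [u], [ut], and write the flux as
   [A(u) p].  For [u] in the simplex, [A(u)] is coercive with constant [K - 2 n kappa] on
   vectors of sum zero.  In [A(u) p - A(ut) pt = A(ut) (p - pt) + A(w) p], tested with
   [p - pt], coercivity handles the first term and Young's inequality the second, so that
   [d/dt |w|^2 <= C |p(t)|_oo^2 |w|^2].  In dimension one [|p(t)|_oo^2] is integrable in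
   time: the flux of the strong solution vanishes at the ends of the interval, hence is
   bounded by the integral of its derivative [|d_t u|], and coercivity of [A(u)] carries
   the bound over to [p].  Gronwall's lemma gives [w = 0].

   The weak solution has a time derivative in the dual of [H^1] only locally in time.
   The energy inequality is therefore derived from the equation integrated in time, by
   difference quotients.  Applied to [ut] alone it shows that [pt] is square integrable
   up to [t = 0]; applied to [w], extended by zero to [t <= 0], it takes care of the
   initial condition. *)

(* For each phi the weak equation holds off a null set of times that depends on phi, so at a fixed
   time it cannot be tested with the solution itself. Integrated over [s, t] and written with the
   representative that is continuous in time, it holds for all s < t and all phi at once; then phi =
   w(t) is allowed. The price is that the increment w(t) - w(t - h) replaces the time derivative and
   a time average replaces the flux. Since only an inequality is wanted, a^2 - b^2 <= 2 (a - b) a is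
   enough on one side and weak L^2 convergence of the averages on the other.

   The resulting inequality relates the energies at almost all times only, and the weak solution
   attains its initial value only in the dual norm, which says nothing on the energy near t = 0. The
   extension by zero supplies good times r < 0 of energy exactly 0. It solves the integrated
   equation because the flux is integrable up to t = 0; this is the use of the separate energy bound
   for [ut].

   The constant K - 2 n kappa comes from K_ij = K + (K_ij - K): equal coefficients act as K times
   the identity on vectors of sum zero, and the deviations are at most kappa. *)
Require Import Defs.
From HB Require Import structures.
From mathcomp Require Import all_boot all_order all_algebra.
From mathcomp Require Import all_classical all_reals all_analysis.
From mathcomp Require Import measurable_realfun measurable_fun_approximation.
From mathcomp Require Import ring lra.

Set Implicit Arguments.
Unset Strict Implicit.
Unset Printing Implicit Defensive.

Import Order.TTheory GRing.Theory Num.Theory.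
Import numFieldNormedType.Exports.
Local Open Scope classical_set_scope.
Local Open Scope ring_scope.

(** * Real-valued integrals *)

Section RealIntegral.
Context d (T : measurableType d) (R : realType).
Variable mu : {measure set T -> \bar R}.
Implicit Types (D : set T) (f g h : T -> R).

Lemma ae_imp (P Q : T -> Prop) :
  (forall x, P x -> Q x) -> (\forall x \ae mu, P x) -> \forall x \ae mu, Q x.
Proof. by move=> PQ; apply: filterS. Qed.

Lemma ae_and (P Q : T -> Prop) :
  (\forall x \ae mu, P x) -> (\forall x \ae mu, Q x) ->
  \forall x \ae mu, P x /\ Q x.
Proof. by move=> aP aQ; apply: filterS2 aP aQ. Qed.

Lemma ae_all (P : T -> Prop) : (forall x, P x) -> \forall x \ae mu, P x.
Proof. by move=> H; exact: aeW. Qed.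

Lemma ae_all_ord (n : nat) (P : 'I_n -> T -> Prop) :
  (forall i, \forall x \ae mu, P i x) -> \forall x \ae mu, forall i, P i x.
Proof.
move=> aP.
have : \forall x \ae mu, forall k : nat, forall i : 'I_n, k = i -> P i x.
  apply/ae_foralln => k; have [kn|nk] := ltnP k n.
    by apply: ae_imp (aP (Ordinal kn)) => x Px i ki; rewrite -(_ : Ordinal kn = i)//; exact: val_inj.
  by apply: ae_all => x i ki; have := ltn_ord i; rewrite -ki ltnNge nk.
by apply: ae_imp => x H i; exact: (H i).
Qed.

Lemma intg_ae_le D f g : measurable D -> measurable_fun D f ->
  mu.-integrable D (EFin \o g) ->
  (\forall x \ae mu, D x -> `|f x| <= g x) ->
  mu.-integrable D (EFin \o f).
Proof.
move=> mD mf /integrableP[mg ig] fg; apply/integrableP.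
split; first exact/measurable_EFinP.
apply: le_lt_trans ig; apply: ae_ge0_le_integral => //.
- by do 2 apply: measurableT_comp => //.
- by apply: measurableT_comp.
- apply: ae_imp fg => x + Dx => /(_ Dx) fg.
  by rewrite /= lee_fin (le_trans fg)// ler_norm.
Qed.

Lemma intg_ae_eq D f g : measurable D -> measurable_fun D f ->
  mu.-integrable D (EFin \o g) ->
  (\forall x \ae mu, D x -> f x = g x) ->
  mu.-integrable D (EFin \o f).
Proof.
move=> mD mf ig fg; apply: (@intg_ae_le D f (fun x => `|g x|)) => //.
  exact: integrable_norm.
by apply: ae_imp fg => x + Dx => /(_ Dx) ->.
Qed.

Lemma ae_eq_Rintegral D f g : measurable D ->
  measurable_fun D f -> measurable_fun D g ->
  (\forall x \ae mu, D x -> f x = g x) ->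
  \int[mu]_(x in D) f x = \int[mu]_(x in D) g x.
Proof.
move=> mD mf mg fg; rewrite /Rintegral; congr fine.
apply: ae_eq_integral => //; try exact/measurable_EFinP.
by apply: ae_imp fg => x + Dx /= => /(_ Dx) ->.
Qed.

Lemma ae_le_Rintegral D f g : measurable D ->
  mu.-integrable D (EFin \o f) -> mu.-integrable D (EFin \o g) ->
  (\forall x \ae mu, D x -> f x <= g x) ->
  \int[mu]_(x in D) f x <= \int[mu]_(x in D) g x.
Proof.
move=> mD intf intg fg.
have [/measurable_EFinP mf _] := elimT (integrableP _ _ _) intf.
have [/measurable_EFinP mg _] := elimT (integrableP _ _ _) intg.
(* [le_Rintegral] compares pointwise, so [g] is replaced by the maximum of [f] and [g], which equals
   it almost everywhere. *)
have mM : measurable_fun D (fun x => Num.max (f x) (g x)).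
  by apply: measurable_maxr.
rewrite (@ae_eq_Rintegral D g (fun x => Num.max (f x) (g x)))//; last first.
  by apply: ae_imp fg => x + Dx => /(_ Dx) H; rewrite max_r.
apply: le_Rintegral => //; last by move=> x Dx; rewrite le_max lexx.
apply: (@intg_ae_eq _ _ g) => //.
by apply: ae_imp fg => x + Dx => /(_ Dx) H; rewrite max_r.
Qed.

Lemma Rdominated_cvg D (f_ : nat -> T -> R) f g : measurable D ->
  (forall n, measurable_fun D (f_ n)) -> measurable_fun D f ->
  mu.-integrable D (EFin \o g) ->
  (\forall x \ae mu, D x -> (fun n => f_ n x) @ \oo --> f x) ->
  (\forall x \ae mu, forall n, D x -> `|f_ n x| <= g x) ->
  (fun n => \int[mu]_(x in D) f_ n x) @ \oo --> \int[mu]_(x in D) f x.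
Proof.
move=> mD mf_ mf ig fc fg.
have [|||||intf _ cv] := @dominated_convergence _ _ _ mu D mD
  (fun n => EFin \o f_ n) (EFin \o f) (EFin \o g).
- by move=> n; exact/measurable_EFinP.
- exact/measurable_EFinP.
- apply: ae_imp fc => x + Dx => /(_ Dx) H.
  by apply: cvg_EFin; first exact: nearW.
- by [].
- by apply: ae_imp fg => x H n Dx; rewrite /= lee_fin; exact: H.
rewrite /Rintegral; apply: fine_cvg; rewrite fineK; first exact: cv.
exact: integrable_fin_num.
Qed.

Lemma intg_cst D (c : R) : measurable D -> (mu D < +oo)%E ->
  mu.-integrable D (EFin \o cst c).
Proof.
move=> mD fD; apply: measurable_bounded_integrable => //.
exists `|c|; split; first exact: num_real.
by move=> x cx y _; rewrite /cst /= ltW.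
Qed.

Lemma intg_bounded D f (M : R) : measurable D -> (mu D < +oo)%E ->
  measurable_fun D f -> (\forall x \ae mu, D x -> `|f x| <= M) ->
  mu.-integrable D (EFin \o f).
Proof.
move=> mD fD mf fM; apply: (@intg_ae_le _ _ (cst M)) => //.
exact: intg_cst.
Qed.

Lemma intg_mul_sq D f g : measurable D ->
  measurable_fun D f -> measurable_fun D g ->
  mu.-integrable D (EFin \o (fun x => f x ^+ 2)) ->
  mu.-integrable D (EFin \o (fun x => g x ^+ 2)) ->
  mu.-integrable D (EFin \o (fun x => f x * g x)).
Proof.
move=> mD mf mg f2 g2.
apply: (@intg_ae_le _ _ (fun x => f x ^+ 2 + g x ^+ 2)) => //.
- exact: measurable_funM.
- exact: integrableD f2 g2.
- apply: ae_all => x _; rewrite normrM -(real_normK (num_real (f x))) -(real_normK (num_real (g x))).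
  have := sqr_ge0 (`|f x| - `|g x|); have := sqr_ge0 (`|f x| + `|g x|); nra.
Qed.

Lemma intg_add_sq D f g : measurable D ->
  measurable_fun D f -> measurable_fun D g ->
  mu.-integrable D (EFin \o (fun x => f x ^+ 2)) ->
  mu.-integrable D (EFin \o (fun x => g x ^+ 2)) ->
  mu.-integrable D (EFin \o (fun x => (f x + g x) ^+ 2)).
Proof.
move=> mD mf mg f2 g2.
apply: (@intg_ae_le _ _ (fun x => 2 * (f x ^+ 2 + g x ^+ 2))) => //.
- by apply: measurable_funX; exact: measurable_funD.
- apply: (@integrableZl _ _ _ mu D mD 2 (EFin \o (fun x => f x ^+ 2 + g x ^+ 2))).
  exact: integrableD f2 g2.
- apply: ae_all => x _; rewrite ger0_norm ?sqr_ge0//.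
  have := sqr_ge0 (f x - g x); nra.
Qed.

Lemma intg_of_sq D f : measurable D -> (mu D < +oo)%E ->
  measurable_fun D f ->
  mu.-integrable D (EFin \o (fun x => f x ^+ 2)) ->
  mu.-integrable D (EFin \o f).
Proof.
move=> mD fD mf f2.
apply: (@intg_ae_le _ _ (fun x => 1 + f x ^+ 2)) => //.
- have : mu.-integrable D (EFin \o cst (1:R)) by exact: intg_cst.
  by move=> i1; exact: integrableD i1 f2.
- apply: ae_all => x _; have := sqr_ge0 (`|f x| - 1).
  rewrite -[f x ^+ 2](real_normK (num_real (f x))); have := normr_ge0 (f x); nra.
Qed.

Lemma intgD D f g : measurable D ->
  mu.-integrable D (EFin \o f) -> mu.-integrable D (EFin \o g) ->
  mu.-integrable D (EFin \o (fun x => f x + g x)).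
Proof. by move=> mD f1 g1; exact: integrableD f1 g1. Qed.

Lemma intgB D f g : measurable D ->
  mu.-integrable D (EFin \o f) -> mu.-integrable D (EFin \o g) ->
  mu.-integrable D (EFin \o (fun x => f x - g x)).
Proof. by move=> mD f1 g1; exact: integrableB f1 g1. Qed.

Lemma intgZ D f (k : R) : measurable D ->
  mu.-integrable D (EFin \o f) -> mu.-integrable D (EFin \o (fun x => k * f x)).
Proof. by move=> mD f1; exact: (@integrableZl _ _ _ mu D mD k _ f1). Qed.

Lemma intgN D f : measurable D ->
  mu.-integrable D (EFin \o f) -> mu.-integrable D (EFin \o (fun x => - f x)).
Proof.
move=> mD f1; have := intgZ (-1) mD f1; apply: eq_integrable => // x _.
by rewrite /= mulN1r.
Qed.

Lemma intg_measurable D f : measurable D ->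
  mu.-integrable D (EFin \o f) -> measurable_fun D f.
Proof. by move=> mD /integrableP[/measurable_EFinP]. Qed.

Lemma intgS D E f : measurable D -> measurable E -> D `<=` E ->
  mu.-integrable E (EFin \o f) -> mu.-integrable D (EFin \o f).
Proof. by move=> mD mE DE; exact: integrableS. Qed.

Lemma intg_sum D (I : Type) (s : seq I) (F : I -> T -> R) : measurable D ->
  (forall i, mu.-integrable D (EFin \o F i)) ->
  mu.-integrable D (EFin \o (fun x => \sum_(i <- s) F i x)).
Proof.
move=> mD iF; elim: s => [|i s IH].
  apply: (@eq_integrable _ _ _ _ _ mD (cst 0%E)); last exact: integrable0.
  by move=> x _; rewrite /= big_nil.
have := intgD mD (iF i) IH; apply: eq_integrable => // x _.
by rewrite /= big_cons.
Qed.

Lemma Rintegral_sum D (I : Type) (s : seq I) (F : I -> T -> R) : measurable D ->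
  (forall i, mu.-integrable D (EFin \o F i)) ->
  \int[mu]_(x in D) (\sum_(i <- s) F i x) = \sum_(i <- s) \int[mu]_(x in D) F i x.
Proof.
move=> mD iF; elim: s => [|i s IH].
  rewrite big_nil; under eq_Rintegral do rewrite big_nil.
  by rewrite /Rintegral integral0.
under eq_Rintegral do rewrite big_cons.
by rewrite RintegralD// ?IH ?big_cons//; exact: intg_sum.
Qed.

Lemma Rintegral_EFin D f : measurable D -> mu.-integrable D (EFin \o f) ->
  (\int[mu]_(x in D) (f x)%:E)%E = (\int[mu]_(x in D) f x)%:E.
Proof.
by move=> mD i; rewrite /Rintegral fineK//; exact: integrable_fin_num.
Qed.

(* No measurability is asked of the larger function. *)
Lemma ge0_le_integral_nonmeas D (f g : T -> \bar R) : measurable D ->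
  measurable_fun D f -> (forall x, D x -> 0 <= f x)%E ->
  (forall x, D x -> 0 <= g x)%E ->
  (\forall x \ae mu, D x -> (f x <= g x)%E) ->
  (\int[mu]_(x in D) f x <= \int[mu]_(x in D) g x)%E.
Proof.
move=> mD mf f0 g0 [N [mN N0 sN]].
rewrite (ge0_negligible_integral mN)//.
rewrite integral_mkcond [leRHS]integral_mkcond.
(* The integral of a nonnegative function is a supremum over the simple functions below it, and a
   simple function below [f] restricted to the complement of [N] is below [g]. *)
rewrite !ge0_integralTE; last 2 first.
- by move=> x; rewrite patchE; case: ifPn => // /set_mem; exact: g0.
- by move=> x; rewrite patchE; case: ifPn => // /set_mem[Dx _]; exact: f0.
apply: le_ereal_sup => _ [h hf <-]; exists h => // x.
apply: (le_trans (hf x)); rewrite !patchE; case: ifPn => [/set_mem[Dx Nx]|_].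
  rewrite mem_set//; apply: contrapT => H; apply: Nx; apply: sN => /= K.
  exact/H/K.
by case: ifPn => // /set_mem; exact: g0.
Qed.

(** Cauchy-Schwarz against the constant 1: the integral of (f - c)^2 is a nonnegative quadratic
    polynomial in c, evaluated at the mean c = A / M. *)
Lemma Rintegral_sq_le D f (M : R) : measurable D -> mu.-integrable D (EFin \o f) ->
  mu.-integrable D (EFin \o (fun x => f x ^+ 2)) ->
  mu D = M%:E ->
  (\int[mu]_(x in D) f x) ^+ 2 <= M * \int[mu]_(x in D) (f x ^+ 2).
Proof.
move=> mD f1 f2 DM.
have fD : (mu D < +oo)%E by rewrite DM ltry.
have M0 : 0 <= M by rewrite -lee_fin -DM.
set A := \int[mu]_(x in D) f x; set B := \int[mu]_(x in D) (f x ^+ 2).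
have H (c : R) : 0 <= B - 2 * c * A + c ^+ 2 * M.
  have -> : B - 2 * c * A + c ^+ 2 * M = \int[mu]_(x in D) ((f x ^+ 2 - 2 * c * f x) + c ^+ 2).
    have ic : mu.-integrable D (EFin \o cst (c ^+ 2)) by exact: intg_cst.
    have iz := intgZ (2 * c) mD f1.
    rewrite RintegralD//; last exact: intgB.
    by rewrite RintegralB// RintegralZl// Rintegral_cst// DM.
  by apply: Rintegral_ge0 => x _; have := sqr_ge0 (f x - c); nra.
have [M0'|M0'] := eqVneq M 0.
  rewrite M0' mul0r; have [->|A0] := eqVneq A 0; first by rewrite expr0n.
  (* For M = 0 the polynomial is affine in c, and this c would give it the value -1. *)
  have := H ((B + 1) / (2 * A)); rewrite M0' mulr0 addr0.
  have -> : 2 * ((B + 1) / (2 * A)) * A = B + 1 by field.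
  lra.
have {}M0 : 0 < M by rewrite lt_def M0'.
have := H (A / M).
have -> : B - 2 * (A / M) * A + (A / M) ^+ 2 * M = B - A ^+ 2 / M by field.
by rewrite subr_ge0 ler_pdivrMr// mulrC.
Qed.

Lemma supp_Rintegral D S f : S `<=` D -> (forall x, D x -> ~ S x -> f x = 0) ->
  \int[mu]_(x in D) f x = \int[mu]_(x in S) f x.
Proof.
move=> SD f0; rewrite Rintegral_mkcond [RHS]Rintegral_mkcond; congr Rintegral.
apply/funext => x; rewrite !patchE; case: ifPn => [/set_mem Dx|Dx].
  by case: ifPn => // /negP Sx; apply: f0 => //; move/mem_set.
by rewrite ifF//; apply/negbTE/negP => /set_mem/SD/mem_set; apply/negP.
Qed.

Lemma supp_intg D S f : measurable D -> measurable S -> S `<=` D ->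
  (forall x, D x -> ~ S x -> f x = 0) ->
  mu.-integrable S (EFin \o f) -> mu.-integrable D (EFin \o f).
Proof.
move=> mD mS SD f0; rewrite integrable_mkcond// [in X in _ -> X]integrable_mkcond//.
apply: eq_integrable => // x _; rewrite !patchE; case: ifPn => [/set_mem Sx|Sx].
  by rewrite mem_set//; exact: SD.
case: ifPn => // /set_mem Dx; rewrite /= f0// => Sx'; move/negP : Sx; apply.
exact: mem_set.
Qed.

End RealIntegral.

(** * A smooth step function *)

Section SmoothStep.
Variable R : realType.

(** The classical flat function exp(-1/x) is [flat 0]; the powers of 1/x make the family closed
    under differentiation up to linear combinations. *)
Definition flat (k : nat) (x : R) : R :=
  if 0 < x then x^-1 ^+ k * expR (- x^-1) else 0.

Lemma flat_ge0 k x : 0 <= flat k x.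
Proof.
rewrite /flat; case: ifPn => // x0.
by rewrite mulr_ge0 ?expR_ge0// exprn_ge0// invr_ge0 ltW.
Qed.

(** The exponential series at 1/x contains the term (1/x)^(k+2) / (k+2)!. A quadratic bound forces
    the derivative 0 at the origin, by [is_derive0_quad]. *)
Lemma flat_le k x : `|flat k x| <= (k.+2)`!%:R * x ^+ 2.
Proof.
rewrite ger0_norm ?flat_ge0// /flat; case: ifPn => x0; last first.
  by rewrite mulr_ge0// sqr_ge0.
have y0 : 0 < x^-1 by rewrite invr_gt0.
rewrite expRN ler_pdivrMr ?expR_gt0//.
have := expR_ge1Dxn k.+1 (ltW y0) => H.
have H2 : x^-1 ^+ k.+2 <= k.+2`!%:R * expR x^-1.
  rewrite mulrC -ler_pdivrMr ?ltr0n ?fact_gt0//.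
  by apply: le_trans H; rewrite lerDr.
have -> : x^-1 ^+ k = x^-1 ^+ k.+2 * x ^+ 2.
  by rewrite -addn2 exprD -mulrA -exprMn mulVf ?gt_eqF// expr1n mulr1.
by rewrite [leRHS]mulrAC ler_wpM2r// sqr_ge0.
Qed.

Lemma is_derive0_quad (f : R -> R) (C : R) :
  (forall x, `|f x| <= C * x ^+ 2) -> is_derive (0:R) (1:R) f 0.
Proof.
move=> H.
have f0 : f 0 = 0.
  by apply/normr0_eq0/eqP; rewrite eq_le normr_ge0 andbT (le_trans (H 0))// expr0n/= mulr0.
have C0 : 0 <= C.
  by have := H 1; rewrite expr1n mulr1; exact: le_trans.
suff L : h^-1 *: ((f \o shift 0) (h *: 1) - f 0) @[h --> 0^'] --> (0 : R).
  apply: DeriveDef; last exact: (cvg_lim _ L).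
  by apply/cvg_ex; exists 0.
have : (C * `|h|) @[h --> (0:R)^'] --> (0 : R).
  rewrite [X in _ --> X](_ : 0 = C * `|0 : R|); last by rewrite normr0 mulr0.
  apply: cvgM; first exact: cvg_cst.
  by apply: cvg_within_filter; apply: norm_continuous.
move=> L; apply/cvgrPdist_le => e e0.
move/cvgrPdist_le : L => /(_ e e0).
apply: filterS2 (nbhs_dnbhs_neq (0:R)) => h h0.
rewrite !sub0r !normrN /= normrM normr_id ger0_norm// => L.
apply: le_trans L.
rewrite f0 subr0 addr0 /GRing.scale/= mulr1 normrM normfV ler_pdivrMl ?normr_gt0//.
rewrite (le_trans (H h))//.
by rewrite -(real_normK (num_real h)) expr2 mulrCA lexx.
Qed.

Lemma is_derive_flat k x :
  is_derive x (1:R) (flat k) (- k%:R * flat k.+1 x + flat k.+2 x).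
Proof.
have [x0|x0|->] := ltgtP x 0.
- have -> : - k%:R * flat k.+1 x + flat k.+2 x = 0.
    by rewrite /flat ltNge ltW//= mulr0 addr0.
  apply: (near_eq_is_derive (f:=cst 0)).
  near=> y; rewrite /flat /cst /= ltNge ltW//.
  near: y; exact: lt_nbhsl.
- have -> : - k%:R * flat k.+1 x + flat k.+2 x =
     x^-1 ^+ k * (- (- x ^- 2) * expR (- x^-1)) + expR (- x^-1) * (k%:R * x^-1 ^+ k.-1 * (- x ^- 2)).
    rewrite /flat x0. case: k => [|k] /=.
      by rewrite !expr0; field; rewrite gt_eqF.
    by rewrite !exprVn !exprS; field; rewrite gt_eqF//= expf_neq0 ?gt_eqF.
  apply: (@near_eq_is_derive _ R R (fun y : R => y^-1 ^+ k * expR (- y^-1))).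
    near=> y; rewrite /flat (_ : 0 < y)//; near: y; exact: lt_nbhsr.
  have dV : is_derive x (1:R) (fun y : R => y^-1) (- x ^- 2).
    have := @is_deriveV R id x 1 1 (negbT (gt_eqF x0)) (is_derive_id _ _).
    by rewrite /GRing.scale /= mulr1.
  have dNV : is_derive x (1:R) (fun y : R => - y^-1) (- - x ^- 2) by exact: is_deriveN.
  have dE := @is_derive1_comp R expR (fun y : R => - y^-1) x _ _ (is_derive_expR _) dNV.
  have dX := is_deriveX k dV.
  have := is_deriveM dX dE.
  rewrite /GRing.scale /= => H.
  have -> : (fun y : R => y^-1 ^+ k * expR (- y^-1)) =
      ((fun y : R => y^-1) ^+ k * (expR \o (fun y : R => - y^-1)))%R.
    by apply/funext => y; rewrite exprfctE.
  apply: (is_derive_eq H); rewrite ?exprfctE; ring.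
- have -> : - k%:R * flat k.+1 0 + flat k.+2 0 = 0.
    by rewrite /flat ltxx mulr0 addr0.
  exact: (is_derive0_quad (flat_le k)).
Unshelve. all: by end_near.
Qed.

(* A class of functions closed under differentiation, hence smooth. *)
Inductive smooth_gen : (R -> R) -> Prop :=
| smooth_flat k : smooth_gen (flat k)
| smooth_cst c : smooth_gen (cst c)
| smooth_add f g : smooth_gen f -> smooth_gen g -> smooth_gen (f \+ g)
| smooth_mul f g : smooth_gen f -> smooth_gen g -> smooth_gen (f \* g)
| smooth_inv f : smooth_gen f -> (forall x, f x != 0) ->
    smooth_gen (fun x => (f x)^-1)
| smooth_affine f r c : smooth_gen f -> smooth_gen (fun x => f (r * x + c)).

Lemma smooth_gen_derive f : smooth_gen f ->
  exists2 f', smooth_gen f' & forall x, is_derive x (1:R) f (f' x).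
Proof.
elim=> {f} [k|c|f g _ [f' sf' df] _ [g' sg' dg]|f g sf [f' sf' df] sg [g' sg' dg]
  |f sf [f' sf' df] f0|f r c _ [f' sf' df]].
- exists (((cst (- k%:R)) \* flat k.+1) \+ flat k.+2); last exact: is_derive_flat.
  by do !constructor.
- exists (cst 0); first by constructor.
  by move=> x; exact: is_derive_cst.
- exists (f' \+ g'); first by constructor.
  by move=> x; exact: is_deriveD.
- exists ((f \* g') \+ (g \* f')); first by do !constructor.
  by move=> x; exact: is_deriveM.
- exists (cst (- 1) \* ((fun x => (f x)^-1) \* (fun x => (f x)^-1)) \* f').
    by do !constructor.
  move=> x; apply: (is_derive_eq (is_deriveV (f0 x) (df x))).
  by rewrite /GRing.scale /= mulN1r expr2 invfM.
- exists (cst r \* (fun x => f' (r * x + c))).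
    apply: smooth_mul; [exact: smooth_cst|exact: smooth_affine].
  move=> x.
  have dA : is_derive x (1:R) (fun x : R => r * x + c) r.
    have := @is_deriveD _ R R _ _ _ _ _ _
      (@is_deriveZ _ R R _ r x 1 _ (is_derive_id x (1:R))) (is_derive_cst c x (1:R)).
    by rewrite /GRing.scale /= mulr1 addr0.
  apply: (is_derive_eq (@is_derive1_comp R f (fun x : R => r * x + c) x _ _ (df _) dA)).
  by rewrite mulrC.
Qed.

Lemma smooth_gen_derive1 f : smooth_gen f -> smooth_gen (derive1 f).
Proof.
move=> /smooth_gen_derive[f' sf' df].
suff -> : derive1 f = f' by [].
by apply/funext => x; rewrite derive1E; have [_ ->] := df x.
Qed.

Lemma smooth_gen_derive1n f k : smooth_gen f -> smooth_gen (derive1n k f).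
Proof.
by move=> sf; elim: k => [|k IH] //; rewrite derive1nS; exact: smooth_gen_derive1.
Qed.

Lemma smooth_gen_derivable f k (x : R) : smooth_gen f ->
  derivable (derive1n k f) x 1.
Proof.
by move=> /(smooth_gen_derive1n k)/smooth_gen_derive[f' _ /(_ x)] [].
Qed.

Lemma smooth_gen_continuous f : smooth_gen f -> continuous f.
Proof.
move=> sf x; apply: differentiable_continuous; apply/derivable1_diffP.
by have := @smooth_gen_derivable f 0%N x sf; rewrite derive1n0.
Qed.

(** At every x one of x and 1 - x is positive, so the denominator never vanishes. The argument
    [- 1 * x + 1] has the shape that [smooth_affine] expects. *)
Definition step (x : R) : R := flat 0 x * (flat 0 x + flat 0 (- 1 * x + 1))^-1.

Lemma step_den_gt0 x : 0 < flat 0 x + flat 0 (- 1 * x + 1).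
Proof.
have [x0|x0] := ltP 0 x.
  by rewrite ltr_wpDr ?flat_ge0// /flat x0 expr0 mul1r expR_gt0.
have x1 : 0 < - 1 * x + 1 by lra.
by rewrite ltr_wpDl ?flat_ge0// /flat x1 expr0 mul1r expR_gt0.
Qed.

Lemma smooth_step : smooth_gen step.
Proof.
apply: smooth_mul; first exact: smooth_flat.
apply: (@smooth_inv (flat 0 \+ (fun x => flat 0 (- 1 * x + 1)))).
  apply: smooth_add; first exact: smooth_flat.
  exact/smooth_affine/smooth_flat.
by move=> x; rewrite /= gt_eqF// step_den_gt0.
Qed.

Lemma step_le0 x : x <= 0 -> step x = 0.
Proof. by move=> x0; rewrite /step /flat ltNge x0 mul0r. Qed.

Lemma step_ge1 x : 1 <= x -> step x = 1.
Proof.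
move=> x1; have H : 0 < - 1 * x + 1 = false by apply/negbTE; rewrite -leNgt; lra.
rewrite /step [flat 0 (_ + _)]/flat H addr0 divff//.
by rewrite /flat (lt_le_trans ltr01 x1) expr0 mul1r gt_eqF ?expR_gt0.
Qed.

Lemma step_ge0 x : 0 <= step x.
Proof. by rewrite mulr_ge0 ?flat_ge0// invr_ge0 ltW// step_den_gt0. Qed.

Lemma step_le1 x : step x <= 1.
Proof.
by rewrite ler_pdivrMr ?step_den_gt0// mul1r lerDl flat_ge0.
Qed.

Lemma derive1_step_out x : x < 0 \/ 1 < x -> derive1 step x = 0.
Proof.
move=> x01; rewrite derive1E.
suff [c H] : exists c : R, \near x, cst c x = step x.
  by have [_ ->] := near_eq_is_derive H (is_derive_cst c x (1:R)).
case: x01 => x01.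
  by exists 0; near=> y; rewrite step_le0//; near: y; exact: lt_le_nbhsl.
by exists 1; near=> y; rewrite step_ge1//; near: y; exact: lt_le_nbhsr.
Unshelve. all: by end_near. Qed.

Lemma derive1_step_bounded : exists2 M : R, 0 <= M & forall x, `|derive1 step x| <= M.
Proof.
have ct : continuous (derive1 step).
  exact/smooth_gen_continuous/smooth_gen_derive1/smooth_step.
have ctn : {within `[0, 1]%classic, continuous (fun x => `|derive1 step x|)}.
  apply: continuous_subspaceT => x; apply: continuous_comp; first exact: ct.
  exact: norm_continuous.
have [c _ H] := EVT_max ler01 ctn.
exists (`|derive1 step c|); first exact: normr_ge0.
move=> x.
have [x0|x0] := ltP x 0; first by rewrite derive1_step_out ?normr0//; left.
have [x1|x1] := ltP 1 x; first by rewrite derive1_step_out ?normr0//; right.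
by apply: H; rewrite in_itv/= x0 x1.
Qed.

End SmoothStep.

(** * Weak derivatives on an interval *)

Section WeakDerivative.
Variable R : realType.
Local Notation mu := (@lebesgue_measure R).
Implicit Types (a b c d e : R) (f g : R -> R).

Definition tstep c e (x : R) := step (e^-1 * x + - (e^-1 * c)).

Lemma smooth_tstep c e : smooth_gen (tstep c e).
Proof. exact/smooth_affine/smooth_step. Qed.

(** An approximate identity at c from the right as e tends to 0: supported in [c, c + e], of
    integral 1 and bounded by a constant over e. *)
Definition kern c e : R -> R := derive1 (tstep c e).

Lemma continuous_kern c e : continuous (kern c e).
Proof. exact/smooth_gen_continuous/smooth_gen_derive1/smooth_tstep. Qed.

Lemma tstep_arg c e x : e^-1 * x + - (e^-1 * c) = (x - c) / e.
Proof. by rewrite -mulrBr mulrC. Qed.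

Lemma kernE c e x : kern c e x = e^-1 * derive1 (@step R) ((x - c) / e).
Proof.
rewrite /kern derive1E.
have dA : is_derive x (1:R) (fun x : R => e^-1 * x + - (e^-1 * c)) e^-1.
  have := @is_deriveD _ R R _ _ _ _ _ _
    (@is_deriveZ _ R R _ e^-1 x 1 _ (is_derive_id x (1:R))) (is_derive_cst (- (e^-1 * c)) x (1:R)).
  by rewrite /GRing.scale /= mulr1 addr0.
have [s' _ ds] := smooth_gen_derive (@smooth_step R).
have := @is_derive1_comp R (@step R) _ x _ _ (ds _) dA => -[_].
rewrite /comp -/(tstep c e) => ->.
by rewrite mulrC derive1E tstep_arg; have [_ ->] := ds ((x - c) / e).
Qed.

Lemma kern_out c e x : 0 < e -> ~ `[c, c + e]%classic x -> kern c e x = 0.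
Proof.
move=> e0 /= H; rewrite kernE derive1_step_out ?mulr0//.
have [xc|cx] := ltP x c; [left|right].
  by rewrite pmulr_llt0 ?invr_gt0// subr_lt0.
rewrite ltr_pdivlMr// mul1r ltrBrDl ltNge; apply/negP => xe; apply: H.
by rewrite in_itv/= cx.
Qed.

Lemma tstep_le c e x : 0 < e -> x <= c -> tstep c e x = 0.
Proof.
by move=> e0 xc; rewrite /tstep tstep_arg step_le0// pmulr_lle0 ?invr_gt0// subr_le0.
Qed.

Lemma tstep_ge c e x : 0 < e -> c + e <= x -> tstep c e x = 1.
Proof.
move=> e0 xc; rewrite /tstep tstep_arg step_ge1//.
by rewrite ler_pdivlMr// mul1r lerBrDl.
Qed.

Lemma kern_intg c e : mu.-integrable `[c, c + e]%classic (EFin \o kern c e).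
Proof.
apply: continuous_compact_integrable; first exact: segment_compact.
by apply: continuous_subspaceT; exact: continuous_kern.
Qed.

Lemma kern_Rintegral c e : 0 < e -> \int[mu]_(x in `[c, c + e]) kern c e x = 1.
Proof.
move=> e0; rewrite /Rintegral (@continuous_FTC2 _ (kern c e) (tstep c e)).
- by rewrite tstep_ge// tstep_le//= subr0.
- by rewrite ltrDl.
- by apply: continuous_subspaceT; exact: continuous_kern.
- have ct := smooth_gen_continuous (smooth_tstep c e).
  split.
  + by move=> x _; exact: (@smooth_gen_derivable _ _ 0%N x (smooth_tstep c e)).
  + by apply: cvg_at_right_filter; exact: ct.
  + by apply: cvg_at_left_filter; exact: ct.
- by move=> x _.
Qed.

(* One-sided, since the kernels [kern c e] live on [c, c + e]. *)
Definition right_lebesgue_pt f c := forall h : R, 0 < h -> exists2 dl : R, 0 < dl &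
  forall e, 0 < e -> e < dl ->
    (\int[mu]_(x in `[c, (c + e)%R]) (`|f x - f c|%R)%:E <= (h * e)%:E)%E.

Lemma lebesgue_pt_right f c (U : set R) : open_nbhs c U -> measurable U ->
  measurable_fun U f -> lebesgue_pt f c -> right_lebesgue_pt f c.
Proof.
move=> [oU Uc] mU mf lf h h0.
have [r r0 rU] : exists2 r : R, 0 < r & ball c r `<=` U.
  have := open_nbhs_nbhs (conj oU Uc) => /nbhs_ballP[r /= r0 H].
  by exists r.
(* [c, c + e] lies in the ball of radius 2 e, whose measure is 4 e; hence the quarter. *)
have h8 : (0 : R) < h / 4 by rewrite divr_gt0.
move/fine_cvgP : lf => [lfin /cvgrPdist_lt/(_ _ h8)].
case: lfin => d1 /= d10 H1 [d2 /= d20 H2].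
exists (Num.min (r / 2) (Num.min (d1 / 2) (d2 / 2))).
  by rewrite !lt_min !divr_gt0.
move=> e e0; rewrite !lt_min => /and3P[er e1 e2].
have e20 : 0 < 2 * e by rewrite mulr_gt0.
have B1 : ball (0:R) d1 (2 * e).
  by rewrite /ball/= sub0r normrN gtr0_norm//; lra.
have B2 : ball (0:R) d2 (2 * e).
  by rewrite /ball/= sub0r normrN gtr0_norm//; lra.
have fn := H1 _ B1 e20; have := H2 _ B2 e20; rewrite /= sub0r normrN.
have dp : (0 <= davg f c (2 * e))%E by exact: davg_ge0.
rewrite ger0_norm ?fine_ge0// => Hd.
have {}Hd : (davg f c (2 * e) <= (h / 4)%:E)%E.
  by rewrite -(fineK fn) lee_fin ltW.
have cb : `[c, c + e]%classic `<=` ball c (2 * e).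
  move=> x; rewrite /= in_itv/= => /andP[cx xe]; rewrite /ball/=.
  by rewrite ler0_norm; lra.
have bU : ball c (2 * e) `<=` U.
  by apply: subset_trans rU => x; rewrite /ball/=; lra.
have mc : measurable_fun (ball c (2 * e)) (fun x => (`|f x - f c|)%:E).
  apply/measurable_EFinP; apply: measurableT_comp => //; apply: measurable_funB => //.
  exact: measurable_funS mf.
apply: (@le_trans _ _ (\int[mu]_(x in ball c (2 * e)%R) (`|f x - f c|%R)%:E)%E).
  by apply: ge0_subset_integral => //; exact: measurable_ball.
move: Hd; rewrite /davg /iavg lebesgue_measure_ball ?(ltW e20)//.
have I0 : (0 <= \int[mu]_(x in ball c (2 * e)) (`|f x - f c|%R)%:E)%E by exact: integral_ge0.
have -> : (\int[mu]_(y in ball c (2 * e)%R) `|((center (f c) \o f) y)%:E| =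
  \int[mu]_(x in ball c (2 * e)%R) (`|f x - f c|%R)%:E)%E by apply: eq_integral.
rewrite inver ifF; last by apply/negbTE; rewrite mulrn_eq0/= gt_eqF.
move=> H.
have -> : ((h * e)%R%:E = ((2 * e) *+ 2)%R%:E * (h / 4)%R%:E)%E.
  by rewrite -EFinM; congr EFin; rewrite mulr2n; field.
rewrite -lee_pdivrMl//.
by rewrite mulr2n addr_gt0.
Qed.

Lemma ae_right_lebesgue_pt a b f : mu.-integrable `]a, b[%classic (EFin \o f) ->
  \forall c \ae mu, a < c < b -> right_lebesgue_pt f c.
Proof.
move=> fi.
have := lebesgue_differentiation (integrable_locally_restrict (measurable_itv _) fi).
apply: ae_imp => c lc cab.
have oc : open_nbhs c `]a, b[%classic.
  by split; [exact: interval_open|rewrite /= in_itv/=].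
have mf : measurable_fun `]a, b[%classic f by apply: intg_measurable fi.
have H : right_lebesgue_pt (f \_ `]a, b[%classic) c.
  apply: (lebesgue_pt_right oc) lc; first exact: measurable_itv.
  apply: measurable_funS (measurableT) (@subsetT _ _) _.
  by apply/(measurable_restrictT _ _).1.
move=> h h0; have [dl dl0 Hd] := H _ h0.
move: cab => /andP[ac cb].
exists (Num.min dl (b - c)); first by rewrite lt_min dl0 subr_gt0.
move=> e e0; rewrite lt_min => /andP[edl ebc].
rewrite (le_trans _ (Hd _ e0 edl))//.
rewrite le_eqVlt; apply/orP; left; apply/eqP; apply: eq_integral => x.
rewrite inE/= in_itv/= => /andP[cx xce]; rewrite !patchE !mem_set//=.
- by rewrite in_itv/= ac cb.
- by rewrite in_itv/= (lt_le_trans ac cx) (le_lt_trans xce)// -ltrBrDl.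
Qed.

Lemma continuous_right_lebesgue_pt a b f c : a < c < b ->
  measurable_fun `]a, b[%classic f -> {for c, continuous f} ->
  right_lebesgue_pt f c.
Proof.
move=> cab mf fc.
have oc : open_nbhs c `]a, b[%classic.
  by split; [exact: interval_open|rewrite /= in_itv/=].
apply: (lebesgue_pt_right oc) => //.
by apply: (continuous_lebesgue_pt oc).
Qed.

Lemma seq_div_cvg0 (e0 : R) : (fun k : nat => e0 / k.+1%:R) @ \oo --> (0 : R).
Proof.
rewrite -[X in _ --> X](mulr0 e0); apply: cvgM; first exact: cvg_cst.
exact: cvg_harmonic.
Qed.

Lemma seq_div_gt0 (e0 : R) k : 0 < e0 -> 0 < e0 / k.+1%:R.
Proof. by move=> ?; rewrite divr_gt0. Qed.

Lemma seq_div_le (e0 : R) k : 0 < e0 -> e0 / k.+1%:R <= e0.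
Proof.
move=> ?; by rewrite ler_pdivrMr// ler_peMr ?ler1n// ltW.
Qed.

Lemma seq_div_near (e0 dl : R) : 0 < dl -> 
  \forall k \near \oo, e0 / k.+1%:R < dl.
Proof.
move=> dl0; have /cvgrPdist_lt/(_ _ dl0) := seq_div_cvg0 e0.
by apply: filterS => k; rewrite sub0r normrN; apply: le_lt_trans; exact: ler_norm.
Qed.

Lemma kern_mul_intg c e e0 f : 0 < e -> e <= e0 ->
  mu.-integrable `[c, c + e0]%classic (EFin \o f) ->
  mu.-integrable `[c, c + e]%classic (EFin \o (fun x => f x * kern c e x)).
Proof.
move=> e_gt0 ee0 fi.
have [M M0 HM] := derive1_step_bounded R.
have fi' : mu.-integrable `[c, c + e]%classic (EFin \o f).
  apply: intgS fi => //; apply: subset_itvl; rewrite bnd_simp; lra.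
have mf : measurable_fun `[c, c + e]%classic f by apply: intg_measurable fi'.
apply: (@intg_ae_le _ _ _ mu _ _ (fun x => M / e * `|f x|)) => //.
- apply: measurable_funM => //; apply: measurable_funTS.
  by apply: continuous_measurable_fun; exact: continuous_kern.
- by apply: intgZ => //; exact: integrable_norm.
- apply: ae_all => x _; rewrite normrM mulrC ler_wpM2r// kernE normrM.
  by rewrite gtr0_norm ?invr_gt0// mulrC ler_wpM2r// invr_ge0 ltW.
Qed.

(** As the kernel has integral 1 and is at most M / e, the error is at most M / e times the integral
    of |f - f c| over [c, c + e], and c is a Lebesgue point from the right. *)
Lemma kern_avg c e0 f : 0 < e0 ->
  mu.-integrable `[c, c + e0]%classic (EFin \o f) -> right_lebesgue_pt f c ->
  (fun k => \int[mu]_(x in `[c, c + e0 / k.+1%:R]) (f x * kern c (e0 / k.+1%:R) x))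
    @ \oo --> f c.
Proof.
move=> e00 fi lf; have [M M0 HM] := derive1_step_bounded R.
apply/cvgrPdist_le => h h0.
have M1 : 0 < M + 1 by rewrite ltr_pwDr.
have [dl dl0 Hd] := lf (h / (M + 1)) (divr_gt0 h0 M1).
near=> k.
set e := e0 / k.+1%:R.
have e_gt0 : 0 < e by exact: seq_div_gt0.
have ee0 : e <= e0 by exact: seq_div_le.
have edl : e < dl by rewrite /e; near: k; exact: seq_div_near.
have fi' : mu.-integrable `[c, c + e]%classic (EFin \o f).
  apply: intgS fi => //; apply: subset_itvl; rewrite bnd_simp; lra.
have fki := kern_mul_intg e_gt0 ee0 fi.
have ci : mu.-integrable `[c, c + e]%classic (EFin \o (fun x => f c * kern c e x)).
  by apply: intgZ => //; exact: kern_intg.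
have -> : f c = \int[mu]_(x in `[c, c + e]) (f c * kern c e x).
  by rewrite RintegralZl ?kern_Rintegral ?mulr1//; exact: kern_intg.
rewrite -RintegralB//.
have fin : (mu `[c, (c + e)%R]%classic < +oo)%E.
  by rewrite /= lebesgue_measure_itv/=; case: ifP => _; rewrite ?ltry.
have cst_i : mu.-integrable `[c, c + e]%classic (EFin \o cst (f c)) by exact: intg_cst.
have fci : mu.-integrable `[c, c + e]%classic (EFin \o (fun x => f x - f c)) by exact: intgB.
apply: le_trans (le_normr_Rintegral _ _) _ => //; first exact: intgB.
have iN : mu.-integrable `[c, c + e]%classic (EFin \o (fun x => `|f x - f c|)).
  exact: integrable_norm fci.
apply: (@le_trans _ _ (\int[mu]_(x in `[c, c + e]) (M / e * `|f x - f c|))).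
  apply: le_Rintegral => //.
  - by apply: integrable_norm; exact: intgB.
  - exact: intgZ.
  - move=> x _; rewrite -mulrBl normrM mulrC distrC ler_wpM2r// kernE normrM.
    by rewrite gtr0_norm ?invr_gt0// mulrC ler_wpM2r// invr_ge0 ltW.
rewrite RintegralZl//.
have {}Hd := Hd _ e_gt0 edl.
have {}Hd : \int[mu]_(x in `[c, c + e]) `|f x - f c| <= h / (M + 1) * e.
  by rewrite -lee_fin -Rintegral_EFin.
apply: (@le_trans _ _ (M / e * (h / (M + 1) * e))).
  by rewrite ler_wpM2l// divr_ge0// ltW.
have -> : M / e * (h / (M + 1) * e) = M * h / (M + 1) by field; rewrite !gt_eqF.
by rewrite ler_pdivrMr// mulrC ler_wpM2l ?ltW// ltrDl.
Unshelve. all: by end_near. Qed.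

Lemma locally_integrable_itv a b c d f : locally_integrable `]a, b[%classic f ->
  a < c -> d < b -> mu.-integrable `[c, d]%classic (EFin \o f).
Proof.
move=> [mf _ lf] ac db; apply/integrableP; split.
  apply/measurable_EFinP; apply: measurable_funS mf => //.
  by apply: subset_itvSoo; rewrite bnd_simp.
have := lf `[c, d]%classic; apply; last exact: segment_compact.
by apply: subset_itvSoo; rewrite bnd_simp.
Qed.

(** A test function that tends to the indicator of ]c, d] while its derivative is a difference of
    two approximate identities; it turns integration by parts against test functions into the
    fundamental theorem of calculus. *)
Definition bumps c d e : R -> R := fun x => tstep c e x - tstep d e x.

Lemma smooth_bumps c d e : smooth_gen (bumps c d e).
Proof.
have -> : bumps c d e = tstep c e \+ (cst (- 1) \* tstep d e).
  by apply/funext => x; rewrite /bumps /= mulN1r.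
apply: smooth_add; first exact: smooth_tstep.
apply: smooth_mul; [exact: smooth_cst|exact: smooth_tstep].
Qed.

Lemma derive1_bumps c d e x : derive1 (bumps c d e) x = kern c e x - kern d e x.
Proof.
rewrite /kern !derive1E.
have := @smooth_gen_derivable _ _ 0%N x (smooth_tstep c e).
have := @smooth_gen_derivable _ _ 0%N x (smooth_tstep d e).
by rewrite !derive1n0 => dd dc; rewrite -deriveB.
Qed.

Lemma bumps_out c d e x : 0 < e -> c < d -> bumps c d e x != 0 -> c <= x <= d + e.
Proof.
move=> e0 cd; apply: contra_neqT; rewrite negb_and -!ltNge => /orP[xc|dx].
  by rewrite /bumps !tstep_le ?subr0//; lra.
by rewrite /bumps !tstep_ge ?subrr//; lra.
Qed.

Lemma bumps_norm_le1 c d e x : `|bumps c d e x| <= 1.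
Proof.
rewrite ler_norml /bumps /tstep.
have := step_ge0 (e^-1 * x + - (e^-1 * c)); have := step_le1 (e^-1 * x + - (e^-1 * c)).
have := step_ge0 (e^-1 * x + - (e^-1 * d)); have := step_le1 (e^-1 * x + - (e^-1 * d)).
lra.
Qed.

Lemma bumps_cvg c d e0 x : 0 < e0 -> c < d ->
  (fun k => bumps c d (e0 / k.+1%:R) x) @ \oo --> (\1_(`]c, d]%classic) x : R).
Proof.
move=> e00 cd.
have T y : (fun k => tstep y (e0 / k.+1%:R) x) @ \oo --> ((y < x)%R%:R : R).
  have [xy|yx] := leP x y.
    apply: cvg_near_cst; apply: nearW => k.
    by rewrite tstep_le ?seq_div_gt0.
  apply: cvg_near_cst; near=> k.
  rewrite tstep_ge ?seq_div_gt0// -lerBrDl ltW//.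
  near: k; apply: seq_div_near; by rewrite subr_gt0.
have -> : \1_(`]c, d]%classic) x = (c < x)%R%:R - (d < x)%R%:R :> R.
  rewrite indicE mem_setE in_itv/=.
  have [cx|xc] := ltP c x; have [dx|xd] := ltP d x; rewrite /= ?subrr ?subr0//.
  by exfalso; lra.
exact: cvgB.
Unshelve. all: by end_near. Qed.

(** In the identity tested with [bumps], the left-hand side tends to f c - f d by [kern_avg] and the
    right-hand side converges by dominated convergence. Lebesgue points take the place of a
    continuous representative. *)
Lemma is_wderiv_ftc a b f g c d : is_wderiv a b f g ->
  a < c -> c < d -> d < b -> right_lebesgue_pt f c -> right_lebesgue_pt f d ->
  f d - f c = \int[mu]_(x in `[c, d]) g x.
Proof.
move=> [lf lg Hw] ac cd db lc ld.
(* Room to the right of d: [bumps] comes back to 0 only at d + e. *)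
set e0 := (b - d) / 2.
have e00 : 0 < e0 by rewrite /e0 divr_gt0// subr_gt0.
have deb : d + e0 < b by rewrite /e0; lra.
set K := `[c, d + e0]%classic.
have mK : measurable K by rewrite /K.
have KS : K `<=` `]a, b[%classic by apply: subset_itvSoo; rewrite bnd_simp.
have fK : mu.-integrable K (EFin \o f) by apply: (locally_integrable_itv lf).
have gK : mu.-integrable K (EFin \o g) by apply: (locally_integrable_itv lg).
have mg : measurable_fun K g by exact: intg_measurable gK.
set e := fun k : nat => e0 / k.+1%:R.
have e_gt0 k : 0 < e k by exact: seq_div_gt0.
have ee0 k : e k <= e0 by exact: seq_div_le.
have L1 : (fun k => \int[mu]_(x in `]a, b[) (f x * derive1 (bumps c d (e k)) x)) @ \oo
    --> f c - f d.
  have fc0 : mu.-integrable `[c, c + e0]%classic (EFin \o f).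
    by apply: intgS fK => //; apply: subset_itvl; rewrite bnd_simp; lra.
  have fd0 : mu.-integrable `[d, d + e0]%classic (EFin \o f).
    by apply: intgS fK => //; apply: subset_itvr; rewrite bnd_simp; lra.
  have C := cvgB (kern_avg e00 fc0 lc) (kern_avg e00 fd0 ld).
  rewrite (_ : (fun k => _) = (fun k =>
    \int[mu]_(x in `[c, c + e k]) (f x * kern c (e k) x) -
    \int[mu]_(x in `[d, d + e k]) (f x * kern d (e k) x))); first exact: C.
  apply/funext => k.
  have sub y : a < y -> y <= d -> `[y, y + e k]%classic `<=` `]a, b[%classic.
    move=> ay yd; apply: subset_itvSoo; rewrite bnd_simp//.
    by have := ee0 k; lra.
  have zero y x : `]a, b[%classic x -> ~ `[y, y + e k]%classic x -> f x * kern y (e k) x = 0.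
    by move=> _ H; rewrite kern_out ?mulr0.
  have sc := sub c ac (ltW cd); have sd := sub d (lt_trans ac cd) (lexx d).
  rewrite -(supp_Rintegral mu sc); last exact: zero.
  rewrite -(supp_Rintegral mu sd); last exact: zero.
  rewrite -RintegralB//.
  - apply: eq_Rintegral => x _; by rewrite derive1_bumps mulrBr.
  - apply: (@supp_intg _ _ _ mu `]a, b[%classic `[c, c + e k]%classic) => //; first exact: zero.
    exact: kern_mul_intg fc0.
  - apply: (@supp_intg _ _ _ mu `]a, b[%classic `[d, d + e k]%classic) => //; first exact: zero.
    exact: kern_mul_intg fd0.
have L2 : (fun k => \int[mu]_(x in `]a, b[) (g x * bumps c d (e k) x)) @ \oo
    --> \int[mu]_(x in `[c, d]) g x.
  have -> : \int[mu]_(x in `[c, d]) g x = \int[mu]_(x in K) (g x * \1_(`]c, d]%classic) x).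
    rewrite (@supp_Rintegral _ _ _ mu K `]c, d]%classic).
    - rewrite -(@Rintegral_itv_obnd_cbnd _ c (BRight d)); last first.
        apply: intgS gK => //; apply: subset_itvScc; rewrite bnd_simp; lra.
      by apply: eq_Rintegral => x H; rewrite indicE H mulr1.
    - apply: subset_itvScc; rewrite bnd_simp; lra.
    - by move=> x _ H; rewrite indicE memNset// mulr0.
  have := @Rdominated_cvg _ _ _ mu K (fun k x => g x * bumps c d (e k) x)
    (fun x => g x * \1_(`]c, d]%classic) x) (fun x => `|g x|).
  move=> /(_ mK).
  have -> : (fun k => \int[mu]_(x in K) (g x * bumps c d (e k) x)) =
    (fun k => \int[mu]_(x in `]a, b[) (g x * bumps c d (e k) x)).
    apply/funext => k; rewrite -(supp_Rintegral mu KS)// => x _ /= H.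
    have [->|/(bumps_out (e_gt0 k) cd) H'] := eqVneq (bumps c d (e k) x) 0; first by rewrite mulr0.
    exfalso; apply: H; rewrite /K /= in_itv/=; have := ee0 k; lra.
  apply.
  - move=> k; apply: measurable_funM => //; apply: measurable_funTS.
    apply: continuous_measurable_fun; exact/smooth_gen_continuous/smooth_bumps.
  - by apply: measurable_funM.
  - exact: integrable_norm.
  - apply: ae_all => x _; apply: cvgM; first exact: cvg_cst.
    exact: bumps_cvg.
  - apply: ae_all => x k _; rewrite normrM ler_piMr// bumps_norm_le1//.
have E k : \int[mu]_(x in `]a, b[) (f x * derive1 (bumps c d (e k)) x) =
    - \int[mu]_(x in `]a, b[) (g x * bumps c d (e k) x).
  apply: Hw; split; first by move=> n x; apply: smooth_gen_derivable; exact: smooth_bumps.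
  exists c, (d + e0); split => // x /(bumps_out (e_gt0 k) cd).
  by have := ee0 k; lra.
have L3 : (fun k => \int[mu]_(x in `]a, b[) (f x * derive1 (bumps c d (e k)) x)) @ \oo
    --> - \int[mu]_(x in `[c, d]) g x.
  have -> : (fun k => \int[mu]_(x in `]a, b[) (f x * derive1 (bumps c d (e k)) x)) =
    (fun k => - \int[mu]_(x in `]a, b[) (g x * bumps c d (e k) x)).
    by apply/funext.
  exact: cvgN.
have := cvg_unique _ L1 L3; move=> /(_ (@Rhausdorff _)) H.
by rewrite -[RHS]opprK -H opprB.
Qed.

End WeakDerivative.

Section WeakDerivative2.
Variable R : realType.
Local Notation mu := (@lebesgue_measure R).
Implicit Types (a b c d e : R) (f g : R -> R).

Lemma ae_itv_ex a b (P : R -> Prop) : a < b ->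
  (\forall x \ae mu, a < x < b -> P x) -> exists2 x, a < x < b & P x.
Proof.
move=> ab [N [mN N0 sN]]; apply: contrapT => H.
have : `]a, b[%classic `<=` N.
  move=> x; rewrite /= in_itv/= => xab; apply: sN => /= K.
  by apply: H; exists x => //; exact: K.
move=> /(le_measure mu) H'.
have : (mu `]a, b[%classic <= mu N)%E by apply: H'; rewrite inE.
rewrite N0 /= lebesgue_measure_itv/= lte_fin ab.
by rewrite -EFinB lee_fin subr_le0 leNgt ab.
Qed.

Lemma test_fun_continuous a b phi : test_fun a b phi -> continuous phi.
Proof.
move=> [sm _] x; apply: differentiable_continuous; apply/derivable1_diffP.
by have := sm 0%N x; rewrite derive1n0.
Qed.

Lemma test_fun_derive1_continuous a b phi : test_fun a b phi -> continuous (derive1 phi).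
Proof.
move=> [sm _] x; apply: differentiable_continuous; apply/derivable1_diffP.
by have := sm 1%N x; rewrite derive1n1.
Qed.

Lemma test_fun_derive1_supp (phi : R -> R) c d x : (forall x, phi x != 0 -> c <= x <= d) ->
  derive1 phi x != 0 -> c <= x <= d.
Proof.
move=> H; apply: contra_neqT; rewrite negb_and -!ltNge => cd.
rewrite derive1E.
suff E : \near x, cst 0 x = phi x.
  by have [_ ->] := near_eq_is_derive E (is_derive_cst 0 x (1:R)).
have Z y : ~~ (c <= y <= d) -> cst 0 y = phi y.
  by move=> cyd; apply/esym/eqP; apply: contraNT cyd; exact: H.
case/orP : cd => xx.
  near=> y; apply: Z; rewrite negb_and -!ltNge; apply/orP; left.
  by near: y; exact: lt_nbhsl.
near=> y; apply: Z; rewrite negb_and -!ltNge; apply/orP; right.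
by near: y; exact: lt_nbhsr.
Unshelve. all: by end_near. Qed.

Lemma loc_mul_intg a b c d f (phi : R -> R) : locally_integrable `]a, b[%classic f ->
  a < c -> d < b -> continuous phi -> (forall x, phi x != 0 -> c <= x <= d) ->
  mu.-integrable `]a, b[%classic (EFin \o (fun x => f x * phi x)).
Proof.
move=> lf ac db cphi sphi.
have fcd := locally_integrable_itv lf ac db.
apply: (@supp_intg _ _ _ mu `]a, b[%classic `[c, d]%classic) => //.
- by apply: subset_itvSoo; rewrite bnd_simp.
- move=> x _ H; have [->|/sphi H'] := eqVneq (phi x) 0; first by rewrite mulr0.
  by exfalso; apply: H; rewrite /= in_itv/=.
have [M HM] : exists M : R, forall x, `[c, d]%classic x -> `|phi x| <= M.
  have [dc|cd] := ltP d c.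
    by exists 0 => x; rewrite /= in_itv/= => H; exfalso; lra.
  have [|z _ Hz] := @EVT_max _ (fun x => `|phi x|) _ _ cd.
    apply: continuous_subspaceT => x; apply: continuous_comp; first exact: cphi.
    exact: norm_continuous.
  by exists (`|phi z|) => x Hx; apply: Hz; rewrite inE in Hx *.
apply: (@intg_ae_le _ _ _ mu _ _ (fun x => M * `|f x|)) => //.
- apply: measurable_funM; first by apply: intg_measurable fcd.
  by apply: measurable_funTS; exact: continuous_measurable_fun.
- by apply: intgZ => //; exact: integrable_norm fcd.
- by apply: ae_all => x Hx; rewrite normrM mulrC ler_wpM2r// HM.
Qed.

Lemma test_mul_intg a b f phi : locally_integrable `]a, b[%classic f ->
  test_fun a b phi -> mu.-integrable `]a, b[%classic (EFin \o (fun x => f x * phi x)).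
Proof.
move=> lf tp; have [_ [c [d [ac db H]]]] := tp.
by apply: (loc_mul_intg lf ac db) => //; exact: test_fun_continuous tp.
Qed.

Lemma test_mul_intg1 a b f phi : locally_integrable `]a, b[%classic f ->
  test_fun a b phi ->
  mu.-integrable `]a, b[%classic (EFin \o (fun x => f x * derive1 phi x)).
Proof.
move=> lf tp; have [_ [c [d [ac db H]]]] := tp.
apply: (loc_mul_intg lf ac db) => //; first exact: test_fun_derive1_continuous tp.
by move=> x; exact: test_fun_derive1_supp.
Qed.

Lemma is_wderivB a b f1 f2 g1 g2 : is_wderiv a b f1 g1 -> is_wderiv a b f2 g2 ->
  is_wderiv a b (fun x => f1 x - f2 x) (fun x => g1 x - g2 x).
Proof.
move=> [lf1 lg1 H1] [lf2 lg2 H2]; split.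
- exact: locally_integrableB.
- exact: locally_integrableB.
- move=> phi tp.
  under eq_Rintegral do rewrite mulrBl.
  under [in RHS]eq_Rintegral do rewrite mulrBl.
  rewrite !RintegralB//; try exact: test_mul_intg; try exact: test_mul_intg1.
  by rewrite H1// H2// opprB addrC opprK.
Qed.

Lemma is_wderiv_ae_eq a b f f' g g' : is_wderiv a b f g ->
  measurable_fun `]a, b[%classic f' -> measurable_fun `]a, b[%classic g' ->
  (\forall x \ae mu, a < x < b -> f x = f' x) ->
  (\forall x \ae mu, a < x < b -> g x = g' x) ->
  is_wderiv a b f' g'.
Proof.
move=> [lf lg H] mf' mg' ff' gg'.
have L h h' : locally_integrable `]a, b[%classic h -> measurable_fun `]a, b[%classic h' ->
  (\forall x \ae mu, a < x < b -> h x = h' x) -> locally_integrable `]a, b[%classic h'.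
  move=> [mh oD hi] mh' hh'; split=> // K KD cK.
  have mK : measurable K by exact: compact_measurable.
  rewrite (_ : (\int[_]_(_ in _) _)%E = \int[mu]_(x in K) (`|h x|)%:E)%E; first exact: hi.
  apply: ae_eq_integral => //.
  - apply/measurable_EFinP; apply: measurableT_comp => //; exact: measurable_funS mh'.
  - apply/measurable_EFinP; apply: measurableT_comp => //; exact: measurable_funS mh.
  - apply: ae_imp hh' => x + /KD; rewrite /= in_itv/= => + Kx => /(_ Kx) ->//.
split; [exact: L lf _ _|exact: L lg _ _|].
have [mf _ _] := lf; have [mg _ _] := lg.
move=> phi tp.
have mp : measurable_fun `]a, b[%classic phi.
  by apply: measurable_funTS; apply: continuous_measurable_fun; exact: test_fun_continuous tp.
have mp' : measurable_fun `]a, b[%classic (derive1 phi).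
  by apply: measurable_funTS; apply: continuous_measurable_fun; exact: test_fun_derive1_continuous tp.
have := H _ tp.
rewrite (@ae_eq_Rintegral _ _ _ mu _ (fun x => f x * _) (fun x => f' x * derive1 phi x))//.
- rewrite (@ae_eq_Rintegral _ _ _ mu _ (fun x => g x * _) (fun x => g' x * phi x))//.
  + exact: measurable_funM.
  + exact: measurable_funM.
  + by apply: ae_imp gg' => x + xab; rewrite /= in_itv/= in xab => /(_ xab) ->.
- exact: measurable_funM.
- exact: measurable_funM.
- by apply: ae_imp ff' => x + xab; rewrite /= in_itv/= in xab => /(_ xab) ->.
Qed.

(** At a Lebesgue point x the averages of h over [x, x + s] are zero and tend to h x. *)
Lemma ae_eq0_itv_integrals a b h : locally_integrable `]a, b[%classic h ->
  (forall c d, a < c -> c < d -> d < b -> \int[mu]_(x in `[c, d]) h x = 0) ->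
  \forall x \ae mu, a < x < b -> h x = 0.
Proof.
move=> lh H0.
(* Local integrability gives Lebesgue points only on intervals compactly inside ]a, b[, so ]a, b[ is
   exhausted by them. *)
pose ak (k : nat) := a + 1 / k.+1%:R; pose bk (k : nat) := b - 1 / k.+1%:R.
have ak0 k : a < ak k by rewrite ltrDl seq_div_gt0.
have bk0 k : bk k < b by rewrite ltrBlDr ltrDl seq_div_gt0.
have P k : \forall x \ae mu, ak k < x < bk k -> right_lebesgue_pt h x.
  apply: ae_right_lebesgue_pt.
  apply: (@intgS _ _ _ mu _ `[ak k, bk k]%classic) => //.
    by apply: subset_itvW; rewrite ?bnd_simp.
  exact: locally_integrable_itv lh _ _.
have {}P : \forall x \ae mu, forall k, ak k < x < bk k -> right_lebesgue_pt h x.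
  exact/ae_foralln.
apply: ae_imp P => x Px /andP[ax xb].
have xa0 : 0 < x - a by rewrite subr_gt0.
have bx0 : 0 < b - x by rewrite subr_gt0.
near \oo => k.
have H1 : 1 / k.+1%:R < x - a by near: k; exact: seq_div_near.
have H2 : 1 / k.+1%:R < b - x by near: k; exact: seq_div_near.
have {}Px : right_lebesgue_pt h x by apply: (Px k); rewrite /ak /bk; move: H1 H2; set t := 1 / _ => H1 H2; lra.
apply/eqP; rewrite -normr_le0; apply/ler_addgt0Pl => e e0; rewrite addr0.
have [dl dl0 Hd] := Px e e0.
pose s := Num.min (dl / 2) ((b - x) / 2).
have s0 : 0 < s by rewrite lt_min !divr_gt0.
have sdl : s < dl by rewrite gt_min; apply/orP; left; lra.
have sb : x + s < b.
  by rewrite -ltrBrDl gt_min; apply/orP; right; lra.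
have hi : mu.-integrable `[x, x + s]%classic (EFin \o h) by exact: locally_integrable_itv lh _ _.
have fin : (mu (`[x, (x + s)%R]%classic) < +oo)%E.
  by rewrite /= lebesgue_measure_itv/=; case: ifP => _; rewrite ?ltry.
have ci : mu.-integrable `[x, x + s]%classic (EFin \o cst (h x)) by exact: intg_cst.
have hci : mu.-integrable `[x, x + s]%classic (EFin \o (fun y => h y - h x)) by exact: intgB.
have {}Hd := Hd _ s0 sdl.
rewrite Rintegral_EFin// in Hd; last exact: integrable_norm hci.
rewrite lee_fin in Hd.
have := le_trans (le_normr_Rintegral _ hci) Hd => /(_ (measurable_itv _)).
rewrite RintegralB// H0//; last by rewrite ltrDl.
rewrite sub0r normrN Rintegral_cst// /= lebesgue_measure_itv/= lte_fin ltrDl s0.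
by rewrite -EFinB/= addrAC subrr add0r normrM (gtr0_norm s0) ler_pM2r.
Unshelve. all: by end_near. Qed.

(** The difference g1 - g2 is a weak derivative of f - f = 0, for which every point is a Lebesgue
    point, so its integral over every [c, d] is zero. *)
Lemma is_wderiv_uniq a b f g1 g2 : is_wderiv a b f g1 -> is_wderiv a b f g2 ->
  \forall x \ae mu, a < x < b -> g1 x = g2 x.
Proof.
move=> w1 w2; have w := is_wderivB w1 w2.
have [lf lg _] := w.
suff : \forall x \ae mu, a < x < b -> g1 x - g2 x = 0.
  by apply: ae_imp => x + xab => /(_ xab)/eqP; rewrite subr_eq0 => /eqP.
apply: ae_eq0_itv_integrals lg _ => c d ac cd db.
have rp y : a < y < b -> right_lebesgue_pt (fun x : R => f x - f x) y.
  move=> yab; have [mf _ _] := lf; apply: (continuous_right_lebesgue_pt yab mf).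
  have -> : (fun x : R => f x - f x) = cst 0 by apply/funext => x; rewrite subrr.
  exact: cvg_cst.
rewrite -(is_wderiv_ftc w ac cd db) ?subrr//; apply: rp; lra.
Qed.

(** For use in the time variable, where h is the evaluation of the continuous representative of the
    solution at a fixed test function: no time is then exceptional. *)
Lemma is_wderiv_ftc_cont a b f g h : is_wderiv a b f g ->
  (forall x, a < x < b -> {for x, continuous h}) ->
  (\forall x \ae mu, a < x < b -> f x = h x) ->
  forall c d, a < c -> c < d -> d < b -> h d - h c = \int[mu]_(x in `[c, d]) g x.
Proof.
move=> w ch fh c d ac cd db.
have mh : measurable_fun `]a, b[%classic h.
  apply: open_continuous_measurable_fun; first exact: interval_open.
  by move=> x; rewrite inE/= in_itv/=; exact: ch.
have w' : is_wderiv a b h g.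
  have [_ [mg _ _] _] := w.
  by apply: (is_wderiv_ae_eq w mh mg) => //; exact: ae_all.
apply: (is_wderiv_ftc w') => //.
- by apply: (continuous_right_lebesgue_pt (a:=a) (b:=b)) => //; [lra|apply: ch; lra].
- by apply: (continuous_right_lebesgue_pt (a:=a) (b:=b)) => //; [lra|apply: ch; lra].
Qed.

End WeakDerivative2.

(** * Fubini's theorem for real-valued functions *)

Section RealFubini.
Context d1 d2 (T1 : measurableType d1) (T2 : measurableType d2) (R : realType).
Variables (m1 : {sigma_finite_measure set T1 -> \bar R}).
Variables (m2 : {sigma_finite_measure set T2 -> \bar R}).
Implicit Types f : T1 -> T2 -> R.

Lemma measurable_section1 f x : measurable_fun setT (fun z => f z.1 z.2) ->
  measurable_fun setT (f x).
Proof.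
move=> mf; rewrite (_ : f x = (fun z => f z.1 z.2) \o (fun y => (x, y)))//.
apply: measurableT_comp => //.
by apply: measurable_fun_pair.
Qed.

Lemma measurable_section2 f y : measurable_fun setT (fun z => f z.1 z.2) ->
  measurable_fun setT (f ^~ y).
Proof.
move=> mf; rewrite (_ : f^~ y = (fun z => f z.1 z.2) \o (fun x => (x, y)))//.
exact: measurableT_comp.
Qed.

Lemma measurable_swap f : measurable_fun setT (fun z => f z.1 z.2) ->
  measurable_fun setT (fun z => f z.2 z.1).
Proof.
move=> mf.
rewrite (_ : (fun z => f z.2 z.1) = (fun z => f z.1 z.2) \o (fun z => (z.2, z.1)))//.
apply: measurableT_comp => //.
by apply: measurable_fun_pair.
Qed.

Lemma measurable_Rint1 f : measurable_fun setT (fun z => f z.1 z.2) ->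
  measurable_fun setT (fun x => \int[m2]_y f x y).
Proof.
move=> mf.
have mE : measurable_fun setT (fun z : T1 * T2 => (f z.1 z.2)%:E).
  exact/measurable_EFinP.
have Hp := @measurable_fun_fubini_tonelli_F _ _ _ _ _ m2 _ (measurable_funepos mE) (fun _ => funepos_ge0 _ _).
have Hn := @measurable_fun_fubini_tonelli_F _ _ _ _ _ m2 _ (measurable_funeneg mE) (fun _ => funeneg_ge0 _ _).
have H : measurable_fun setT (fun x => (\int[m2]_y (f x y)%:E)%E).
  have := emeasurable_funB Hp Hn; congr measurable_fun.
  apply/funext => x; rewrite [RHS]integralE; congr (_ - _)%E.
    by apply: eq_integral => y _; rewrite /= !funeposE.
  by apply: eq_integral => y _; rewrite /= !funenegE.
have mfine : measurable_fun setT (@fine R) by exact: fine_measurable.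
exact: (measurableT_comp mfine H).
Qed.

Lemma RFubini_ae f :
  (m1 \x m2)%E.-integrable setT (EFin \o (fun z => f z.1 z.2)) ->
  \forall x \ae m1, m2.-integrable setT (EFin \o f x).
Proof. by move=> fi; apply: ae_imp (ae_integrable1 fi). Qed.

Lemma RFubini_intg f : measurable_fun setT (fun z => f z.1 z.2) ->
  (m1 \x m2)%E.-integrable setT (EFin \o (fun z => f z.1 z.2)) ->
  m1.-integrable setT (EFin \o (fun x => \int[m2]_y f x y)).
Proof.
move=> mf fi; have [_ H] := elimT (integrableP _ _ _) (integrable_fubini_F fi).
apply/integrableP; split; first exact/measurable_EFinP/measurable_Rint1.
apply: le_lt_trans H; apply: ae_ge0_le_integral => //.
- by do 2 apply: measurableT_comp => //; exact: measurable_Rint1.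
- by apply: measurableT_comp => //; exact: (measurable_fubini_F fi).
- apply: ae_imp (RFubini_ae fi) => x ix _.
  by rewrite /fubini_F /= Rintegral_EFin.
Qed.

Lemma RFubini f : measurable_fun setT (fun z => f z.1 z.2) ->
  (m1 \x m2)%E.-integrable setT (EFin \o (fun z => f z.1 z.2)) ->
  \int[m1]_x \int[m2]_y f x y = \int[(m1 \x m2)%E]_z f z.1 z.2.
Proof.
move=> mf fi; rewrite /Rintegral; congr fine.
rewrite -(integral12_prod_meas1 fi); apply: ae_eq_integral => //.
- exact/measurable_EFinP/measurable_Rint1.
- exact: (measurable_fubini_F fi).
- apply: ae_imp (RFubini_ae fi) => x ix _.
  by rewrite /fubini_F /= Rintegral_EFin.
Qed.

End RealFubini.

Section RealFubiniSwap.
Context d1 d2 (T1 : measurableType d1) (T2 : measurableType d2) (R : realType).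
Variables (m1 : {sigma_finite_measure set T1 -> \bar R}).
Variables (m2 : {sigma_finite_measure set T2 -> \bar R}).
Implicit Types f : T1 -> T2 -> R.

Lemma intg_swap f : measurable_fun setT (fun z => f z.1 z.2) ->
  (m1 \x m2)%E.-integrable setT (EFin \o (fun z => f z.1 z.2)) ->
  (m2 \x m1)%E.-integrable setT (EFin \o (fun z => f z.2 z.1)).
Proof.
move=> mf fi; apply/integrable12ltyP.
  by apply/measurable_EFinP; exact: (measurable_swap mf).
have mE : measurable_fun setT (EFin \o (fun z : T1 * T2 => f z.1 z.2)).
  exact/measurable_EFinP.
exact: (integrable21ltyP m1 m2 mE).1 fi.
Qed.

Lemma RFubini_swap f : measurable_fun setT (fun z => f z.1 z.2) ->
  (m1 \x m2)%E.-integrable setT (EFin \o (fun z => f z.1 z.2)) ->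
  \int[m1]_x \int[m2]_y f x y = \int[m2]_y \int[m1]_x f x y.
Proof.
move=> mf fi; rewrite (RFubini mf fi).
rewrite (RFubini (f := fun y x => f x y) (measurable_swap mf) (intg_swap mf fi)).
rewrite /Rintegral; congr fine.
rewrite -(integral21_prod_meas1 fi).
by rewrite -(integral12_prod_meas1 (intg_swap mf fi)).
Qed.

Lemma intg_Tonelli f : measurable_fun setT (fun z => f z.1 z.2) ->
  (forall x y, 0 <= f x y) ->
  (\forall x \ae m1, m2.-integrable setT (EFin \o f x)) ->
  m1.-integrable setT (EFin \o (fun x => \int[m2]_y f x y)) ->
  (m1 \x m2)%E.-integrable setT (EFin \o (fun z => f z.1 z.2)).
Proof.
move=> mf f0 aef fi; apply/integrable12ltyP; first exact/measurable_EFinP.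
have [_] := elimT (integrableP _ _ _) fi.
apply: le_lt_trans; apply: ae_ge0_le_integral => //.
- by move=> x _; exact: integral_ge0.
- apply: (measurable_fun_fubini_tonelli_F (fun z => `|(f z.1 z.2)%:E|%E)) => //.
  by apply: measurableT_comp => //; exact/measurable_EFinP.
- by apply: measurableT_comp => //; exact/measurable_EFinP/measurable_Rint1.
- apply: ae_imp aef => x ix _ /=.
  under eq_integral do rewrite ger0_norm//.
  rewrite ger0_norm ?Rintegral_ge0// -Rintegral_EFin//.
Qed.

End RealFubiniSwap.

(** * Instances for Lebesgue measure on the plane *)

Section LebesgueFubini.
Variable R : realType.
Local Notation mu := (@lebesgue_measure R).
Local Notation mu2 := (mu \x mu)%E.
Local Notation RR := (measurableTypeR R * measurableTypeR R)%type.
Implicit Types f : R -> R -> R.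

Definition meas2 f := measurable_fun setT (fun z : RR => f z.1 z.2).
Definition intg2 f := mu2.-integrable setT (EFin \o (fun z : RR => f z.1 z.2)).

Lemma leb_mul_sq (D : set R) (u v : R -> R) : measurable D ->
  measurable_fun D u -> measurable_fun D v ->
  mu.-integrable D (EFin \o (fun x => u x ^+ 2)) ->
  mu.-integrable D (EFin \o (fun x => v x ^+ 2)) ->
  mu.-integrable D (EFin \o (fun x => u x * v x)).
Proof. exact: (@intg_mul_sq _ _ _ mu). Qed.

Lemma meas2_sec1 f x : meas2 f -> measurable_fun setT (f x).
Proof. exact: (@measurable_section1 _ _ _ _ _ f). Qed.

Lemma meas2_sec2 f y : meas2 f -> measurable_fun setT (f^~ y).
Proof. exact: (@measurable_section2 _ _ _ _ _ f). Qed.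

Lemma meas2_swap f : meas2 f -> meas2 (fun y x => f x y).
Proof. exact: (@measurable_swap _ _ _ _ _ f). Qed.

Lemma meas2_Rint f : meas2 f -> measurable_fun setT (fun x => \int[mu]_y f x y).
Proof. exact: (@measurable_Rint1 _ _ _ _ _ mu f). Qed.

Lemma intg2_ae f : intg2 f -> \forall x \ae mu, mu.-integrable setT (EFin \o f x).
Proof. exact: (@RFubini_ae _ _ _ _ _ mu mu f). Qed.

Lemma intg2_Rint f : meas2 f -> intg2 f ->
  mu.-integrable setT (EFin \o (fun x => \int[mu]_y f x y)).
Proof. exact: (@RFubini_intg _ _ _ _ _ mu mu f). Qed.

Lemma intg2_fubini f : meas2 f -> intg2 f ->
  \int[mu]_x \int[mu]_y f x y = \int[mu2]_z f z.1 z.2.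
Proof. exact: (@RFubini _ _ _ _ _ mu mu f). Qed.

Lemma intg2_swap f : meas2 f -> intg2 f -> intg2 (fun y x => f x y).
Proof. exact: (@intg_swap _ _ _ _ _ mu mu f). Qed.

Lemma intg2_fubini_swap f : meas2 f -> intg2 f ->
  \int[mu]_x \int[mu]_y f x y = \int[mu]_y \int[mu]_x f x y.
Proof. exact: (@RFubini_swap _ _ _ _ _ mu mu f). Qed.

Lemma intg2_Tonelli f : meas2 f -> (forall x y, 0 <= f x y) ->
  (\forall x \ae mu, mu.-integrable setT (EFin \o f x)) ->
  mu.-integrable setT (EFin \o (fun x => \int[mu]_y f x y)) -> intg2 f.
Proof. exact: (@intg_Tonelli _ _ _ _ _ mu mu f). Qed.

End LebesgueFubini.

(** * The energy inequality *)

Lemma normB_add_le (R : realFieldType) (e x y z t : R) : 0 <= e ->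
  `|x - z| <= e / 4 -> `|y| <= e / 4 -> `|t| <= e / 4 -> `|x + y - (z + t)| <= e.
Proof. by rewrite !ler_norml; lra. Qed.

(** * Averages in time and their weak convergence *)

Section Steklov.
Variable R : realType.
Local Notation mu := (@lebesgue_measure R).
Local Notation mu2 := (mu \x mu)%E.
Local Notation RR := (measurableTypeR R * measurableTypeR R)%type.
Implicit Types (f : R -> R) (D g : R -> R -> R) (k : nat).

Definition win k : R := k.+1%:R^-1.

Lemma win_gt0 k : 0 < win k. Proof. by rewrite invr_gt0. Qed.

Lemma mulr_win k : k.+1%:R * win k = 1. Proof. by rewrite mulfV. Qed.

(** The Steklov average. The window lies behind t because the equation is integrated over [t - [win]
    k, t] and tested with the value at t. *)
Definition avg k f (t : R) : R := k.+1%:R * \int[mu]_(s in `[t - win k, t]) f s.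

Lemma measure_win k t : mu `[t - win k, t]%classic = (win k)%:E.
Proof.
rewrite /= lebesgue_measure_itv/= lte_fin ltrBlDr ltrDl win_gt0.
by rewrite -EFinB; congr EFin; ring.
Qed.

Lemma measure_win' k s : mu `[s, s + win k]%classic = (win k)%:E.
Proof.
rewrite /= lebesgue_measure_itv/= lte_fin ltrDl win_gt0.
by rewrite -EFinB; congr EFin; ring.
Qed.

Lemma measurable_le_ind d (T : measurableType d) (u v : T -> R) :
  measurable_fun setT u -> measurable_fun setT v ->
  measurable_fun setT (fun z => ((u z <= v z)%R%:R : R)).
Proof.
move=> mu' mv.
have -> : (fun z => ((u z <= v z)%R%:R : R)) = \1_([set: T] `&` [set z | u z <= v z]).
  by apply/funext => z; rewrite setTI indicE mem_setE.
by apply: measurable_indic; exact: measurable_fun_le.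
Qed.

(** The window as a kernel on the plane, so that Fubini's theorem applies: the indicator of an
    interval in s for fixed t, and in t for fixed s. *)
Definition wker k (t s : R) : R := (t - win k <= s)%R%:R * (s <= t)%R%:R.

Lemma wkerE k t s : wker k t s = \1_(`[t - win k, t]%classic) s.
Proof. by rewrite /wker indicE mem_setE in_itv/= -natrM mulnb. Qed.

Lemma wkerE' k t s : wker k t s = \1_(`[s, s + win k]%classic) t.
Proof.
rewrite /wker indicE mem_setE in_itv/= -natrM mulnb andbC.
by rewrite lerBlDr.
Qed.

Lemma wker_ge0 k t s : 0 <= wker k t s.
Proof. by rewrite /wker mulr_ge0. Qed.

Lemma measurable_wker k : meas2 (wker k).
Proof.
apply: measurable_funM; apply: measurable_le_ind => //.
exact: measurable_funB.
Qed.

Lemma Rintegral_ind (A : set R) f :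
  \int[mu]_(s in A) f s = \int[mu]_s (f s * \1_A s).
Proof.
rewrite Rintegral_mkcond; apply: eq_Rintegral => s _.
by rewrite patchE indicE; case: ifPn => sA; rewrite ?mulr1 ?mulr0.
Qed.

Lemma avgE k f t : avg k f t = k.+1%:R * \int[mu]_s (f s * wker k t s).
Proof.
rewrite /avg Rintegral_ind; congr (_ * _).
by apply: eq_Rintegral => s _; rewrite wkerE.
Qed.

Lemma measurable_avg2 k D : meas2 D ->
  meas2 (fun x => avg k (D x)).
Proof.
move=> mD; rewrite /meas2; under eq_fun do rewrite avgE.
apply: measurable_funM => //.
apply: (@measurable_Rint1 _ _ _ _ _ mu (fun (z : RR) s => D z.1 s * wker k z.2 s)).
apply: measurable_funM.
  rewrite (_ : (fun z : RR * measurableTypeR R => D z.1.1 z.2) =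
    (fun z : RR => D z.1 z.2) \o (fun z : RR * measurableTypeR R => (z.1.1, z.2)))//.
  apply: measurableT_comp => //; apply: measurable_fun_pair => //.
  exact: measurableT_comp.
rewrite (_ : (fun z : RR * measurableTypeR R => wker k z.1.2 z.2) =
    (fun z : RR => wker k z.1 z.2) \o (fun z : RR * measurableTypeR R => (z.1.2, z.2)))//.
apply: measurableT_comp => //; first exact: measurable_wker.
apply: measurable_fun_pair => //.
exact: measurableT_comp.
Qed.

Lemma measurable_avg k f : measurable_fun setT f -> measurable_fun setT (avg k f).
Proof.
move=> mf.
have m2 : measurable_fun setT (fun z : RR => f z.2) by exact: measurableT_comp.
exact: (meas2_sec1 (f := fun _ : R => avg k f) 0 (measurable_avg2 k (D := fun _ => f) m2)).
Qed.

Lemma Rintegral_wker k s : \int[mu]_t wker k t s = win k.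
Proof.
under eq_Rintegral do rewrite wkerE'.
rewrite /Rintegral integral_indic// setIT -[RHS]/(fine (win k)%:E).
by congr fine; exact: measure_win'.
Qed.

Lemma avg_wker_intg k f : measurable_fun setT f -> (forall s, 0 <= f s) ->
  mu.-integrable setT (EFin \o f) ->
  mu2.-integrable setT (EFin \o (fun z : RR => f z.1 * wker k z.2 z.1)).
Proof.
move=> mf f0 fi.
have mW : measurable_fun setT (fun z : RR => f z.1 * wker k z.2 z.1).
  apply: measurable_funM; first exact: measurableT_comp.
  exact: (meas2_swap (f := wker k) (measurable_wker k)).
have iW s : mu.-integrable setT (EFin \o (fun t => wker k t s)).
  have -> : (fun t => wker k t s) = \1_(`[s, s + win k]%classic).
    by apply/funext => t; rewrite wkerE'.
  exact: integrable_indic_itv.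
apply: (@intg2_Tonelli _ (fun s t => f s * wker k t s)) => //.
- by move=> s t; rewrite mulr_ge0// wker_ge0.
- by apply: ae_all => s; apply: intgZ.
- apply: (@eq_integrable _ _ _ mu setT measurableT (EFin \o (fun s => win k * f s))) => //.
    move=> s _; rewrite /= RintegralZl//; congr EFin; rewrite mulrC; congr (_ * _).
    by rewrite Rintegral_wker.
  exact: intgZ.
Qed.

(** After exchanging the integrals, each s is weighted by the length of the set of t whose window
    contains it, which is [win] k and cancels the factor k + 1. *)
Lemma avg_intg_ge0 k f : measurable_fun setT f -> (forall s, 0 <= f s) ->
  mu.-integrable setT (EFin \o f) ->
  mu.-integrable setT (EFin \o avg k f) /\
  \int[mu]_t avg k f t = \int[mu]_s f s.
Proof.
move=> mf f0 fi; have iW := avg_wker_intg k mf f0 fi.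
have mW : measurable_fun setT (fun z : RR => f z.1 * wker k z.2 z.1).
  apply: measurable_funM; first exact: measurableT_comp.
  exact: (meas2_swap (f := wker k) (measurable_wker k)).
have iW' := intg2_swap (f := fun s t => f s * wker k t s) mW iW.
have mW' := meas2_swap (f := fun s t => f s * wker k t s) mW.
have iA : mu.-integrable setT (EFin \o (fun t => \int[mu]_s (f s * wker k t s))).
  exact: (intg2_Rint (f := fun t s => f s * wker k t s) mW' iW').
split.
  apply: (@eq_integrable _ _ _ mu setT measurableT (EFin \o (fun t => k.+1%:R * \int[mu]_s (f s * wker k t s)))) => //.
    by move=> t _ /=; rewrite avgE.
  exact: intgZ.
under eq_Rintegral do rewrite avgE.
rewrite RintegralZl//.
rewrite (intg2_fubini_swap (f := fun t s => f s * wker k t s) mW' iW').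
under eq_Rintegral.
  move=> s _; rewrite RintegralZl//; last first.
    have -> : (fun t => wker k t s) = \1_(`[s, s + win k]%classic).
      by apply/funext => t; rewrite wkerE'.
    exact: integrable_indic_itv.
  rewrite Rintegral_wker; over.
by rewrite RintegralZr// mulrCA mulr_win mulr1.
Qed.

Lemma avg_sq_le k f t : measurable_fun setT f ->
  mu.-integrable setT (EFin \o (fun s => f s ^+ 2)) ->
  (avg k f t) ^+ 2 <= avg k (fun s => f s ^+ 2) t.
Proof.
move=> mf f2.
have f2w : mu.-integrable `[t - win k, t]%classic (EFin \o (fun s => f s ^+ 2)).
  exact: intgS f2.
have fin : (mu (`[(t - win k)%R, t]%classic) < +oo)%E by rewrite measure_win ltry.
have f1 : mu.-integrable `[t - win k, t]%classic (EFin \o f).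
  by apply: intg_of_sq => //; exact: measurable_funTS.
have := Rintegral_sq_le _ f1 f2w (measure_win k t) => /(_ (measurable_itv _)) H.
rewrite /avg exprMn.
apply: le_trans (ler_wpM2l (sqr_ge0 _) H) _.
by rewrite mulrA expr2 -(mulrA k.+1%:R k.+1%:R) mulr_win mulr1.
Qed.

Lemma avg_bound k f t (N : R) : measurable_fun setT f -> (forall s, `|f s| <= N) ->
  `|avg k f t| <= N.
Proof.
move=> mf fN; rewrite /avg normrM ger0_norm//.
have fin : (mu (`[(t - win k)%R, t]%classic) < +oo)%E by rewrite measure_win ltry.
have fi : mu.-integrable `[t - win k, t]%classic (EFin \o f).
  apply: (@intg_bounded _ _ _ mu _ _ N) => //; first exact: measurable_funTS.
  by apply: ae_all => s _.
apply: (@le_trans _ _ (k.+1%:R * \int[mu]_(s in `[t - win k, t]) N)).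
  rewrite ler_wpM2l//; apply: le_trans (le_normr_Rintegral _ _) _ => //.
  apply: le_Rintegral => //; first exact: integrable_norm fi.
  exact: intg_cst.
rewrite Rintegral_cst// (_ : fine _ = win k).
  by rewrite mulrCA mulr_win mulr1.
exact: (congr1 fine (measure_win k t)).
Qed.

Lemma bounded_locally_integrable f (N : R) : measurable_fun setT f ->
  (forall s, `|f s| <= N) -> locally_integrable setT f.
Proof.
move=> mf fN; split => //; first exact: openT.
move=> K _ cK; have mK : measurable K by exact: compact_measurable.
have : mu.-integrable K (EFin \o f).
  apply: (@intg_bounded _ _ _ mu _ _ N) => //; first exact: compact_finite_measure.
    exact: measurable_funTS.
  by apply: ae_all.
by move=> /integrableP[].
Qed.

Lemma avg_cvg f : locally_integrable setT f ->
  \forall t \ae mu, (fun k => avg k f t) @ \oo --> f t.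
Proof.
move=> lf.
pose E (t : R) k := `[t - win k, t]%classic.
have nE t : nicely_shrinking t (E t).
  split; first by move=> n; exact: measurable_itv.
  have w2 n : 0 < 2 * win n by rewrite mulr_gt0// win_gt0.
  (* The window of length h lies in the ball of radius 2 h, whose measure is four times that of the
     window. *)
  exists (4, fun n => PosNum (w2 n)); split => //=.
  - rewrite -[X in _ --> X](mulr0 2); apply: cvgM; first exact: cvg_cst.
    exact: cvg_harmonic.
  - move=> n x; rewrite /E /ball/= in_itv/= => /andP[x1 x2].
    have := win_gt0 n; rewrite ger0_norm; lra.
  - move=> n; rewrite lebesgue_measure_ball/=; last exact: ltW.
    rewrite /E [X in (_ <= _ * X)%E]measure_win -EFinM lee_fin.
    by rewrite mulr2n; have := win_gt0 n; lra.
have := lebesgue_differentiation lf.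
apply: ae_imp => t lt.
have := nice_lebesgue_differentiation nE lf lt => /fine_cvg.
rewrite (_ : (fine \o _) = (fun k => avg k f t))//.
apply/funext => k; rewrite /= /avg /E.
rewrite Rintegral_EFin//; last first.
  have [mf _ fi] := lf; apply/integrableP; split.
    by apply/measurable_EFinP; exact: measurable_funTS.
  by apply: (fi `[t - win k, t]%classic) => //; exact: segment_compact.
have -> : (mu (`[(t - win k)%R, t]%classic))^-1%E = k.+1%:R%:E.
  by rewrite measure_win inver gt_eqF ?win_gt0//= /win invrK.
by [].
Qed.

Lemma Young_Rintegral (u v : RR -> R) (l : R) : 0 < l ->
  measurable_fun setT u -> measurable_fun setT v ->
  mu2.-integrable setT (EFin \o (fun z => u z ^+ 2)) ->
  mu2.-integrable setT (EFin \o (fun z => v z ^+ 2)) ->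
  `|\int[mu2]_z (u z * v z)| <=
    2^-1 * (l^-1 * \int[mu2]_z (u z ^+ 2) + l * \int[mu2]_z (v z ^+ 2)).
Proof.
move=> l0 mu_ mv iu iv.
have iuv := intg_mul_sq measurableT mu_ mv iu iv.
have il := intgZ l measurableT iv.
have il' := intgZ l^-1 measurableT iu.
apply: le_trans (le_normr_Rintegral _ _) _ => //.
rewrite -(RintegralZl l^-1 measurableT iu) -(RintegralZl l measurableT iv).
rewrite -(RintegralD measurableT il' il).
rewrite -(RintegralZl 2^-1 measurableT (intgD measurableT il' il)).
apply: ae_le_Rintegral => //.
- exact: integrable_norm iuv.
- by apply: intgZ => //; exact: intgD.
apply: ae_all => z _.
rewrite normrM -[u z ^+ 2](real_normK (num_real _)) -[v z ^+ 2](real_normK (num_real _)).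
set p := `|u z|; set q := `|v z|.
have -> : 2^-1 * (l^-1 * p ^+ 2 + l * q ^+ 2) = p * q + 2^-1 * (l^-1 * (p - l * q) ^+ 2).
  by field; rewrite gt_eqF.
by rewrite lerDl mulr_ge0// mulr_ge0 ?sqr_ge0// invr_ge0 ltW.
Qed.

(** Pointwise Jensen's inequality [avg_sq_le], then invariance of the integral under averaging, on
    almost every section. *)
Lemma avg_L2 k D : meas2 D ->
  mu2.-integrable setT (EFin \o (fun z : RR => D z.1 z.2 ^+ 2)) ->
  mu2.-integrable setT (EFin \o (fun z : RR => avg k (D z.1) z.2 ^+ 2)) /\
  \int[mu2]_z (avg k (D z.1) z.2 ^+ 2) <= \int[mu2]_z (D z.1 z.2 ^+ 2).
Proof.
move=> mD iD.
have mD2 : measurable_fun setT (fun z : RR => D z.1 z.2 ^+ 2) by exact: measurable_funX.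
have mA : measurable_fun setT (fun z : RR => avg k (D z.1) z.2) := measurable_avg2 k mD.
have mA2 : measurable_fun setT (fun z : RR => avg k (D z.1) z.2 ^+ 2) by exact: measurable_funX.
have H : \forall x \ae mu, mu.-integrable setT (EFin \o (fun t => avg k (D x) t ^+ 2)) /\
    \int[mu]_t (avg k (D x) t ^+ 2) <= \int[mu]_t (D x t ^+ 2).
  apply: ae_imp (intg2_ae (f := fun x t => D x t ^+ 2) iD) => x ix.
  have mDx : measurable_fun setT (D x) := meas2_sec1 x mD.
  have mDx2 : measurable_fun setT (fun t => D x t ^+ 2) by exact: measurable_funX.
  have [iE EE] := avg_intg_ge0 k mDx2 (fun s => sqr_ge0 _) ix.
  have le t : avg k (D x) t ^+ 2 <= avg k (fun s => D x s ^+ 2) t by exact: avg_sq_le.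
  have iA : mu.-integrable setT (EFin \o (fun t => avg k (D x) t ^+ 2)).
    apply: (@intg_ae_le _ _ _ mu _ _ _ measurableT _ iE).
      by apply: measurable_funX; exact: measurable_avg.
    by apply: ae_all => t _; rewrite ger0_norm ?sqr_ge0.
  by split => //; rewrite -EE; apply: le_Rintegral.
have iDx := intg2_Rint (f := fun x t => D x t ^+ 2) mD2 iD.
have iAA : mu2.-integrable setT (EFin \o (fun z : RR => avg k (D z.1) z.2 ^+ 2)).
  apply: (@intg2_Tonelli _ (fun x t => avg k (D x) t ^+ 2)) => //.
  - by move=> x t; exact: sqr_ge0.
  - by apply: ae_imp H => x [].
  - apply: (@intg_ae_le _ _ _ mu _ _ _ measurableT _ iDx).
      exact: (meas2_Rint (f := fun x t => avg k (D x) t ^+ 2) mA2).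
    apply: ae_imp H => x [_ H] _; rewrite ger0_norm//.
    by apply: Rintegral_ge0 => t _; exact: sqr_ge0.
split => //.
rewrite -(intg2_fubini (f := fun x t => avg k (D x) t ^+ 2) mA2 iAA).
rewrite -(intg2_fubini (f := fun x t => D x t ^+ 2) mD2 iD).
apply: ae_le_Rintegral => //.
- exact: (intg2_Rint (f := fun x t => avg k (D x) t ^+ 2) mA2 iAA).
- by apply: ae_imp H => x [_ H] _.
Qed.

Lemma avg_weak_bounded D g (N : R) : meas2 D ->
  (forall x t, `|D x t| <= N) ->
  meas2 g ->
  mu2.-integrable setT (EFin \o (fun z : RR => g z.1 z.2)) ->
  (fun k => \int[mu2]_z (g z.1 z.2 * avg k (D z.1) z.2)) @ \oo -->
    \int[mu2]_z (g z.1 z.2 * D z.1 z.2).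
Proof.
move=> mD DN mg ig.
have mDx x : measurable_fun setT (D x) := meas2_sec1 x mD.
have mgx x : measurable_fun setT (g x) := meas2_sec1 x mg.
have AN k x t : `|avg k (D x) t| <= N by exact: avg_bound.
have mA k : measurable_fun setT (fun z : RR => avg k (D z.1) z.2) := measurable_avg2 k mD.
have mgA k : measurable_fun setT (fun z : RR => g z.1 z.2 * avg k (D z.1) z.2).
  exact: measurable_funM.
have mgD : measurable_fun setT (fun z : RR => g z.1 z.2 * D z.1 z.2).
  exact: measurable_funM.
have ign := integrable_norm ig.
have iNg : mu2.-integrable setT (EFin \o (fun z : RR => N * `|g z.1 z.2|)).
  exact: intgZ.
have igA k : mu2.-integrable setT (EFin \o (fun z : RR => g z.1 z.2 * avg k (D z.1) z.2)).
  apply: (@intg_ae_le _ _ _ mu2 _ _ _ measurableT _ iNg) => //.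
  by apply: ae_all => z _; rewrite normrM mulrC ler_wpM2r.
have igD : mu2.-integrable setT (EFin \o (fun z : RR => g z.1 z.2 * D z.1 z.2)).
  apply: (@intg_ae_le _ _ _ mu2 _ _ _ measurableT _ iNg) => //.
  by apply: ae_all => z _; rewrite normrM mulrC ler_wpM2r.
rewrite -(intg2_fubini (f := fun x t => g x t * D x t) mgD igD).
rewrite (_ : (fun k => _) = (fun k => \int[mu]_x \int[mu]_t (g x t * avg k (D x) t))); last first.
  apply/funext => k.
  by rewrite -(intg2_fubini (f := fun x t => g x t * avg k (D x) t) (mgA k) (igA k)).
have mNg : measurable_fun setT (fun z : RR => N * `|g z.1 z.2|).
  by apply: measurable_funM => //; exact: measurableT_comp.
have igx := intg2_ae (f := g) ig.
apply: (@Rdominated_cvg _ _ _ mu setT _ _ (fun x => \int[mu]_t (N * `|g x t|))) => //.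
- move=> k; exact: (meas2_Rint (f := fun x t => g x t * avg k (D x) t) (mgA k)).
- exact: (meas2_Rint (f := fun x t => g x t * D x t) mgD).
- exact: (intg2_Rint (f := fun x t => N * `|g x t|) mNg iNg).
- apply: ae_imp igx => x ix _.
  apply: (@Rdominated_cvg _ _ _ mu setT _ _ (fun t => N * `|g x t|)) => //.
  + by move=> k; apply: (measurable_funM (mgx x)); exact: (measurable_avg k (mDx x)).
  + exact: (measurable_funM (mgx x) (mDx x)).
  + by apply: intgZ => //; exact: integrable_norm ix.
  + apply: ae_imp (avg_cvg (bounded_locally_integrable (mDx x) (DN x))) => t ct _.
    by apply: cvgM => //; exact: cvg_cst.
  + by apply: ae_all => t k _; rewrite normrM mulrC ler_wpM2r.
- apply: ae_imp igx => x ix k _.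
  have inx : mu.-integrable setT (EFin \o (fun t => N * `|g x t|)).
    by apply: intgZ => //; exact: integrable_norm ix.
  have igx' : mu.-integrable setT (EFin \o (fun t => g x t * avg k (D x) t)).
    apply: (@intg_ae_le _ _ _ mu _ _ _ measurableT _ inx) => //.
      by apply: (measurable_funM (mgx x)); exact: (measurable_avg k (mDx x)).
    by apply: ae_all => t _; rewrite normrM mulrC ler_wpM2r.
  apply: le_trans (le_normr_Rintegral _ _) _ => //.
  apply: le_Rintegral => //; first exact: integrable_norm igx'.
  by move=> t _; rewrite normrM mulrC ler_wpM2r.
Qed.

Definition trunc (N : nat) (y : R) : R := Num.max (- N%:R) (Num.min N%:R y).

Lemma trunc_bound N y : `|trunc N y| <= N%:R.
Proof.
have N0 : 0 <= N%:R :> R by [].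
by rewrite ler_norml /trunc le_max lexx ge_max ge_min lexx/= andbT; lra.
Qed.

Lemma trunc_id (N : nat) y : `|y| <= N%:R -> trunc N y = y.
Proof. by rewrite ler_norml /trunc => /andP[H1 H2]; rewrite min_r// max_r. Qed.

Lemma trunc_diff N y : `|y - trunc N y| <= `|y|.
Proof.
have N0 : 0 <= N%:R :> R by [].
have [yN|Ny] := leP `|y| N%:R; first by rewrite trunc_id// subrr normr0.
rewrite /trunc.
have [y0|y0] := leP 0 y.
  rewrite (ger0_norm y0) in Ny *; rewrite min_l; last exact: ltW.
  by rewrite max_r; [rewrite ger0_norm; lra|lra].
rewrite (ltr0_norm y0) in Ny *; rewrite min_r; last lra.
by rewrite max_l; [rewrite ler0_norm; lra|lra].
Qed.

Lemma measurable_trunc d (T : measurableType d) N (u : T -> R) :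
  measurable_fun setT u -> measurable_fun setT (fun z => trunc N (u z)).
Proof.
move=> mu_; apply: measurable_maxr => //.
exact: measurable_minr.
Qed.

Lemma trunc_cvg_L2 (u : RR -> R) : measurable_fun setT u ->
  mu2.-integrable setT (EFin \o (fun z => u z ^+ 2)) ->
  (fun N => \int[mu2]_z ((u z - trunc N (u z)) ^+ 2)) @ \oo --> (0 : R).
Proof.
move=> mu_ iu.
rewrite (_ : (0 : R) = \int[mu2]_z (0 : R)); last by rewrite /Rintegral integral0.
apply: (@Rdominated_cvg _ _ _ mu2 setT _ _ (fun z => u z ^+ 2)) => //.
- by move=> N; apply: measurable_funX; apply: measurable_funB => //; exact: measurable_trunc.
- apply: ae_all => z _; apply: cvg_near_cst; near=> N.
  rewrite trunc_id ?subrr ?expr0n//.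
  near: N; exact: nbhs_infty_ger.
- apply: ae_all => z N _; rewrite ger0_norm ?sqr_ge0//.
  rewrite -[leLHS](real_normK (num_real _)) -[leRHS](real_normK (num_real _)).
  by rewrite lerXn2r ?nnegrE// trunc_diff.
Unshelve. all: by end_near. Qed.

(* Jensen's inequality bounds the averages in L^2 uniformly in k, so it is enough to
   treat bounded D, for which Lebesgue differentiation and dominated convergence apply. *)
Lemma avg_weak D g : meas2 D ->
  mu2.-integrable setT (EFin \o (fun z : RR => D z.1 z.2 ^+ 2)) ->
  meas2 g ->
  mu2.-integrable setT (EFin \o (fun z : RR => g z.1 z.2 ^+ 2)) ->
  mu2.-integrable setT (EFin \o (fun z : RR => g z.1 z.2)) ->
  (fun k => \int[mu2]_z (g z.1 z.2 * avg k (D z.1) z.2)) @ \oo -->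
    \int[mu2]_z (g z.1 z.2 * D z.1 z.2).
Proof.
move=> mD iD mg ig2 ig.
apply/cvgrPdist_le => e e0.
have e84 : e / 8 + e / 8 = e / 4 by field.
set A := \int[mu2]_z (g z.1 z.2 ^+ 2).
have A0 : 0 <= A by apply: Rintegral_ge0 => z _; exact: sqr_ge0.
(* The weight in Young's inequality: it brings the part with g below e / 8, and a truncation error
   of at most e / (4 l) does the same for the other part. [A + 1] replaces [A], which may be 0. *)
pose l := (4 * (A + 1)) / e.
have l0 : 0 < l by rewrite divr_gt0// mulr_gt0// ltr_wpDl.
have lA : 2^-1 * (l^-1 * A) <= e / 8.
  have A1 : A + 1 != 0 by rewrite gt_eqF// ltr_wpDl.
  have -> : 2^-1 * (l^-1 * A) = e / 8 * (A / (A + 1)).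
    by rewrite /l; field; rewrite A1 gt_eqF.
  rewrite -[leRHS]mulr1 ler_wpM2l ?divr_ge0 ?ltW//.
  by rewrite ltr_pdivrMr ?mul1r ?ltrDl// ltr_wpDl.
have e4l : 0 < e / (4 * l) by rewrite divr_gt0// mulr_gt0.
have /cvgrPdist_le/(_ _ e4l) TN := trunc_cvg_L2 mD iD.
have [N _ HN] := TN; have {HN TN} := HN N (leqnn N); rewrite /= sub0r normrN.
pose DN x t := trunc N (D x t); pose E x t := D x t - DN x t.
have mDN : meas2 DN by exact: measurable_trunc.
have mE : meas2 E by exact: measurable_funB.
have iE : mu2.-integrable setT (EFin \o (fun z : RR => E z.1 z.2 ^+ 2)).
  apply: (@intg_ae_le _ _ _ mu2 _ _ _ measurableT _ iD); first exact: measurable_funX.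
  apply: ae_all => z _; rewrite ger0_norm ?sqr_ge0//.
  rewrite -[leLHS](real_normK (num_real _)) -[leRHS](real_normK (num_real _)).
  by rewrite lerXn2r ?nnegrE// trunc_diff.
rewrite -/(\int[mu2]_z (E z.1 z.2 ^+ 2)) ger0_norm; last first.
  by apply: Rintegral_ge0 => z _; exact: sqr_ge0.
set B := \int[mu2]_z _ => BE.
have B0 : 0 <= B by apply: Rintegral_ge0 => z _; exact: sqr_ge0.
have lB : 2^-1 * (l * B) <= e / 8.
  have : l * B <= l * (e / (4 * l)) by rewrite ler_pM2l.
  have -> : l * (e / (4 * l)) = e / 4 by field; rewrite gt_eqF.
  by move=> ?; lra.
have DNb x t : `|DN x t| <= N%:R by exact: trunc_bound.
have e40 : 0 < e / 4 by rewrite divr_gt0.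
have /cvgrPdist_le/(_ _ e40) := avg_weak_bounded mDN DNb mg ig.
apply: filterS => k Hk.
have igE : mu2.-integrable setT (EFin \o (fun z : RR => g z.1 z.2 * E z.1 z.2)).
  exact: intg_mul_sq.
have [iAE AE] := avg_L2 k mE iE.
have mAE : measurable_fun setT (fun z : RR => avg k (E z.1) z.2) := measurable_avg2 k mE.
have mADN : measurable_fun setT (fun z : RR => avg k (DN z.1) z.2) := measurable_avg2 k mDN.
have mAD : measurable_fun setT (fun z : RR => avg k (D z.1) z.2) := measurable_avg2 k mD.
have igAE : mu2.-integrable setT (EFin \o (fun z : RR => g z.1 z.2 * avg k (E z.1) z.2)).
  exact: intg_mul_sq.
have iNg : mu2.-integrable setT (EFin \o (fun z : RR => N%:R * `|g z.1 z.2|)).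
  by apply: intgZ => //; exact: integrable_norm ig.
have igDN : mu2.-integrable setT (EFin \o (fun z : RR => g z.1 z.2 * DN z.1 z.2)).
  apply: (@intg_ae_le _ _ _ mu2 _ _ _ measurableT _ iNg); first exact: measurable_funM.
  by apply: ae_all => z _; rewrite normrM mulrC ler_wpM2r.
have ADNb x t : `|avg k (DN x) t| <= N%:R.
  by apply: avg_bound => //; exact: (meas2_sec1 x mDN).
have igADN : mu2.-integrable setT (EFin \o (fun z : RR => g z.1 z.2 * avg k (DN z.1) z.2)).
  apply: (@intg_ae_le _ _ _ mu2 _ _ _ measurableT _ iNg); first exact: measurable_funM.
  by apply: ae_all => z _; rewrite normrM mulrC ler_wpM2r.
have E1 : \int[mu2]_z (g z.1 z.2 * D z.1 z.2) =
    \int[mu2]_z (g z.1 z.2 * DN z.1 z.2) + \int[mu2]_z (g z.1 z.2 * E z.1 z.2).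
  by rewrite -RintegralD//; apply: eq_Rintegral => z _; rewrite /E; ring.
have [iAD _] := avg_L2 k mD iD.
have igAD : mu2.-integrable setT (EFin \o (fun z : RR => g z.1 z.2 * avg k (D z.1) z.2)).
  exact: intg_mul_sq.
have E2 : \int[mu2]_z (g z.1 z.2 * avg k (D z.1) z.2) =
    \int[mu2]_z (g z.1 z.2 * avg k (DN z.1) z.2) +
    \int[mu2]_z (g z.1 z.2 * avg k (E z.1) z.2).
  rewrite -RintegralD//.
  (* [avg] is additive on D = DN + E only where D x is integrable on the window, that is for almost
     every x; hence the comparison section by section. *)
  pose g1 x t := g x t * avg k (D x) t.
  pose g2 x t := g x t * avg k (DN x) t + g x t * avg k (E x) t.
  have m1 : measurable_fun setT (fun z : RR => g1 z.1 z.2) by exact: measurable_funM.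
  have m2 : measurable_fun setT (fun z : RR => g2 z.1 z.2).
    by apply: measurable_funD; exact: measurable_funM.
  have i2 : mu2.-integrable setT (EFin \o (fun z : RR => g2 z.1 z.2)) by exact: intgD.
  rewrite -[LHS](intg2_fubini (f := g1) m1 igAD) -[RHS](intg2_fubini (f := g2) m2 i2).
  apply: ae_eq_Rintegral => //; try exact: meas2_Rint.
  apply: ae_imp (intg2_ae (f := fun x t => D x t ^+ 2) iD) => x ix _.
  apply: eq_Rintegral => t _; rewrite /g1 /g2 -mulrDr; congr (_ * _).
  have fin : (mu (`[(t - win k)%R, t]%classic) < +oo)%E by rewrite measure_win ltry.
  have mDx : measurable_fun setT (D x) := meas2_sec1 x mD.
  have mDNx : measurable_fun setT (DN x) := meas2_sec1 x mDN.
  have iDx : mu.-integrable `[t - win k, t]%classic (EFin \o D x).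
    apply: intg_of_sq => //; first exact: measurable_funTS.
    exact: intgS ix.
  have iDNx : mu.-integrable `[t - win k, t]%classic (EFin \o DN x).
    apply: (@intg_bounded _ _ _ mu _ _ N%:R) => //; first exact: measurable_funTS.
    exact: ae_all.
  rewrite /avg -mulrDr; congr (_ * _); rewrite /E RintegralB//; ring.
have Y1 : `|\int[mu2]_z (g z.1 z.2 * E z.1 z.2)| <= e / 4.
  apply: le_trans (Young_Rintegral l0 mg mE ig2 iE) _.
  by rewrite -/A -/B mulrDr -e84 lerD.
have Y2 : `|\int[mu2]_z (g z.1 z.2 * avg k (E z.1) z.2)| <= e / 4.
  apply: le_trans (Young_Rintegral l0 mg mAE ig2 iAE) _.
  by rewrite -/A mulrDr -e84 lerD// (le_trans _ lB)// ler_wpM2l// ler_pM2l.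
rewrite E1 E2.
exact: normB_add_le (ltW e0) Hk Y1 Y2.
Qed.

End Steklov.

Lemma subr_eq_sub (V : zmodType) (x y z t s : V) :
  s = x + y -> s = z + t -> y - z = t - x.
Proof.
move=> e1 e2; have -> : y = s - x by rewrite e1 addrC addKr.
have -> : t = s - z by rewrite e2 addrC addKr.
exact: addrAC.
Qed.

(** * From difference quotients to the energy inequality *)

Section Energy.
Variable R : realType.
Local Notation mu := (@lebesgue_measure R).
Local Notation mu2 := (mu \x mu)%E.
Implicit Types (f : R -> R) (z D g : R -> R -> R) (k : nat).

Lemma measurable_shift (h : R) : measurable_fun setT (fun t : measurableTypeR R => (t - h : measurableTypeR R)).
Proof. exact: measurable_funB. Qed.

Lemma shift_preimage_itv (h r r' : R) b1 b2 :
  (fun t : R => t - h) @^-1` [set` Interval (BSide b1 (r - h)) (BSide b2 (r' - h))] =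
  [set` Interval (BSide b1 r) (BSide b2 r')].
Proof.
apply/seteqP; split => t; rewrite /= !in_itv/=.
  by case: b1; case: b2; rewrite /= ?lerD2r ?ltrD2r.
by case: b1; case: b2; rewrite /= ?lerD2r ?ltrD2r.
Qed.

Lemma lebesgue_measure_shift (h : R) (A : set R) : measurable A ->
  pushforward mu (fun t : measurableTypeR R => (t - h : measurableTypeR R)) A = mu A.
Proof.
move=> mA; apply/esym.
have mS := measurable_shift h.
pose nu : {measure set (measurableTypeR R) -> \bar R} :=
  measure_function_pushforward__canonical__measure_function_Measure mu mS.
apply: (@lebesgue_measure_unique _ nu) => //= _ [[a b]] _ <-.
rewrite /pushforward.
have -> : (fun t : R => t - h) @^-1` `]a, b] = `]a + h, b + h]%classic.
  by rewrite -(shift_preimage_itv h (a + h) (b + h)) !addrK.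
rewrite /= !lebesgue_measure_itv/= !lte_fin ltrD2r; case: ifP => // _.
by rewrite -!EFinB; congr EFin; ring.
Qed.

Lemma ae_shift (h : R) (P : R -> Prop) : (\forall t \ae mu, P t) ->
  \forall t \ae mu, P (t - h).
Proof.
move=> [N [mN N0 sN]].
exists ((fun t : R => t - h) @^-1` N); split.
- by rewrite -[X in measurable X]setTI; exact: measurable_shift.
- by rewrite -[RHS]N0 -(lebesgue_measure_shift h mN).
- by move=> t /= H; apply: sN.
Qed.

Lemma integral_shift (h : R) (A : set R) (f : R -> \bar R) : measurable A ->
  measurable_fun setT f -> (forall t, 0 <= f t)%E ->
  (\int[mu]_(t in (fun t => (t - h)%R) @^-1` A) f (t - h)%R = \int[mu]_(t in A) f t)%E.
Proof.
move=> mA mf f0.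
have mS := measurable_shift h.
have := @ge0_integral_pushforward _ _ _ _ _ _ mS mu A f mA (measurable_funTS mf) (fun y _ => f0 y).
rewrite /comp => <-; apply: eq_measure_integral => /= B mB BA.
exact: lebesgue_measure_shift.
Qed.

Lemma Rintegral_shift (h r r' : R) f : measurable_fun setT f -> (forall t, 0 <= f t) ->
  \int[mu]_(t in `[r, r']) f (t - h) = \int[mu]_(t in `[r - h, r' - h]) f t.
Proof.
move=> mf f0; rewrite /Rintegral; congr fine.
rewrite -(shift_preimage_itv h) (integral_shift h (f := fun t => (f t)%:E))//.
exact/measurable_EFinP.
Qed.

Lemma intg_shift (h : R) f : measurable_fun setT f -> (forall t, 0 <= f t) ->
  mu.-integrable setT (EFin \o f) -> mu.-integrable setT (EFin \o (fun t => f (t - h))).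
Proof.
move=> mf f0 /integrableP[_ H]; apply/integrableP; split.
  by apply/measurable_EFinP; apply: measurableT_comp => //; exact: measurable_shift.
apply: le_lt_trans H; rewrite le_eqVlt; apply/orP; left; apply/eqP.
rewrite -[X in integral _ X _](preimage_setT (fun t : R => t - h)).
rewrite (integral_shift h (f := fun t => `|(EFin \o f) t|%E))//.
by apply: measurableT_comp => //; exact/measurable_EFinP.
Qed.

Lemma Rintegral_itv_split f (r s t : R) : r <= s -> s <= t ->
  mu.-integrable `[r, t]%classic (EFin \o f) ->
  \int[mu]_(x in `[r, t]) f x =
  \int[mu]_(x in `[r, s]) f x + \int[mu]_(x in `[s, t]) f x.
Proof.
move=> rs st fi.
have := @Rintegral_itvB _ f (BLeft r) (BRight t) s fi.
rewrite !bnd_simp => /(_ rs st) /eqP; rewrite subr_eq addrC => /eqP ->.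
rewrite Rintegral_itv_obnd_cbnd//.
by apply: intgS fi => //; apply: subset_itvScc; rewrite bnd_simp//.
Qed.

Definition sqn z (t : R) : R := \int[mu]_x (z t x ^+ 2).

(* The identity for [z t - z s] tested with [z t] gives, by
   a^2 - b^2 <= 2 (a - b) a, the inequality below for the difference quotients;
   the limit of vanishing time step is taken by [avg_weak]. *)
Lemma energy_ineq (al be : R) z g D :
  meas2 z -> meas2 g -> meas2 D ->
  intg2 (fun t x => z t x ^+ 2) -> intg2 (fun t x => g t x ^+ 2) ->
  intg2 (fun t x => D t x ^+ 2) -> intg2 g ->
  (forall k, \forall t \ae mu, al < t - win R k -> t < be ->
    sqn z t - \int[mu]_x (z (t - win R k) x * z t x) =
    - \int[mu]_(s in `[t - win R k, t]) \int[mu]_x (D s x * g t x)) ->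
  exists2 L : R -> Prop, (\forall r \ae mu, L r) &
    forall r r', L r -> L r' -> al < r -> r < r' -> r' < be ->
      sqn z r' - sqn z r <= - 2 * \int[mu]_(t in `[r, r']) \int[mu]_x (D t x * g t x).
Proof.
move=> mz mg mD iz ig2 iD ig H.
have mz2 : meas2 (fun t x => z t x ^+ 2) by exact: measurable_funX.
have mD2 : meas2 (fun t x => D t x ^+ 2) by exact: measurable_funX.
have me : measurable_fun setT (sqn z) := meas2_Rint (f := fun t x => z t x ^+ 2) mz2.
have ie : mu.-integrable setT (EFin \o sqn z) := intg2_Rint (f := fun t x => z t x ^+ 2) mz2 iz.
have e0 t : 0 <= sqn z t by apply: Rintegral_ge0 => x _; exact: sqr_ge0.
have lie : locally_integrable setT (sqn z) by apply: open_integrable_locally => //; exact: openT.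
(* Good times are those at which the backward averages of the energy converge to the energy; the
   difference quotients see the energy only through these averages. *)
exists (fun r => (fun k => avg k (sqn z) r) @ \oo --> sqn z r); first exact: avg_cvg.
move=> r r' Lr Lr' alr rr' r'be.
(* [avg] acts on the second variable, so time comes second in [Dt] and [gr]. The indicator in [gr]
   restricts time to [r, r']. *)
pose Dt (x t : R) := D t x.
pose gr (x t : R) := g t x * \1_(`[r, r']%classic) t.
have mDt : meas2 Dt := meas2_swap (f := D) mD.
have mind : meas2 (fun _ t : R => \1_(`[r, r']%classic) t : R).
  by apply: measurableT_comp => //; exact: measurable_indic.
have mgt : meas2 (fun x t => g t x) := meas2_swap (f := g) mg.
have mgr : meas2 gr by exact: measurable_funM.
have gr_le x t : `|gr x t| <= `|g t x|.
  by rewrite /gr normrM ler_piMr// indicE ger0_norm// lern1 leq_b1.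
have igr : intg2 gr.
  apply: (@intg_ae_le _ _ _ mu2 _ _ _ measurableT _ (integrable_norm (intg2_swap (f := g) mg ig))) => //.
  by apply: ae_all => y _; exact: gr_le.
have igr2 : intg2 (fun x t => gr x t ^+ 2).
  have mg2 : meas2 (fun t x => g t x ^+ 2) by exact: measurable_funX.
  apply: (@intg_ae_le _ _ _ mu2 _ _ _ measurableT _ (intg2_swap (f := fun t x => g t x ^+ 2) mg2 ig2)).
    exact: measurable_funX.
  apply: ae_all => y _; rewrite ger0_norm ?sqr_ge0//.
  rewrite -[leLHS](real_normK (num_real _)) -[leRHS](real_normK (num_real _)).
  by rewrite lerXn2r ?nnegrE//; exact: gr_le.
have iDt : intg2 (fun x t => Dt x t ^+ 2) := intg2_swap (f := fun t x => D t x ^+ 2) mD2 iD.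
have W := avg_weak mDt iDt mgr igr2 igr.
have mA k : meas2 (fun x => avg k (Dt x)) := measurable_avg2 k mDt.
have mgA k : meas2 (fun x t => gr x t * avg k (Dt x) t) := measurable_funM mgr (mA k).
have igA k : intg2 (fun x t => gr x t * avg k (Dt x) t).
  apply: (intg_mul_sq measurableT mgr (mA k) igr2).
  by have [] := avg_L2 k mDt iDt.
have mgA' k := meas2_swap (f := fun x t => gr x t * avg k (Dt x) t) (mgA k).
have igA' k := intg2_swap (f := fun x t => gr x t * avg k (Dt x) t) (mgA k) (igA k).
have mgD : meas2 (fun t x => D t x * g t x) := measurable_funM mD mg.
have igD : intg2 (fun t x => D t x * g t x).
  exact: (intg_mul_sq measurableT mD mg iD ig2).
have iB := intg2_Rint (f := fun t x => D t x * g t x) mgD igD.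
have Wlim : \int[mu2]_z (gr z.1 z.2 * Dt z.1 z.2) =
    \int[mu]_(t in `[r, r']) \int[mu]_x (D t x * g t x).
  rewrite Rintegral_ind.
  have mgD1 : meas2 (fun x t => gr x t * Dt x t) := measurable_funM mgr mDt.
  have igD1 : intg2 (fun x t => gr x t * Dt x t).
    exact: (intg_mul_sq measurableT mgr mDt igr2 iDt).
  rewrite -(intg2_fubini (f := fun x t => gr x t * Dt x t) mgD1 igD1).
  rewrite (intg2_fubini_swap (f := fun x t => gr x t * Dt x t) mgD1 igD1).
  apply: ae_eq_Rintegral => //.
  - exact: (meas2_Rint (f := fun t x => gr x t * Dt x t) (meas2_swap (f := fun x t => gr x t * Dt x t) mgD1)).
  - apply: measurable_funM; first exact: (meas2_Rint (f := fun t x => D t x * g t x) mgD).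
    exact: measurable_indic.
  - apply: ae_imp (intg2_ae (f := fun t x => D t x * g t x) igD) => t it _.
    rewrite -RintegralZr//; apply: eq_Rintegral => x _; rewrite /gr /Dt; ring.
rewrite -Wlim.
apply: (ler_cvg_to (cvgB Lr' Lr) (cvgM (cvg_cst (- 2 : R)) W)).
near=> k.
have h0 := win_gt0 R k.
have hr : win R k < r - al.
  near: k; rewrite /win.
  have : 0 < r - al by rewrite subr_gt0.
  move=> ra0; exact: (near_infty_natSinv_lt (PosNum ra0)).
have alr' : al < r - win R k by rewrite ltrBrDl -ltrBrDr.
have iez : mu.-integrable `[r - win R k, r']%classic (EFin \o sqn z) by exact: intgS ie.
(* The integral over [r, r'] of the increments with step [win] k telescopes: only the windows behind
   r' and r remain. *)
have Lhs : avg k (sqn z) r' - avg k (sqn z) r =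
    k.+1%:R * \int[mu]_(t in `[r, r']) (sqn z t - sqn z (t - win R k)).
  rewrite RintegralB//; last 2 first.
  - exact: intgS ie.
  - by apply: intgS (intg_shift _ me e0 ie).
  rewrite Rintegral_shift// /avg -mulrBr; congr (_ * _).
  have e1 := Rintegral_itv_split _ _ iez.
  have := e1 r; have := e1 (r' - win R k).
  have w0 := ltW h0.
  rewrite lerD2r !gerBl w0 (ltW rr') => /(_ isT isT) e2 /(_ isT isT) e3.
  exact: subr_eq_sub e2 e3.
suff : avg k (sqn z) r' - avg k (sqn z) r <=
  - 2 * \int[mu2]_z (gr z.1 z.2 * avg k (Dt z.1) z.2) by [].
rewrite Lhs.
have -> : \int[mu2]_z0 (gr z0.1 z0.2 * avg k (Dt z0.1) z0.2) =
    \int[mu]_(t in `[r, r']) \int[mu]_x (gr x t * avg k (Dt x) t).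
  rewrite -(intg2_fubini (f := fun x t => gr x t * avg k (Dt x) t) (mgA k) (igA k)).
  rewrite (intg2_fubini_swap (f := fun x t => gr x t * avg k (Dt x) t) (mgA k) (igA k)).
  rewrite (@supp_Rintegral _ _ _ mu setT `[r, r']%classic)// => t _ rt.
  under eq_Rintegral do rewrite /gr indicE memNset// mulr0 mul0r.
  by rewrite /Rintegral integral0.
have iR : mu.-integrable `[r, r']%classic
    (EFin \o (fun t => \int[mu]_x (gr x t * avg k (Dt x) t))).
  exact: intgS (intg2_Rint (f := fun t x => gr x t * avg k (Dt x) t) (mgA' k) (igA' k)).
have i2w : mu.-integrable `[r, r']%classic
    (EFin \o (fun t => - (2 * win R k) * \int[mu]_x (gr x t * avg k (Dt x) t))).
  exact: intgZ.
apply: (@le_trans _ _ (k.+1%:R * \int[mu]_(t in `[r, r'])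
   (- (2 * win R k) * \int[mu]_x (gr x t * avg k (Dt x) t)))); last first.
  by rewrite RintegralZl// mulrA mulrN mulrCA mulr_win mulr1.
rewrite ler_wpM2l//.
apply: ae_le_Rintegral => //.
- apply: intgB => //; first exact: intgS ie.
  by apply: intgS (intg_shift _ me e0 ie).
have az := intg2_ae (f := fun t x => z t x ^+ 2) iz.
have ag := intg2_ae (f := fun t x => g t x ^+ 2) ig2.
have aA := intg2_ae (igA' k).
apply: ae_imp (ae_and (ae_and az (ae_shift (win R k) az)) (ae_and aA (ae_and ag (H k)))).
move=> t [[izt izs] [igax [igt Ht]]].
rewrite /= in_itv/= => /andP[rt tr'].
have {}Ht := Ht (lt_le_trans alr' (lerB rt (lexx _))) (le_lt_trans tr' r'be).
have mzt : measurable_fun setT (z t) := meas2_sec1 t mz.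
have mzs : measurable_fun setT (z (t - win R k)) := meas2_sec1 _ mz.
have izz := leb_mul_sq measurableT mzs mzt izs izt.
have Hle : sqn z t - sqn z (t - win R k) <=
    2 * (sqn z t - \int[mu]_x (z (t - win R k) x * z t x)).
  rewrite -subr_ge0.
  have -> : 2 * (sqn z t - \int[mu]_x (z (t - win R k) x * z t x)) -
      (sqn z t - sqn z (t - win R k)) =
    \int[mu]_x ((z t x ^+ 2 - 2 * (z (t - win R k) x * z t x)) + z (t - win R k) x ^+ 2).
    have iz2 := intgZ 2 measurableT izz.
    rewrite RintegralD//; last exact: intgB.
    rewrite RintegralB// RintegralZl// /sqn; ring.
  apply: Rintegral_ge0 => x _.
  rewrite (_ : _ + _ = (z t x - z (t - win R k) x) ^+ 2) ?sqr_ge0//; ring.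
apply: (le_trans Hle); rewrite Ht.
(* Exchanging the integrals in s and x makes the time integral over the window an average of D at
   fixed x, while g stays frozen at time t. *)
have Dg : \int[mu]_(s in `[t - win R k, t]) \int[mu]_x (D s x * g t x) =
    win R k * \int[mu]_x (gr x t * avg k (Dt x) t).
  pose Q s x := D s x * (g t x * \1_(`[t - win R k, t]%classic) s).
  have mgt2 : meas2 (fun s x => g t x * \1_(`[t - win R k, t]%classic) s).
    apply: measurable_funM.
      by apply: measurableT_comp => //; exact: (meas2_sec1 t mg).
    by apply: measurableT_comp => //; exact: measurable_indic.
  have igt2 : intg2 (fun s x => (g t x * \1_(`[t - win R k, t]%classic) s) ^+ 2).
    have mgtx : measurable_fun setT (g t) := meas2_sec1 t mg.
    have E s x : (g t x * \1_(`[t - win R k, t]%classic) s) ^+ 2 =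
        \1_(`[t - win R k, t]%classic) s * g t x ^+ 2.
      by rewrite exprMn mulrC indicE; case: (_ \in _); rewrite ?expr1n ?expr0n.
    apply: intg2_Tonelli.
    - exact: measurable_funX.
    - by move=> s x; exact: sqr_ge0.
    - apply: ae_all => s; under eq_fun do rewrite E.
      exact: intgZ.
    - apply: (@eq_integrable _ _ _ mu setT measurableT
        (EFin \o (fun s => (\int[mu]_x (g t x ^+ 2)) * \1_(`[t - win R k, t]%classic) s))) => //.
        move=> s _; rewrite /= [RHS](_ : _ = (\int[mu]_x (\1_(`[t - win R k, t]%classic) s * g t x ^+ 2))%:E).
          by rewrite RintegralZl// mulrC.
        by congr EFin; apply: eq_Rintegral => x _.
      apply: intgZ => //; exact: integrable_indic_itv.
  have mQ : meas2 Q := measurable_funM mD mgt2.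
  have iQ : intg2 Q := intg_mul_sq measurableT mD mgt2 iD igt2.
  transitivity (\int[mu]_s \int[mu]_x Q s x).
    rewrite Rintegral_ind; apply: ae_eq_Rintegral => //.
    - apply: measurable_funM; last exact: measurable_indic.
      apply: (meas2_Rint (f := fun s x => D s x * g t x)).
      apply: measurable_funM => //.
      by apply: measurableT_comp => //; exact: (meas2_sec1 t mg).
    - exact: (meas2_Rint mQ).
    - apply: ae_imp (intg2_ae (f := fun t x => D t x ^+ 2) iD) => s iDs _.
      rewrite -RintegralZr//; last first.
        exact: (leb_mul_sq measurableT (meas2_sec1 s mD) (meas2_sec1 t mg) iDs igt).
      by apply: eq_Rintegral => x _; rewrite /Q mulrA.
  rewrite (intg2_fubini_swap mQ iQ).
  have iDsw := intg2_ae (f := fun x t => Dt x t ^+ 2) iDt.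
  rewrite -RintegralZl//.
  apply: ae_eq_Rintegral => //.
  - exact: (meas2_Rint (meas2_swap mQ)).
  - apply: measurable_funM => //.
    exact: (measurable_funM (meas2_sec2 t mgr) (meas2_sec2 t (mA k))).
  - apply: ae_imp iDsw => x iDx _.
    have fin : (mu (`[(t - win R k)%R, t]%classic) < +oo)%E by rewrite measure_win ltry.
    have iDx1 : mu.-integrable `[t - win R k, t]%classic (EFin \o Dt x).
      apply: intg_of_sq => //; first exact: (measurable_funTS (meas2_sec1 x mDt)).
      exact: intgS iDx.
    rewrite /gr indicE mem_set ?mulr1/= ?in_itv/= ?rt ?tr'//.
    rewrite /avg mulrCA [win R k * _]mulrA [win R k * _]mulrC mulr_win mul1r.
    rewrite -RintegralZl// Rintegral_ind.
    by apply: eq_Rintegral => s _; rewrite /Q /Dt; ring.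
by rewrite Dg mulrN mulNr mulrA.
Unshelve. all: by end_near.
Qed.

End Energy.

(** * Coercivity of the flux *)

Section Algebra.
Variables (R : realType) (n : nat) (K : 'I_n.+1 -> 'I_n.+1 -> R).
Hypothesis n1 : (1 <= n)%N.
Implicit Types (y g p w : 'I_n.+1 -> R).

Lemma Kplus_ge i j : i != j -> K i j <= Kplus K.
Proof.
move=> ij; rewrite /Kplus.
exact: (@le_bigmax_cond _ _ _ _ (i, j) (fun x => x.1 != x.2) (fun x => K x.1 x.2)).
Qed.

Lemma Kminus_le i j : i != j -> Kminus K <= K i j.
Proof.
move=> ij; rewrite /Kminus.
exact: (@bigmin_le_cond _ _ _ _ (i, j) (fun x => x.1 != x.2) (fun x => K x.1 x.2)).
Qed.

Lemma Kgap_norm i j : i != j -> `|K i j - Kmean K| <= Kgap K.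
Proof.
move=> ij; have := Kplus_ge ij; have := Kminus_le ij.
by rewrite ler_norml /Kmean /Kgap; lra.
Qed.

(** The flux at one point (t, x). [flux] unfolds to it, so the algebraic estimates apply directly at
    almost every point of the cylinder. *)
Definition pflux y g i : R := \sum_(j | j != i) K i j * (y j * g i - y i * g j).

Lemma sum_neq_cst (i : 'I_n.+1) (c : R) : \sum_(j | j != i) c = n%:R * c.
Proof.
rewrite sumr_const mulr_natl; congr (_ *+ _).
by rewrite -[LHS]/(#|predC1 i|) cardC1 card_ord.
Qed.

Lemma sum_neq_swap (h : 'I_n.+1 -> R) :
  \sum_i \sum_(j | j != i) h j = n%:R * \sum_i h i.
Proof.
rewrite (exchange_big_dep xpredT)//= mulr_sumr.
apply: eq_bigr => j _; rewrite -(sum_neq_cst j).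
by apply: eq_bigl => i; rewrite eq_sym.
Qed.

(** Since y sums to 1 and g to 0, the sum over j of y_j g_i - y_i g_j is g_i: with equal
    coefficients the cross-diffusion reduces to a linear heat flux. *)
Lemma pflux_split y g i : in_simplex y -> \sum_i g i = 0 ->
  pflux y g i = Kmean K * g i +
    \sum_(j | j != i) (K i j - Kmean K) * (y j * g i - y i * g j).
Proof.
move=> [_ y1] g0.
have E : g i = \sum_(j | j != i) (y j * g i - y i * g j).
  have : \sum_j (y j * g i - y i * g j) = g i.
    by rewrite sumrB -mulr_suml y1 -mulr_sumr g0 mulr0 subr0 mul1r.
  by rewrite (bigD1 i)//= mulrC subrr add0r => ->.
rewrite {1}E mulr_sumr -big_split /=; apply: eq_bigr => j _; ring.
Qed.

(** In the remainder of [pflux_split] tested with g, the pair (i, j) costs at most kappa times g_i^2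
    + (g_i^2 + g_j^2) / 2, as the y_i lie in [0, 1]. Over all i and j != i the coefficients 3/2 and
    1/2 each occur n times, which adds up to 2 n. *)
Lemma pflux_coercive y g : in_simplex y -> \sum_i g i = 0 ->
  (Kmean K - 2 * n%:R * Kgap K) * \sum_i (g i ^+ 2) <= \sum_i pflux y g i * g i.
Proof.
move=> sy g0.
have y01 i : 0 <= y i <= 1.
  have [y0 y1] := sy; rewrite y0/= -y1 (bigD1 i)//= lerDl sumr_ge0//.
have k0 : 0 <= Kgap K.
  have ij : (ord0 : 'I_n.+1) != ord_max by rewrite -val_eqE/= eq_sym -lt0n.
  exact: le_trans (Kgap_norm ij).
have -> : (Kmean K - 2 * n%:R * Kgap K) * \sum_i (g i ^+ 2) =
    \sum_i (Kmean K * g i ^+ 2 - \sum_(j | j != i) Kgap K * (3 / 2 * g i ^+ 2 + 1 / 2 * g j ^+ 2)).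
  rewrite sumrB -mulr_sumr.
  under [X in _ = _ - X]eq_bigr do rewrite -mulr_sumr big_split/= sum_neq_cst -mulr_sumr.
  rewrite -mulr_sumr big_split/= -!mulr_sumr sum_neq_swap.
  by set S := \sum_i _; field.
apply: ler_sum => i _.
rewrite (pflux_split i sy g0) [leRHS]mulrDl -(mulrA (Kmean K)) -expr2 lerD2l -sumrN mulr_suml.
apply: ler_sum => j ji.
have := Kgap_norm ji; rewrite distrC; have := Kgap_norm (i:=i) (j:=j); rewrite eq_sym => /(_ ji).
set k := K i j - Kmean K => Hk _.
have /andP[yj0 yj1] := y01 j; have /andP[yi0 yi1] := y01 i.
have H : `|(y j * g i - y i * g j) * g i| <= 3 / 2 * g i ^+ 2 + 1 / 2 * g j ^+ 2.
  rewrite mulrBl; apply: le_trans (ler_normB _ _) _.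
  have h1 : `|y j * g i * g i| <= g i ^+ 2.
    rewrite -mulrA -expr2 normrM (ger0_norm yj0) (ger0_norm (sqr_ge0 _)).
    by apply: ler_piMl => //; exact: sqr_ge0.
  have h2 : `|y i * g j * g i| <= 1 / 2 * (g i ^+ 2 + g j ^+ 2).
    rewrite -mulrA normrM (ger0_norm yi0).
    apply: (@le_trans _ _ `|g j * g i|); first exact: ler_piMl.
    rewrite ler_norml; have := sqr_ge0 (g i - g j); have := sqr_ge0 (g i + g j); nra.
  lra.
have : `|k * ((y j * g i - y i * g j) * g i)| <= Kgap K * (3 / 2 * g i ^+ 2 + 1 / 2 * g j ^+ 2).
  by rewrite normrM ler_pM.
by rewrite ler_norml mulrA => /andP[].
Qed.

Lemma sqr_sum_le (m : nat) (h : 'I_m -> R) :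
  (\sum_i h i) ^+ 2 <= m%:R * \sum_i (h i ^+ 2).
Proof.
elim: m h => [|m IH] h; first by rewrite !big_ord0 expr0n mulr0.
rewrite !big_ord_recl /=; set s := \sum_i _; set q := \sum_i _.
have H : s ^+ 2 <= m%:R * q by exact: IH.
have q0 : 0 <= q by apply: sumr_ge0 => i _; exact: sqr_ge0.
rewrite -natr1.
have [m0|m0] := posnP m.
  have s0 : s = 0 by rewrite /s; subst m; rewrite big_ord0.
  have -> : m%:R = 0 :> R by rewrite [in LHS]m0.
  by rewrite s0 addr0 mulrDl mul0r add0r mul1r lerDl.
have mp : 0 < m%:R :> R by rewrite ltr0n.
have : 0 <= (m%:R * h ord0 - s) ^+ 2 by exact: sqr_ge0.
have H2 : s ^+ 2 / m%:R <= q by rewrite ler_pdivrMr// mulrC.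
have E : (m%:R * h ord0 - s) ^+ 2 / m%:R = m%:R * h ord0 ^+ 2 - 2 * h ord0 * s + s ^+ 2 / m%:R.
  by field; rewrite gt_eqF.
have : 0 <= (m%:R * h ord0 - s) ^+ 2 / m%:R by rewrite divr_ge0 ?sqr_ge0// ltW.
rewrite E; nra.
Qed.

Lemma pflux_norm_le y g i : in_simplex y -> (forall i j, i != j -> 0 < K i j) ->
  `|pflux y g i| <= Kplus K * (2 * n%:R + 2) * \sum_j `|g j|.
Proof.
move=> sy Kp.
have y01 k : 0 <= y k <= 1.
  have [y0 y1] := sy; rewrite y0/= -y1 (bigD1 k)//= lerDl sumr_ge0//.
have Kp0 : 0 <= Kplus K.
  have ij : (ord0 : 'I_n.+1) != ord_max by rewrite -val_eqE/= eq_sym -lt0n.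
  exact: le_trans (ltW (Kp _ _ ij)) (Kplus_ge ij).
apply: (@le_trans _ _ (\sum_(j | j != i) (Kplus K * (2 * \sum_j `|g j|)))).
  apply: le_trans (ler_norm_sum _ _ _) _; apply: ler_sum => j ji.
  rewrite normrM ler_pM//.
    by rewrite ger0_norm ?Kplus_ge 1?eq_sym// ltW// Kp// eq_sym.
  have G k : `|g k| <= \sum_j `|g j| by rewrite (bigD1 k)//= lerDl sumr_ge0.
  apply: le_trans (ler_normB _ _) _; rewrite !normrM.
  have /andP[yj0 yj1] := y01 j; have /andP[yi0 yi1] := y01 i.
  rewrite !(ger0_norm (x := y _))//.
  have := ler_piMl (normr_ge0 (g i)) yj1; have := ler_piMl (normr_ge0 (g j)) yi1.
  have := G i; have := G j; lra.
rewrite sum_neq_cst.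
have : 0 <= Kplus K * \sum_j `|g j| by rewrite mulr_ge0// sumr_ge0.
have : 0 <= n%:R :> R by [].
nra.
Qed.

Lemma pflux_sq_le y g i : in_simplex y -> (forall i j, i != j -> 0 < K i j) ->
  pflux y g i ^+ 2 <= (Kplus K * (2 * n%:R + 2)) ^+ 2 * n.+1%:R * \sum_j (g j ^+ 2).
Proof.
move=> sy Kp; have H := pflux_norm_le g i sy Kp.
rewrite -[leLHS](real_normK (num_real _)) -mulrA.
apply: (@le_trans _ _ ((Kplus K * (2 * n%:R + 2) * \sum_j `|g j|) ^+ 2)).
  by rewrite lerXn2r ?nnegrE// (le_trans _ H).
rewrite [leLHS]exprMn ler_wpM2l ?sqr_ge0//.
apply: le_trans (sqr_sum_le _) _; rewrite ler_wpM2l//.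
by apply: ler_sum => j _; rewrite real_normK ?num_real.
Qed.

Hypothesis hK : 2 * n%:R * Kgap K < Kmean K.
Hypothesis Kp : forall i j, i != j -> 0 < K i j.

Definition cK : R := Kmean K - 2 * n%:R * Kgap K.

Lemma cK_gt0 : 0 < cK. Proof. by rewrite subr_gt0. Qed.

(** Coercivity bounds [cK] |p|^2 by the product of flux and gradient; Young's inequality moves half
    of it back to the left. *)
Lemma grad_le_flux y p : in_simplex y -> \sum_i p i = 0 ->
  \sum_i (p i ^+ 2) <= cK ^- 2 * \sum_i (pflux y p i ^+ 2).
Proof.
move=> sy p0; have := pflux_coercive sy p0; rewrite -/cK.
have c0 := cK_gt0.
set S := \sum_i _ => H.
have : \sum_i pflux y p i * p i <= 1 / (2 * cK) * \sum_i (pflux y p i ^+ 2) + cK / 2 * S.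
  rewrite /S !mulr_sumr -big_split /=; apply: ler_sum => i _.
  set f := pflux y p i; set q := p i.
  have -> : 1 / (2 * cK) * f ^+ 2 + cK / 2 * q ^+ 2 = f * q + 1 / (2 * cK) * (f - cK * q) ^+ 2.
    by field; rewrite gt_eqF.
  by rewrite lerDl mulr_ge0 ?sqr_ge0// divr_ge0// mulr_ge0// ltW.
set Q := \sum_i (pflux y p i ^+ 2) => H2.
have {H H2} : cK / 2 * S <= 1 / (2 * cK) * Q by lra.
have -> : cK ^- 2 * Q = (cK / 2)^-1 * (1 / (2 * cK) * Q) by field; rewrite gt_eqF.
by rewrite ler_pdivlMl// divr_gt0.
Qed.

(** The splitting is chosen so that w multiplies p and never pt: only the strong solution has to
    have a bounded gradient. All the coercivity is spent on the term with A(w) p. For each i, every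
    one of the n indices j != i gets the share [cK] / n of g_i^2 to complete a square; what is left
    over adds up to the constant in front of P2. *)
Lemma dissipation u ut p pt (P2 : R) : in_simplex ut ->
  \sum_i p i = 0 -> \sum_i pt i = 0 -> (forall i, p i ^+ 2 <= P2) ->
  - (n%:R ^+ 2 * Kplus K ^+ 2 / cK * P2 * \sum_i (u i - ut i) ^+ 2) <=
  \sum_i (pflux u p i - pflux ut pt i) * (p i - pt i).
Proof.
move=> sut p0 pt0 pP.
have c0 := cK_gt0.
pose g i := p i - pt i; pose w i := u i - ut i.
have g0 : \sum_i g i = 0 by rewrite sumrB p0 pt0 subrr.
(* [A(u) p - A(ut) pt = A(ut) (p - pt) + A(u - ut) p] *)
have E i : pflux u p i - pflux ut pt i = pflux ut g i + pflux w p i.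
  rewrite /pflux -sumrB -big_split /=; apply: eq_bigr => j _; rewrite /g /w; ring.
under [leRHS]eq_bigr do rewrite E -/(g _) mulrDl.
rewrite big_split /=.
have n0 : 0 < n%:R :> R by rewrite ltr0n.
have C1 := pflux_coercive sut g0; rewrite -/cK in C1.
have P20 : 0 <= P2 by apply: le_trans (pP ord0); exact: sqr_ge0.
have C2 : - (cK * \sum_i (g i ^+ 2) +
    n%:R ^+ 2 * Kplus K ^+ 2 / cK * P2 * \sum_i (w i ^+ 2)) <= \sum_i pflux w p i * g i.
  have -> : cK * \sum_i (g i ^+ 2) +
    n%:R ^+ 2 * Kplus K ^+ 2 / cK * P2 * \sum_i (w i ^+ 2) =
    \sum_i \sum_(j | j != i) (cK / n%:R * g i ^+ 2 +
      Kplus K ^+ 2 * P2 * n%:R / (2 * cK) * (w i ^+ 2 + w j ^+ 2)).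
    under [RHS]eq_bigr do rewrite big_split/= sum_neq_cst -mulr_sumr big_split/= sum_neq_cst.
    rewrite big_split/= -!mulr_sumr big_split/= -!mulr_sumr sum_neq_swap.
    by field; rewrite !gt_eqF.
  rewrite -sumrN; apply: ler_sum => i _; rewrite mulr_suml -sumrN; apply: ler_sum => j ji.
  set k := K i j.
  have k0 : 0 < k by apply: Kp; rewrite eq_sym.
  have kM : k <= Kplus K by apply: Kplus_ge; rewrite eq_sym.
  set x := w j * p i - w i * p j.
  have xle : x ^+ 2 <= 2 * P2 * (w i ^+ 2 + w j ^+ 2).
    have h1 : w j ^+ 2 * p i ^+ 2 <= w j ^+ 2 * P2 by rewrite ler_wpM2l ?sqr_ge0.
    have h2 : w i ^+ 2 * p j ^+ 2 <= w i ^+ 2 * P2 by rewrite ler_wpM2l ?sqr_ge0.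
    have := sqr_ge0 (w j * p i + w i * p j); rewrite /x; nra.
  have kxle : (k * x) ^+ 2 <= Kplus K ^+ 2 * (2 * P2 * (w i ^+ 2 + w j ^+ 2)).
    rewrite exprMn ler_pM ?sqr_ge0// lerXn2r ?nnegrE ?(ltW k0)//.
    exact: le_trans (ltW k0) kM.
  have -> : Kplus K ^+ 2 * P2 * n%:R / (2 * cK) * (w i ^+ 2 + w j ^+ 2) =
    n%:R / (4 * cK) * (Kplus K ^+ 2 * (2 * P2 * (w i ^+ 2 + w j ^+ 2))).
    by field; rewrite gt_eqF.
  have nc : 0 <= n%:R / (4 * cK) by rewrite divr_ge0// mulr_ge0// ltW.
  have h3 := ler_wpM2l nc kxle.
  have h4 : 0 <= cK / n%:R * (g i + n%:R / (2 * cK) * (k * x)) ^+ 2.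
    by rewrite mulr_ge0 ?sqr_ge0// divr_ge0// ltW.
  have E4 : cK / n%:R * (g i + n%:R / (2 * cK) * (k * x)) ^+ 2 =
    cK / n%:R * g i ^+ 2 + k * x * g i + n%:R / (4 * cK) * (k * x) ^+ 2.
    by field; rewrite !gt_eqF.
  by rewrite E4 in h4; lra.
rewrite -/(w _); lra.
Qed.

End Algebra.

(** * Gronwall's lemma *)

Section Gronwall.
Variable R : realType.
Local Notation mu := (@lebesgue_measure R).

Lemma small_Rintegral (m : R -> R) (s eps : R) : mu.-integrable setT (EFin \o m) -> 0 < eps ->
  exists2 dl : R, 0 < dl & `|\int[mu]_(t in `]s, s + dl]) m t| <= eps.
Proof.
move=> im e0.
have mm : measurable_fun setT m by apply: intg_measurable im.
have L : (fun k : nat => \int[mu]_t (m t * \1_(`]s, s + 1 / k.+1%:R]%classic) t)) @ \oo --> (0 : R).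
  rewrite (_ : (0 : R) = \int[mu]_t (0 : R)); last by rewrite /Rintegral integral0.
  apply: (@Rdominated_cvg _ _ _ mu setT _ _ (fun t => `|m t|)) => //.
  - by move=> k; apply: measurable_funM => //; exact: measurable_indic.
  - exact: integrable_norm im.
  - apply: ae_all => t _; apply: cvg_near_cst.
    have [ts|st] := leP t s.
      by apply: nearW => k; rewrite indicE memNset ?mulr0//= in_itv/= ltNge ts.
    near=> k; rewrite indicE memNset ?mulr0//= in_itv/= => /andP[_].
    apply/negP; rewrite -ltNge -ltrBrDl; near: k; apply: seq_div_near.
    by rewrite subr_gt0.
  - apply: ae_all => t k _; rewrite normrM ler_piMr// indicE ger0_norm// lern1 leq_b1//.
have /cvgrPdist_le/(_ _ e0)[k _ /(_ k (leqnn k))] := L.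
rewrite /= sub0r normrN => H.
exists (1 / k.+1%:R); first exact: seq_div_gt0.
rewrite Rintegral_mkcond (_ : \int[mu]_x _ = \int[mu]_t (m t * \1_(`]s, s + 1 / k.+1%:R]%classic) t))//.
apply: eq_Rintegral => t _; rewrite patchE indicE.
by case: ifPn => _; rewrite ?mulr1 ?mulr0.
Unshelve. all: by end_near. Qed.

Lemma gronwall (T M : R) (e m : R -> R) : 0 < T ->
  measurable_fun setT e -> (forall t, 0 <= e t <= M) ->
  (forall t, 0 <= m t) -> mu.-integrable setT (EFin \o m) ->
  (\forall t \ae mu, 0 < t < T -> e t <= \int[mu]_(s in `[0, t]) (m s * e s)) ->
  \forall t \ae mu, 0 < t < T -> e t = 0.
Proof.
move=> T0 me eM m0 im H.
have mm : measurable_fun setT m by apply: intg_measurable im.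
pose Z s := \forall t \ae mu, 0 < t < s -> e t = 0.
pose S := [set s | 0 <= s <= T /\ Z s].
have S0 : S 0 by split; [rewrite lexx ltW|apply: ae_all => t; lra].
have hS : has_sup S.
  by split; [exists 0|exists T => s [/andP[]]].
set s0 := sup S.
have s0T : s0 <= T by apply: ge_sup => [|s [/andP[]]//]; exists 0.
have s00 : 0 <= s0 by apply: sup_ubound => //; case: hS.
have Zs0 : Z s0.
  have A k : \forall t \ae mu, 0 < t < s0 - 1 / k.+1%:R -> e t = 0.
    have [s [_ Zs] ss] := sup_adherent (seq_div_gt0 k (@ltr01 R)) hS.
    apply: ae_imp Zs => t + /andP[t0 ts]; apply; rewrite t0/=.
    exact: lt_trans ss.
  have {}A : \forall t \ae mu, forall k, 0 < t < s0 - 1 / k.+1%:R -> e t = 0.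
    exact/ae_foralln.
  apply: ae_imp A => t At /andP[t0 ts].
  near \oo => k; apply: (At k); rewrite t0/= ltrBrDl -ltrBrDr.
  near: k; apply: seq_div_near; by rewrite subr_gt0.
have [Ts|sT] := leP T s0.
  by apply: ae_imp Zs0 => t + /andP[t0 tT]; apply; rewrite t0 (lt_le_trans tT).
exfalso.
have [d1 d10 Hd1] := small_Rintegral s0 im (eps := 2^-1) ltac:(by rewrite invr_gt0).
pose s1 := Num.min (s0 + d1) T.
have s01 : s0 < s1 by rewrite lt_min sT ltrDl d10.
have s1T : s1 <= T by rewrite ge_min lexx orbT.
have s1d : s1 <= s0 + d1 by rewrite ge_min lexx.
have M0 : 0 <= M by have /andP[] := eM 0; exact: le_trans.
have Hk (k : nat) : \forall t \ae mu, 0 < t < s1 -> e t <= M * 2^-1 ^+ k.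
  elim: k => [|k IH].
    by apply: ae_all => t _; rewrite expr0 mulr1; have /andP[] := eM t.
  apply: ae_imp H => t Ht /andP[t0 ts].
  have tT : 0 < t < T by rewrite t0 (lt_le_trans ts).
  apply: le_trans (Ht tT) _.
  set q := M * 2^-1 ^+ k; have q0 : 0 <= q by rewrite mulr_ge0// exprn_ge0.
  have iq : mu.-integrable `[0, t]%classic (EFin \o (fun s => q * (m s * \1_(`]s0, s0 + d1]%classic) s))).
    apply: (@intgS _ _ _ mu _ setT) => //.
    apply: intgZ => //.
    apply: (@intg_ae_le _ _ _ mu _ _ _ measurableT _ (integrable_norm im)).
      by apply: measurable_funM => //; exact: measurable_indic.
    by apply: ae_all => s _; rewrite normrM ler_piMr// indicE ger0_norm// lern1 leq_b1//.
  apply: (@le_trans _ _ (\int[mu]_(s in `[0, t]) (q * (m s * \1_(`]s0, s0 + d1]%classic) s)))).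
    apply: ae_le_Rintegral => //.
      apply: (@intgS _ _ _ mu _ setT) => //.
      have iM := intgZ M measurableT im.
      apply: (@intg_ae_le _ _ _ mu _ _ _ measurableT _ iM).
        exact: measurable_funM.
      apply: ae_all => s _; rewrite normrM mulrC (ger0_norm (m0 s)) ler_wpM2r//.
      by have /andP[e0 e1] := eM s; rewrite ger0_norm.
    (* 0 and s0 belong to neither of the two ranges distinguished below. *)
    have N0 : \forall s \ae mu, s != 0 /\ s != s0.
      exists [set 0; s0]; split.
      - by apply: measurableU; exact: measurable_set1.
      - apply/eqP; rewrite -measure_le0; apply: le_trans (measureU2 _ _ _) _ => //.
        by rewrite /= !lebesgue_measure_set1 adde0.
      - move=> s /= /not_andP[] /negP; rewrite negbK => /eqP ->; [by left|by right].
    apply: ae_imp (ae_and N0 (ae_and IH Zs0)) => s [[sn0 sns0] [IHs Zs]].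
    rewrite /= in_itv/= => /andP[s_0 st].
    have sp : 0 < s by rewrite lt_def sn0.
    have [ss0|s0s] := ltP s s0.
      by rewrite Zs ?sp// mulr0 mulr_ge0// mulr_ge0.
    rewrite indicE mem_set/=; last first.
      by rewrite in_itv/= lt_def sns0 s0s/= (le_trans st)// (le_trans (ltW ts)).
    rewrite mulr1 mulrC ler_wpM2r// IHs// sp/=.
    exact: le_lt_trans st ts.
  have im' : mu.-integrable setT (EFin \o (fun s => m s * \1_(`]s0, s0 + d1]%classic) s)).
    apply: (@intg_ae_le _ _ _ mu _ _ _ measurableT _ (integrable_norm im)).
      by apply: measurable_funM => //; exact: measurable_indic.
    by apply: ae_all => s _; rewrite normrM ler_piMr// indicE ger0_norm// lern1 leq_b1//.
  have ims : mu.-integrable `[0, t]%classic (EFin \o (fun s => m s * \1_(`]s0, s0 + d1]%classic) s)).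
    exact: (@intgS _ _ _ mu _ setT).
  rewrite RintegralZl// exprS mulrCA [leRHS]mulrC ler_wpM2l//.
  apply: le_trans Hd1; apply: le_trans (ler_norm _).
  rewrite (_ : \int[mu]_(x in `]s0, s0 + d1]) m x =
    \int[mu]_s (m s * \1_(`]s0, s0 + d1]%classic) s)); last first.
    rewrite Rintegral_mkcond; apply: eq_Rintegral => s _; rewrite patchE indicE.
    by case: ifPn => _; rewrite ?mulr1 ?mulr0.
  rewrite Rintegral_mkcond; apply: le_Rintegral => //.
    by rewrite -restrict_EFin -integrable_mkcond.
  move=> s _; rewrite patchE; case: ifPn => // _.
  by rewrite mulr_ge0.
have : S s1.
  split; first by rewrite s1T (le_trans s00 (ltW s01)).
  have Hk' : \forall t \ae mu, forall k, 0 < t < s1 -> e t <= M * 2^-1 ^+ k.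
    exact/ae_foralln.
  apply: ae_imp Hk' => t Ht ts1.
  apply/eqP; rewrite eq_le; have /andP[-> _] := eM t; rewrite andbT.
  have L : (fun k : nat => M * 2^-1 ^+ k) @ \oo --> (0 : R).
    rewrite -[X in _ --> X](mulr0 M); apply: cvgM; first exact: cvg_cst.
    by apply: cvg_expr; rewrite ger0_norm ?invr_ge0// invf_lt1// ltr1n.
  apply: (ler_cvg_to (cvg_cst (e t)) L); apply: nearW => k.
  exact: Ht.
move=> /(sup_ubound hS.2); rewrite -/s0 leNgt s01//.
Unshelve. all: by end_near. Qed.

End Gronwall.

(** * Functions on the cylinder and H^1 *)

Section Box.
Variables (R : realType) (a b : R).
Local Notation mu := (@lebesgue_measure R).
Local Notation mu2 := (mu \x mu)%E.
Local Notation RR := (measurableTypeR R * measurableTypeR R)%type.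
Implicit Types (A : set R) (f g : R -> R -> R).

(** Extension by zero off the box A x ]a, b[, which gives total functions on the plane, as the
    Fubini lemmas over [setT] require. *)
Definition bx A f (t x : R) : R :=
  if (t \in A) && (x \in `]a, b[%classic) then f t x else 0.

Lemma bxE A f t x : t \in A -> x \in `]a, b[%classic -> bx A f t x = f t x.
Proof. by rewrite /bx => -> ->. Qed.

Lemma meas2_bx A f : measurable A ->
  measurable_fun (A `*` `]a, b[%classic) (fun z : RR => f z.1 z.2) -> meas2 (bx A f).
Proof.
move=> mA mf.
have mAb : measurable (A `*` `]a, b[%classic : set RR).
  by apply: measurableX => //; exact: measurable_itv.
have := (measurable_restrictT (fun z : RR => f z.1 z.2) mAb).1 mf.
congr measurable_fun; apply/funext => z; rewrite patchE /bx.
by rewrite in_setX.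
Qed.

Lemma Rintegral_bx A f (h : R -> R -> R) t : t \in A -> (h 0 =1 fun=> 0) ->
  \int[mu]_x h (bx A f t x) x = \int[mu]_(x in `]a, b[) h (f t x) x.
Proof.
move=> tA h0; rewrite [RHS]Rintegral_mkcond; apply: eq_Rintegral => x _.
by rewrite patchE /bx tA/=; case: ifPn => // _; rewrite h0.
Qed.

Lemma bx_out A f t x : ~ A t -> bx A f t x = 0.
Proof. by move=> At; rewrite /bx memNset. Qed.

Lemma ae2_sections (P : R -> R -> Prop) : (\forall z \ae mu2, P z.1 z.2) ->
  \forall t \ae mu, \forall x \ae mu, P t x.
Proof.
move=> [N [mN N0 sN]].
have m1 : measurable_fun setT (fun t => mu (xsection N t)).
  exact: (measurable_fun_xsection mu mN).
have N0' : (\int[mu]_t mu (xsection N t))%E = 0%E by exact: N0.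
have : ae_eq mu setT (fun t => mu (xsection N t)) (cst 0%E).
  apply/(ae_eq_integral_abs mu measurableT m1); rewrite -[RHS]N0'.
  by apply: eq_integral => t _; rewrite gee0_abs.
apply: ae_imp => t /(_ I) H.
exists (xsection N t); split => //; first exact: measurable_xsection.
by move=> x /= Hx; rewrite /xsection /= inE; exact: sN.
Qed.

(** The converse of [ae2_sections] fails for arbitrary properties, since null sections do not make a
    set measurable; hence the form f = 0 with f jointly measurable, where Tonelli's theorem applies
    to |f|. *)
Lemma ae2_of_sections (f : R -> R -> R) : meas2 f ->
  (\forall t \ae mu, \forall x \ae mu, f t x = 0) ->
  \forall z \ae mu2, f z.1 z.2 = 0.
Proof.
move=> mf H.
have mE : measurable_fun setT (fun z : RR => (f z.1 z.2)%:E).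
  exact/measurable_EFinP.
have : ae_eq mu2 setT (fun z : RR => (f z.1 z.2)%:E) (cst 0%E).
  apply/(ae_eq_integral_abs _ measurableT mE).
  rewrite (fubini_tonelli1 (fun z : RR => `|(f z.1 z.2)%:E|%E))//; last first.
    by apply: measurableT_comp.
  rewrite (ae_eq_integral (cst 0%E))//.
  - by rewrite integral0.
  - apply: (measurable_fun_fubini_tonelli_F (fun z : RR => `|(f z.1 z.2)%:E|%E)) => //.
    by apply: measurableT_comp.
  - apply: ae_imp H => t ft _; rewrite /fubini_F /=.
    rewrite (ae_eq_integral (cst 0%E))//; first by rewrite integral0.
      by apply/measurable_EFinP; apply: measurableT_comp => //; exact: (meas2_sec1 t mf).
    by apply: ae_imp ft => x -> _; rewrite normr0.
by apply: ae_imp => z /(_ I) [].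
Qed.

End Box.

(** * Membership in L^2 and H^1 *)

Section H1.
Variables (R : realType) (a b : R).
Hypothesis ab : a < b.
Local Notation mu := (@lebesgue_measure R).
Implicit Types (f g : R -> R).

Lemma in_L2P f : in_L2 a b f <-> measurable_fun `]a, b[%classic f /\
  mu.-integrable `]a, b[%classic (EFin \o (fun x => f x ^+ 2)).
Proof.
split=> [[mf f2]|[mf f2]]; split => //.
  apply/integrableP; split; first by apply/measurable_EFinP; exact: measurable_funX.
  rewrite (_ : (\int[_]_(_ in _) _)%E = L2sq a b f)//; apply: eq_integral => x _.
  by rewrite /= ger0_norm ?sqr_ge0.
have [_] := elimT (integrableP _ _ _) f2; apply: le_lt_trans.
rewrite le_eqVlt; apply/orP; left; apply/eqP; apply: eq_integral => x _.
by rewrite /= ger0_norm ?sqr_ge0.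
Qed.

Lemma measure_ab : mu (`]a, b[%classic) = (b - a)%:E.
Proof. by rewrite /= lebesgue_measure_itv/= lte_fin ab -EFinB. Qed.

Lemma in_L2_ae_eq f g : in_L2 a b f -> measurable_fun `]a, b[%classic g ->
  (\forall x \ae mu, a < x < b -> f x = g x) -> in_L2 a b g.
Proof.
move=> /in_L2P[mf f2] mg fg; apply/in_L2P; split => //.
apply: (@intg_ae_eq _ _ _ mu _ _ _ _ _ f2) => //; first exact: measurable_funX.
by apply: ae_imp fg => x fg; rewrite /= in_itv/= => /fg ->.
Qed.

Lemma in_L2_intg f : in_L2 a b f -> mu.-integrable `]a, b[%classic (EFin \o f).
Proof.
move=> /in_L2P[mf f2]; apply: intg_of_sq => //.
by rewrite [X in (X < _)%E]measure_ab ltry.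
Qed.

(** [wderiv] is a choice: it is a weak derivative as soon as one exists, and uniqueness identifies
    it with g up to a null set. *)
Lemma in_H1_wderiv f g : in_L2 a b f -> is_wderiv a b f g -> in_L2 a b g ->
  in_H1 a b f /\ \forall x \ae mu, a < x < b -> wderiv a b f x = g x.
Proof.
move=> f2 w g2.
have w' : is_wderiv a b f (wderiv a b f).
  by apply: (@xgetPex _ _ [set g | is_wderiv a b f g]); exists g.
have E := is_wderiv_uniq w' w.
split => //; split => //.
have [_ [mw _ _] _] := w'.
apply: (in_L2_ae_eq g2 mw); apply: ae_imp E => x + xab => /(_ xab) //.
Qed.

End H1.

(** * The energy inequality on a box *)

Section EnergyBox.
Variables (R : realType) (a b : R).
Hypothesis ab : a < b.
Local Notation mu := (@lebesgue_measure R).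
Local Notation mu2 := (mu \x mu)%E.

Lemma bxX (A : set R) f (t x : R) : bx a b A f t x ^+ 2 = bx a b A (fun t x => f t x ^+ 2) t x.
Proof. by rewrite /bx; case: ifPn => // _; rewrite expr0n. Qed.

Lemma intg2_box (A : set R) (f : R -> R -> R) (c : R) : meas2 (bx a b A f) -> measurable A ->
  (mu A < +oo)%E ->
  (\forall t \ae mu, A t -> \forall x \ae mu, a < x < b -> `|f t x| <= c) ->
  intg2 (bx a b A f).
Proof.
move=> mf mA fA H.
have finab : (mu (`]a, b[%classic) < +oo)%E by rewrite measure_ab ?ltry.
have Nf : intg2 (fun t x => `|bx a b A f t x|).
  apply: intg2_Tonelli.
  - exact: measurableT_comp.
  - by [].
  - apply: ae_imp H => t Ht.
    have [At|At] := pselect (A t); last first.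
      apply: (@eq_integrable _ _ _ mu setT measurableT (cst 0%E)); last exact: integrable0.
      by move=> x _; rewrite /= bx_out ?normr0.
    apply: (@supp_intg _ _ _ mu setT `]a, b[%classic) => //.
      by move=> x _ xab; rewrite /bx (memNset xab) andbF normr0.
    apply: (@intg_bounded _ _ _ mu _ _ c) => //.
      by apply: measurable_funTS; apply: measurableT_comp => //; exact: (meas2_sec1 t mf).
    apply: ae_imp (Ht At) => x Hx xab; rewrite normr_id bxE ?inE//; apply: Hx.
    by move: xab; rewrite /= in_itv.
  - have mm : meas2 (fun t x => `|bx a b A f t x|) by exact: measurableT_comp.
    apply: (@supp_intg _ _ _ mu setT A) => //.
      move=> t _ At; under eq_Rintegral do rewrite bx_out// normr0.
      by rewrite /Rintegral integral0.
    apply: (@intg_bounded _ _ _ mu _ _ (`|c| * (b - a))) => //.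
      exact: (measurable_funTS (meas2_Rint mm)).
    apply: ae_imp H => t Ht At; rewrite ger0_norm ?Rintegral_ge0//.
    rewrite (@supp_Rintegral _ _ _ mu setT `]a, b[%classic)//; last first.
      by move=> x _ xab; rewrite /bx (memNset xab) andbF normr0.
    have -> : `|c| * (b - a) = \int[mu]_(x in `]a, b[) `|c|.
      rewrite Rintegral_cst//; congr (_ * _).
      exact/esym/(congr1 fine (measure_ab ab)).
    have Hx : \forall x \ae mu, `]a, b[%classic x -> `|bx a b A f t x| <= `|c|.
      apply: ae_imp (Ht At) => x Hx xab; rewrite bxE ?inE//.
      by rewrite (le_trans (Hx _)) ?ler_norm//.
    apply: ae_le_Rintegral => //.
      apply: (@intg_bounded _ _ _ mu _ _ `|c|) => //.
        by apply: measurable_funTS; apply: measurableT_comp => //; exact: (meas2_sec1 t mf).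
      by apply: ae_imp Hx => x Hx xab; rewrite normr_id Hx.
    exact: intg_cst.
by apply: (@intg_ae_le _ _ _ mu2 _ _ _ measurableT _ Nf) => //; exact: ae_all.
Qed.

(** [UE] has no exceptional times, so its test function may be z t for almost every t; this yields
    the hypothesis of [energy_ineq]. [U] stands for the representative that is continuous in time,
    and is replaced by the pairing with z at almost all times only. *)
Lemma energy_box (r0 r1 : R) (z p F : R -> R -> R) (U : R -> (R -> R) -> R) :
  let A := `]r0, r1[%classic in
  meas2 (bx a b A z) -> meas2 (bx a b A p) -> meas2 (bx a b A F) ->
  intg2 (fun t x => bx a b A p t x ^+ 2) -> intg2 (fun t x => bx a b A F t x ^+ 2) ->
  (\forall t \ae mu, A t -> \forall x \ae mu, a < x < b -> `|z t x| <= 1) ->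
  (\forall t \ae mu, A t -> [/\ in_H1 a b (z t), is_wderiv a b (z t) (p t) &
    forall phi, in_H1 a b phi -> U t phi = L2pair a b (z t) phi]) ->
  (forall phi s t, in_H1 a b phi -> r0 < s -> s < t -> t < r1 ->
    U t phi - U s phi = - \int[mu]_(r in `[s, t]) \int[mu]_(x in `]a, b[)
      (F r x * wderiv a b phi x)) ->
  exists2 L : R -> Prop, (\forall r \ae mu, L r) &
    forall r r', L r -> L r' -> r0 < r -> r < r' -> r' < r1 ->
      \int[mu]_(x in `]a, b[) (z r' x ^+ 2) - \int[mu]_(x in `]a, b[) (z r x ^+ 2) <=
      - 2 * \int[mu]_(t in `[r, r']) \int[mu]_(x in `]a, b[) (F t x * p t x).
Proof.
move=> A mz mp mF ip iF z1 zH UE.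
have mA : measurable A by rewrite /A.
have fA : (mu A < +oo)%E.
  by rewrite /A /= lebesgue_measure_itv/=; case: ifP => _; rewrite ?ltry.
have iz : intg2 (fun t x => bx a b A z t x ^+ 2).
  have : intg2 (bx a b A (fun t x => z t x ^+ 2)).
    apply: (intg2_box (c := 1)) => //.
      have : meas2 (fun t x => bx a b A z t x ^+ 2) by exact: measurable_funX.
      by congr measurable_fun; apply/funext => y; rewrite bxX.
    apply: ae_imp z1 => t + At => /(_ At); apply: ae_imp => x + xab => /(_ xab) H.
    by rewrite normrX expr_le1.
  congr (mu2.-integrable _ _); apply/funext => y; rewrite /= bxX//.
have ip1 : intg2 (bx a b A p).
  have i1 : intg2 (bx a b A (fun _ _ => 1 : R)).
    apply: (intg2_box (c := 1)) => //.
      by apply: meas2_bx => //; exact: measurable_cst.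
    by apply: ae_all => t _; apply: ae_all => x _; rewrite normr1.
  apply: (@intg_ae_le _ _ _ mu2 _ _ _ measurableT _ (intgD measurableT i1 ip)) => //.
  apply: ae_all => y _; rewrite /bx; case: ifPn => _; last by rewrite normr0 expr0n addr0.
  rewrite -[p _ _ ^+ 2](real_normK (num_real _)).
  have := sqr_ge0 (`|p y.1 y.2| - 1); have := normr_ge0 (p y.1 y.2); nra.
have sq t : A t -> sqn (bx a b A z) t = \int[mu]_(x in `]a, b[) (z t x ^+ 2).
  move=> At; rewrite /sqn (@Rintegral_bx _ a b _ _ (fun y _ => y ^+ 2))//; first by rewrite inE.
  by move=> x; rewrite expr0n.
have FG t g s : A s -> \int[mu]_x (bx a b A F s x * bx a b A g t x) =
    \int[mu]_(x in `]a, b[) (F s x * bx a b A g t x).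
  move=> As; rewrite (@Rintegral_bx _ a b _ _ (fun y x => y * bx a b A g t x))//.
    by rewrite inE.
  by move=> x; rewrite mul0r.
have [|L aeL HL] := @energy_ineq R r0 r1 (bx a b A z) (bx a b A p) (bx a b A F) mz mp mF iz ip iF ip1.
  (* The increment involves both t and t - [win] k, and both have to be times at which [zH] holds;
     translates of null sets are null. *)
  move=> k; apply: ae_imp (ae_and zH (ae_shift (win R k) zH)) => t [Ht Hs] r0s tr1.
  have h0 := win_gt0 R k.
  set s := t - win R k.
  have st : s < t by rewrite /s ltrBlDr ltrDl.
  have At : A t by rewrite /A /= in_itv/= (lt_trans r0s).
  have As : A s by rewrite /A /= in_itv/= r0s (lt_trans st).
  have [Ht1 Ht2 Ht3] := Ht At; have [Hs1 Hs2 Hs3] := Hs As.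
  have [_ Ew] := in_H1_wderiv (let: And3 q _ _ := Ht1 in q) Ht2
    (in_L2_ae_eq (let: And3 _ _ q := Ht1 in q) (let: And3 _ (And3 q _ _) _ := Ht2 in q)
      (is_wderiv_uniq (let: And3 _ q _ := Ht1 in q) Ht2)).
  have := UE _ _ _ Ht1 r0s st tr1; rewrite (Ht3 _ Ht1) (Hs3 _ Ht1) /L2pair => E.
  rewrite (sq _ At).
  have -> : \int[mu]_x (bx a b A z s x * bx a b A z t x) =
      \int[mu]_(x in `]a, b[) (z s x * z t x).
    rewrite (@Rintegral_bx _ a b _ _ (fun y x => y * bx a b A z t x))//.
    - by apply: eq_Rintegral => x xab; rewrite bxE// inE.
    - by rewrite inE.
    - by move=> x; rewrite mul0r.
  under eq_Rintegral do rewrite expr2.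
  rewrite E; congr (- _); apply: eq_Rintegral => r; rewrite inE/= in_itv/= => /andP[sr rt].
  have Ar : A r by rewrite /A /= in_itv/= (lt_le_trans r0s sr) (le_lt_trans rt).
  rewrite FG//; apply: ae_eq_Rintegral => //.
  - apply: measurable_funM.
      have := measurable_funTS (D := `]a, b[%classic) (meas2_sec1 r mF).
      by apply: eq_measurable_fun => x xab; rewrite bxE ?(mem_set Ar).
    by have [_ [q _ _] _] := (let: And3 _ q _ := Ht1 in q).
  - apply: measurable_funM.
      have := measurable_funTS (D := `]a, b[%classic) (meas2_sec1 r mF).
      by apply: eq_measurable_fun => x xab; rewrite bxE ?(mem_set Ar).
    exact: (measurable_funTS (meas2_sec1 t mp)).
  - apply: ae_imp Ew => x Ex; rewrite /= in_itv/= => xab.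
    by rewrite bxE ?inE/= ?in_itv//= Ex.
exists L; first exact: aeL.
move=> r r' Lr Lr' r0r rr' r'r1.
have Ar : A r by rewrite /A /= in_itv/= r0r (lt_trans rr').
have Ar' : A r' by rewrite /A /= in_itv/= r'r1 (lt_trans r0r).
have := HL r r' Lr Lr' r0r rr' r'r1; rewrite (sq _ Ar) (sq _ Ar') => H; apply: (le_trans H).
rewrite le_eqVlt; apply/orP; left; apply/eqP; congr (_ * _).
apply: eq_Rintegral => t; rewrite inE/= in_itv/= => /andP[rt tr'].
have At : A t by rewrite /A /= in_itv/= (lt_le_trans r0r rt) (le_lt_trans tr').
rewrite FG//; apply: eq_Rintegral => x xab; rewrite bxE// inE//.
Qed.

End EnergyBox.

(** * Linear structure of H^1 and evaluation of functionals *)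

Section H1closure.
Variables (R : realType) (a b : R).
Hypothesis ab : a < b.
Local Notation mu := (@lebesgue_measure R).
Implicit Types (f g phi : R -> R).

Lemma is_wderivZ (c : R) f g : is_wderiv a b f g ->
  is_wderiv a b (fun x => c * f x) (fun x => c * g x).
Proof.
move=> [lf lg H].
have L h : locally_integrable `]a, b[%classic h -> locally_integrable `]a, b[%classic (fun x => c * h x).
  move=> [mh oD hK]; split => //; first exact: measurable_funM.
  move=> A AD cA; have mA : measurable A by exact: compact_measurable.
  have iA : mu.-integrable A (EFin \o h).
    apply/integrableP; split; last exact: hK.
    by apply/measurable_EFinP; exact: measurable_funS mh.
  have iA' : mu.-integrable A (EFin \o (fun x => c * h x)) by exact: intgZ.
  by have [_] := elimT (integrableP _ _ _) iA'.
split; [exact: L|exact: L|] => phi tp.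
under eq_Rintegral do rewrite -mulrA.
under [in RHS]eq_Rintegral do rewrite -mulrA.
rewrite !RintegralZl//; first by rewrite H// mulrN.
- exact: test_mul_intg.
- exact: test_mul_intg1.
Qed.

Lemma is_wderiv0 : is_wderiv a b (fun=> 0) (fun=> 0).
Proof.
have L : locally_integrable `]a, b[%classic (fun=> 0 : R).
  apply: open_integrable_locally; first exact: interval_open.
  exact: integrable0.
split => // phi _.
under eq_Rintegral do rewrite mul0r.
under [in RHS]eq_Rintegral do rewrite mul0r.
by rewrite /Rintegral integral0 oppr0.
Qed.

Lemma is_wderivD f1 f2 g1 g2 : is_wderiv a b f1 g1 -> is_wderiv a b f2 g2 ->
  is_wderiv a b (fun x => f1 x + f2 x) (fun x => g1 x + g2 x).
Proof.
move=> w1 w2; have := is_wderivB w1 (is_wderivB is_wderiv0 w2).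
by congr is_wderiv; apply/funext => x; rewrite sub0r opprK.
Qed.

Lemma is_wderiv_sum (n : nat) (f g : 'I_n -> R -> R) :
  (forall i, is_wderiv a b (f i) (g i)) ->
  is_wderiv a b (fun x => \sum_i f i x) (fun x => \sum_i g i x).
Proof.
elim: n f g => [|n IH] f g w.
  by have := is_wderiv0; congr is_wderiv; apply/funext => x; rewrite big_ord0.
have := is_wderivD (w ord0) (IH _ _ (fun i => w (lift ord0 i))).
by congr is_wderiv; apply/funext => x; rewrite big_ord_recl.
Qed.

Lemma in_L2Z (c : R) f : in_L2 a b f -> in_L2 a b (fun x => c * f x).
Proof.
move=> /in_L2P[mf f2]; apply/in_L2P; split; first exact: measurable_funM.
have -> : (fun x => (c * f x) ^+ 2) = (fun x => c ^+ 2 * f x ^+ 2).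
  by apply/funext => x; rewrite exprMn.
exact: intgZ.
Qed.

Lemma in_L2B f g : in_L2 a b f -> in_L2 a b g -> in_L2 a b (fun x => f x - g x).
Proof.
move=> /in_L2P[mf f2] /in_L2P[mg g2]; apply/in_L2P; split; first exact: measurable_funB.
apply: (@intg_add_sq _ _ _ mu _ f (fun x => - g x)) => //; first exact: measurableT_comp.
have -> : (fun x => (- g x) ^+ 2) = (fun x => g x ^+ 2).
  by apply/funext => x; rewrite sqrrN.
by [].
Qed.

Lemma in_L2_0 : in_L2 a b (fun=> 0).
Proof.
apply/in_L2P; split => //; rewrite expr0n.
exact: integrable0.
Qed.

Lemma in_H1Z (c : R) f : in_H1 a b f -> in_H1 a b (fun x => c * f x) /\
  \forall x \ae mu, a < x < b -> wderiv a b (fun x => c * f x) x = c * wderiv a b f x.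
Proof.
by move=> [f2 w w2]; apply: in_H1_wderiv; [exact: in_L2Z|exact: is_wderivZ|exact: in_L2Z].
Qed.

Lemma in_H1B f g : in_H1 a b f -> in_H1 a b g -> in_H1 a b (fun x => f x - g x).
Proof.
move=> [f2 w w2] [g2 wg wg2].
have [] // := in_H1_wderiv (in_L2B f2 g2) (is_wderivB w wg) (in_L2B w2 wg2).
Qed.

Lemma in_H1_0 : in_H1 a b (fun=> 0).
Proof. by have [] := in_H1_wderiv in_L2_0 is_wderiv0 in_L2_0. Qed.

Lemma L2sq_ge0 f : (0 <= L2sq a b f)%E.
Proof. by apply: integral_ge0 => x _; rewrite lee_fin sqr_ge0. Qed.

Lemma L2sq_fin f : in_L2 a b f -> L2sq a b f \is a fin_num.
Proof. by move=> [_ h]; rewrite ge0_fin_numE// L2sq_ge0. Qed.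

Lemma L2sqE f : in_L2 a b f -> L2sq a b f = (\int[mu]_(x in `]a, b[) (f x ^+ 2))%:E.
Proof. by move=> h; rewrite /Rintegral fineK//; exact: L2sq_fin. Qed.

Lemma L2sqZ (c : R) f : in_L2 a b f -> L2sq a b (fun x => c * f x) = ((c ^+ 2)%:E * L2sq a b f)%E.
Proof.
move=> h; rewrite !L2sqE//; last exact: in_L2Z.
have /in_L2P[_ f2] := h.
rewrite -EFinM -RintegralZl//; congr EFin; apply: eq_Rintegral => x _.
by rewrite exprMn.
Qed.

Lemma L2sq_ae_eq f g : measurable_fun `]a, b[%classic f -> measurable_fun `]a, b[%classic g ->
  (\forall x \ae mu, a < x < b -> f x = g x) -> L2sq a b f = L2sq a b g.
Proof.
move=> mf mg fg; apply: ae_eq_integral => //.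
- by apply/measurable_EFinP; exact: measurable_funX.
- by apply/measurable_EFinP; exact: measurable_funX.
- by apply: ae_imp fg => x fg; rewrite /= in_itv/= => /fg ->.
Qed.

Lemma H1_normalize phi : in_H1 a b phi -> exists c : R, 
  [/\ 0 < c, in_H1 a b (fun x => c * phi x) & (H1norm a b (fun x => (c * phi x)%R) <= 1)%E].
Proof.
move=> hp; have [p2 w w2] := hp.
set S := fine (L2sq a b phi + L2sq a b (wderiv a b phi))%E.
have S0 : 0 <= S by apply: fine_ge0; rewrite adde_ge0 ?L2sq_ge0.
have S1 : 0 < S + 1 by rewrite ltr_wpDl.
(* With S the squared norm, S / (S + 1)^2 <= 1; unlike the inverse of the norm, this factor also
   serves when the norm is zero. *)
exists (S + 1)^-1; have [h1 h2] := in_H1Z (S + 1)^-1 hp.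
split => //; first by rewrite invr_gt0.
rewrite /H1norm; have -> : (1 = sqrte 1 :> \bar R)%E by rewrite /sqrte/= sqrtr1.
rewrite lee_sqrt// (L2sq_ae_eq _ _ h2); last 2 first.
- by have [_ [_ [q _ _] _] _] := h1.
- by apply: measurable_funM => //; have [_ [q _ _] _] := w.
rewrite !L2sqZ// -ge0_muleDr ?L2sq_ge0//.
have E : (L2sq a b phi + L2sq a b (wderiv a b phi))%E = S%:E.
  by rewrite /S fineK// fin_numD !L2sq_fin.
rewrite E -EFinM lee_fin.
rewrite exprVn ler_pdivrMl ?exprn_gt0// mulr1.
by rewrite expr2; nra.
Qed.

(** Scaling phi into the unit ball shows that evaluation at phi is continuous for the dual norm. The
    constant depends on phi alone, so convergence of functionals passes to their values. *)
Lemma H1dual_bound phi : in_H1 a b phi -> exists2 C : R, 0 < C &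
  forall (G : (R -> R) -> R) (e : R), in_H1dual a b G -> (H1dual_norm a b G <= e%:E)%E ->
    `|G phi| <= C * e.
Proof.
move=> hp; have [c [c0 hc nc]] := H1_normalize hp.
exists c^-1; first by rewrite invr_gt0.
move=> G e [lG _] Ge.
have G0 : G (fun=> 0) = 0.
  have := lG 1 (fun=> 0) (fun=> 0) in_H1_0 in_H1_0.
  by under eq_fun do rewrite mulr0 addr0; move=> /eqP; rewrite mul1r -subr_eq subrr eq_sym => /eqP.
have Gc : G (fun x => c * phi x) = c * G phi.
  have := lG c phi (fun=> 0) hp in_H1_0; rewrite G0 addr0.
  by under eq_fun do rewrite addr0.
rewrite ler_pdivlMl// -(gtr0_norm c0) -normrM -Gc -lee_fin.
apply: le_trans Ge; apply: ereal_sup_ubound.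
by exists (fun x => c * phi x).
Qed.

Lemma in_H1dualB (G G' : (R -> R) -> R) : in_H1dual a b G -> in_H1dual a b G' ->
  (H1dual_norm a b (fun y => (G y - G' y)%R) < +oo)%E ->
  in_H1dual a b (fun y => G y - G' y).
Proof.
move=> [lG _] [lG' _] fin; split => // c f g hf hg.
by rewrite lG// lG'//; ring.
Qed.

Lemma const_wderiv0 (f g : R -> R) (c : R) : is_wderiv a b f g ->
  (\forall x \ae mu, a < x < b -> f x = c) -> \forall x \ae mu, a < x < b -> g x = 0.
Proof.
move=> w fc; have [_ lg _] := w.
apply: ae_eq0_itv_integrals lg _ => r s ar rs sb.
rewrite -(is_wderiv_ftc_cont (h := fun=> c) w _ fc ar rs sb) ?subrr//.
by move=> x _; exact: cst_continuous.
Qed.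

End H1closure.

(** * Weak solutions *)

Section WeakFacts.
Variables (R : realType) (n : nat) (T a b : R).
Hypotheses (T0 : 0 < T) (ab : a < b).
Variable K : 'I_n.+1 -> 'I_n.+1 -> R.
Local Notation mu := (@lebesgue_measure R).
Local Notation mu2 := (mu \x mu)%E.
Local Notation RR := (measurableTypeR R * measurableTypeR R)%type.

Lemma joint_measurable_flux (u p : 'I_n.+1 -> R -> R -> R) i :
  (forall j, joint_measurable T a b (u j)) -> (forall j, joint_measurable T a b (p j)) ->
  joint_measurable T a b (flux K u p i).
Proof.
move=> mu_ mp; rewrite /joint_measurable /flux.
under eq_fun do rewrite big_mkcond.
apply: measurable_sum => j; case: (j != i); last exact: measurable_cst.
apply: measurable_funM => //; apply: measurable_funB; apply: measurable_funM.
- exact: mu_.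
- exact: mp.
- exact: mu_.
- exact: mp.
Qed.

Lemma joint_meas2_bx (A : set R) f : measurable A -> A `<=` `]0, T[ ->
  joint_measurable T a b f -> meas2 (bx a b A f).
Proof.
move=> mA AT mf; apply: meas2_bx => //.
apply: measurable_funS mf.
  by apply: measurableX => //; exact: measurable_itv.
by move=> [t x] [/= At xab]; split => //; exact: AT.
Qed.

Lemma measurable_pairing f (h : R -> R) : joint_measurable T a b f ->
  measurable_fun `]a, b[%classic h ->
  measurable_fun `]0, T[%classic (fun t => \int[mu]_(x in `]a, b[) (f t x * h x)).
Proof.
move=> mf mh.
have m1 : meas2 (bx a b `]0, T[%classic f) by exact: joint_meas2_bx.
have m2 : measurable_fun setT (h \_ `]a, b[%classic).
  exact/(measurable_restrictT _ _).1.
have m3 : meas2 (fun t x => bx a b `]0, T[%classic f t x * (h \_ `]a, b[%classic) x).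
  apply: measurable_funM => //.
  by apply: measurableT_comp.
have := measurable_funTS (D := `]0, T[%classic) (meas2_Rint m3).
apply: eq_measurable_fun => t tT.
rewrite (@Rintegral_bx _ a b _ _ (fun y x => y * (h \_ `]a, b[%classic) x))//.
  by apply: eq_Rintegral => x xab; rewrite patchE xab.
by move=> x; rewrite mul0r.
Qed.

(** [Gf] equals - H only off a null set that varies with the test function. Integration in time
    removes this set, and the continuity of [Uf] makes the identity valid for every s < t. *)
Lemma time_identity (f Gf Uf H : R -> R) : is_wderiv 0 T f Gf ->
  (forall t, 0 < t < T -> {for t, continuous Uf}) ->
  (\forall t \ae mu, 0 < t < T -> f t = Uf t) ->
  (\forall t \ae mu, 0 < t < T -> Gf t = - H t) ->
  measurable_fun `]0, T[%classic H ->
  forall s t, 0 < s -> s < t -> t < T -> Uf t - Uf s = - \int[mu]_(r in `[s, t]) H r.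
Proof.
move=> w cU fU GH mH s t s0 st tT.
have [_ lG _] := w.
rewrite (is_wderiv_ftc_cont w cU fU s0 st tT).
have iG := locally_integrable_itv lG s0 tT.
have sub : `[s, t]%classic `<=` `]0, T[%classic.
  by apply: subset_itvSoo; rewrite bnd_simp.
have mHs : measurable_fun `[s, t]%classic H by exact: measurable_funS mH.
have GH' : \forall r \ae mu, `[s, t]%classic r -> Gf r = - H r.
  by apply: ae_imp GH => r + rst; apply; move/sub: rst; rewrite /= in_itv.
have iH : mu.-integrable `[s, t]%classic (EFin \o H).
  apply: (@intg_ae_eq _ _ _ mu _ _ (fun r => - Gf r)) => //; first exact: intgN.
  by apply: ae_imp GH' => r Hr rst; rewrite Hr// opprK.
rewrite (@ae_eq_Rintegral _ _ _ mu _ _ (fun r => - 1 * H r))//.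
- by rewrite RintegralZl// mulN1r.
- by apply: intg_measurable iG.
- exact: measurable_funM.
- by apply: ae_imp GH' => r Hr rst; rewrite Hr// mulN1r.
Qed.

Lemma dual_continuous (J : set R) (U : R -> (R -> R) -> R) (phi : R -> R) : in_H1 a b phi ->
  (forall t, J t -> in_H1dual a b (U t)) ->
  (forall t, J t -> forall e : R, 0 < e -> exists2 d : R, 0 < d &
          forall s, J s -> `|s - t| < d ->
            (H1dual_norm a b (fun y => U s y - U t y)%R < e%:E)%E) ->
  forall t, J t -> forall e : R, 0 < e -> exists2 d : R, 0 < d &
          forall s, J s -> `|s - t| < d -> `|U s phi - U t phi| < e.
Proof.
move=> hp UX Uc t Jt e e0.
have [C C0 HC] := H1dual_bound hp.
have e1 : 0 < e / (2 * C) by rewrite divr_gt0// mulr_gt0.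
have [d d0 Hd] := Uc t Jt _ e1.
exists d => // s Js st; have N := Hd s Js st.
have X : in_H1dual a b (fun y => U s y - U t y).
  apply: in_H1dualB; [exact: UX|exact: UX|].
  by apply: lt_le_trans N _; rewrite leey.
have := HC _ _ X (ltW N).
have -> : C * (e / (2 * C)) = e / 2 by field; rewrite gt_eqF.
move=> H; apply: le_lt_trans H _; lra.
Qed.

(** The components sum to the constant 1, whose weak derivative is 0; coercivity holds only for
    gradients of sum zero. *)
Lemma sum_grad0 (u p : 'I_n.+1 -> R -> R -> R) :
  (\forall z \ae mu2, cylinder T a b z -> in_simplex (fun i => u i z.1 z.2)) ->
  (forall i, is_spatial_deriv T a b (u i) (p i)) ->
  \forall t \ae mu, 0 < t < T -> \forall x \ae mu, a < x < b ->
    in_simplex (fun i => u i t x) /\ \sum_i p i t x = 0.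
Proof.
move=> us up.
have us' := ae2_sections (P := fun t x => cylinder T a b (t, x) -> in_simplex (fun i => u i t x)).
have {us'}us : \forall t \ae mu, \forall x \ae mu, cylinder T a b (t, x) -> in_simplex (fun i => u i t x).
  by apply: us'; apply: ae_imp us => -[t x].
have up' : \forall t \ae mu, forall i, 0 < t < T -> is_wderiv a b (u i t) (p i t).
  by apply: ae_all_ord => i; have [] := up i.
apply: ae_imp (ae_and us up') => t [Hu Hp] tT.
have Hu' : \forall x \ae mu, a < x < b -> in_simplex (fun i => u i t x).
  apply: ae_imp Hu => x + xab; apply; split => /=; rewrite in_itv/=//.
have w := is_wderiv_sum (fun i => Hp i tT).
have w0 := const_wderiv0 (c := 1) w.
apply: ae_imp (ae_and Hu' (w0 _)) => [x [Hx Hx0] xab|].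
  by split; [exact: Hx|exact: Hx0].
by apply: ae_imp Hu' => x + xab => /(_ xab)[].
Qed.

Lemma ae_0T (P : R -> Prop) :
  (forall r s : R, 0 < r -> r < s -> s < T -> \forall t \ae mu, `[r, s]%classic t -> P t) ->
  \forall t \ae mu, 0 < t < T -> P t.
Proof.
move=> H.
(* A third of T keeps q below T - q in every interval [q, T - q] of the exhaustion. *)
have T3 : 0 < T / 3 by rewrite divr_gt0.
have Hk (k : nat) : \forall t \ae mu, `[T / 3 / k.+1%:R, T - T / 3 / k.+1%:R]%classic t -> P t.
  have := seq_div_gt0 k T3; have := seq_div_le k T3; set q := _ / _ => q1 q0.
  by apply: H => //; lra.
have {}Hk : \forall t \ae mu, forall k : nat,
  `[T / 3 / k.+1%:R, T - T / 3 / k.+1%:R]%classic t -> P t by exact/ae_foralln.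
apply: ae_imp Hk => t Ht /andP[t0 tT].
near \oo => k; apply: (Ht k); rewrite /= in_itv/=.
apply/andP; split.
  by apply: ltW; near: k; exact: seq_div_near.
have : T / 3 / k.+1%:R < T - t by near: k; apply: seq_div_near; rewrite subr_gt0.
set q := _ / _; lra.
Unshelve. all: by end_near. Qed.

Lemma bx_intg2 (A J : set R) (f : R -> R -> R) (N : R -> \bar R) :
  measurable J -> A `<=` J -> meas2 (bx a b A f) -> (forall t, 0 <= N t)%E ->
  (\int[mu]_(t in J) N t < +oo)%E ->
  (\forall t \ae mu, A t -> (L2sq a b (f t) <= N t)%E) ->
  intg2 (fun t x => bx a b A f t x ^+ 2).
Proof.
move=> mJ AJ mb N0 fin H.
have mb2 : meas2 (fun t x => bx a b A f t x ^+ 2) by exact: measurable_funX.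
have mE : measurable_fun setT (EFin \o (fun z : RR => bx a b A f z.1 z.2 ^+ 2)).
  exact/measurable_EFinP.
apply/(integrable12ltyP mu mu mE).
pose h t := (\int[mu]_x `|(EFin \o (fun z : RR => (bx a b A f z.1 z.2 ^+ 2)%R)) (t, x)|)%E.
have mF : measurable_fun setT h.
  apply: (measurable_fun_fubini_tonelli_F
    (fun z : RR => `|(EFin \o (fun z : RR => (bx a b A f z.1 z.2 ^+ 2)%R)) z|%E)) => //.
  exact: measurableT_comp.
have h0 t : ~ A t -> h t = 0%E.
  by move=> At; apply: integral0_eq => x _ /=; rewrite bx_out ?expr0n ?normr0.
have E : (\int[mu]_t h t = \int[mu]_(t in J) h t)%E.
  rewrite [RHS]integral_mkcond; apply: eq_integral => t _; rewrite patchE.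
  by case: ifPn => // /negP tn; apply: h0 => At; apply: tn; rewrite inE; exact: AJ.
rewrite [X in (X < _)%E]E; apply: le_lt_trans fin.
apply: (@ge0_le_integral_nonmeas _ _ _ mu) => //.
- exact: measurable_funTS.
- by move=> t _; exact: integral_ge0.
apply: ae_imp H => t Ht tJ.
have [At|At] := pselect (A t); last by rewrite h0.
have -> : h t = L2sq a b (f t).
  rewrite /L2sq [RHS]integral_mkcond; apply: eq_integral => x _ /=.
  rewrite patchE /bx mem_set//=; case: ifPn => _; first by rewrite ger0_norm ?sqr_ge0.
  by rewrite expr0n normr0.
exact: Ht.
Qed.

Lemma grad_intg2 (u p : R -> R -> R) : bochner_L2loc (in_H1 a b) (H1norm a b) T u ->
  is_spatial_deriv T a b u p ->
  forall r0 r1, 0 < r0 -> r0 < r1 -> r1 < T ->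
    intg2 (fun t x => bx a b `]r0, r1[%classic p t x ^+ 2).
Proof.
move=> Bu [mp wp] r0 r1 r00 r01 r1T.
have [[aeH1 _] fin] := Bu _ _ r00 r01 r1T.
set A := `]r0, r1[%classic.
have AT : A `<=` `]0, T[%classic by apply: subset_itvW; rewrite ltW.
have mA : measurable A by rewrite /A.
have mb : meas2 (bx a b A p) by exact: joint_meas2_bx.
have AJ : A `<=` `[r0, r1]%classic by exact: subset_itv_oo_cc.
apply: (bx_intg2 _ AJ mb _ fin) => //.
  by move=> t; rewrite mule_ge0 ?sqrte_ge0.
apply: ae_imp (ae_and aeH1 wp) => t [Ht wt] At.
have tT : 0 < t < T by have := AT _ At; rewrite /= in_itv.
have [h1 h2 h3] := Ht (AJ _ At).
have Ew := is_wderiv_uniq h2 (wt tT).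
have [_ [mw _ _] _] := wt tT; have [mw' _] := h3.
rewrite -(L2sq_ae_eq mw' mw Ew).
have S0 := adde_ge0 (L2sq_ge0 a b (u t)) (L2sq_ge0 a b (wderiv a b (u t))).
rewrite -expe2 /H1norm (sqr_sqrte S0).
exact: (leeDr _ (L2sq_ge0 _ _ _)).
Qed.

(** The interface to the uniqueness argument: the dual-valued time derivative is eliminated, and [U]
    is the representative continuous on [0, T[ with values in the dual of H^1. *)
Lemma weak_solution_integrated (ut : 'I_n.+1 -> R -> R -> R) (ut0 : 'I_n.+1 -> R -> R) :
  weak_solution T a b K ut ut0 ->
  exists (p : 'I_n.+1 -> R -> R -> R) (U : 'I_n.+1 -> R -> (R -> R) -> R),
  [/\ forall i, joint_measurable T a b (ut i) /\ joint_measurable T a b (p i),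
    \forall t \ae mu, 0 < t < T -> forall i, [/\ in_H1 a b (ut i t),
      is_wderiv a b (ut i t) (p i t) &
      forall phi, in_H1 a b phi -> U i t phi = L2pair a b (ut i t) phi],
    \forall t \ae mu, 0 < t < T -> \forall x \ae mu, a < x < b ->
      in_simplex (fun i => ut i t x) /\ \sum_i p i t x = 0,
    forall i r0 r1, 0 < r0 -> r0 < r1 -> r1 < T ->
      intg2 (fun t x => bx a b `]r0, r1[%classic (p i) t x ^+ 2) &
    forall i phi, in_H1 a b phi -> [/\ forall s t, 0 < s -> s < t -> t < T ->
        U i t phi - U i s phi = - \int[mu]_(r in `[s, t]) \int[mu]_(x in `]a, b[)
          (flux K ut p i r x * wderiv a b phi x),
      U i 0 phi = L2pair a b (ut0 i) phi &
      forall e : R, 0 < e -> exists2 d : R, 0 < d &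
        forall s, 0 < s < T -> s < d -> `|U i s phi - U i 0 phi| < e]].
Proof.
move=> [p [G [H1 [H2 [H3 [H4 H5]]]]]].
have HU i : exists U : R -> (R -> R) -> R,
  [/\ forall t, `[0, T[%classic t -> in_H1dual a b (U t),
    forall t, `[0, T[%classic t -> forall e : R, 0 < e -> exists2 d : R, 0 < d &
          forall s, `[0, T[%classic s -> `|s - t| < d ->
            (H1dual_norm a b (fun y => U s y - U t y)%R < e%:E)%E,
    \forall t \ae mu, `[0, T[%classic t -> in_H1dual a b (L2pair a b (ut i t)) /\
       H1dual_norm a b (fun y => U t y - L2pair a b (ut i t) y) = 0%E &
    in_H1dual a b (L2pair a b (ut0 i)) /\
       H1dual_norm a b (fun y => U 0 y - L2pair a b (ut0 i) y) = 0%E].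
  by have [_ [U ?]] := H5 i; exists U.
have {HU}[U HU] := choice HU.
(* Dual norm zero gives equality of functionals on H^1 only, so they are compared after evaluation
   at an element of H^1. *)
have eq0 (G1 G2 : (R -> R) -> R) phi : in_H1 a b phi -> in_H1dual a b G1 -> in_H1dual a b G2 ->
    H1dual_norm a b (fun y => G1 y - G2 y) = 0%E -> G1 phi = G2 phi.
  move=> hp X1 X2 N0; have [C C0 HC] := H1dual_bound hp.
  have X : in_H1dual a b (fun y => G1 y - G2 y) by apply: in_H1dualB; rewrite ?N0 ?ltry.
  have := HC _ 0 X; rewrite N0 mulr0 => /(_ (lexx _)).
  by rewrite normr_le0 subr_eq0 => /eqP.
have UL : \forall t \ae mu, 0 < t < T -> forall i phi, in_H1 a b phi ->
    U i t phi = L2pair a b (ut i t) phi.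
  have A : \forall t \ae mu, forall i, `[0, T[%classic t -> in_H1dual a b (L2pair a b (ut i t)) /\
       H1dual_norm a b (fun y => U i t y - L2pair a b (ut i t) y) = 0%E.
    by apply: ae_all_ord => i; have [_ _ ? _] := HU i.
  apply: ae_imp A => t At /andP[t0 tT] i phi hp.
  have tJ : `[0, T[%classic t by rewrite /= in_itv/= (ltW t0).
  have [X N0] := At i tJ; have [XU _ _ _] := HU i.
  by apply: eq0 => //; exact: XU.
have mut i : joint_measurable T a b (ut i) by have [] := H1 i.
have mp i : joint_measurable T a b (p i) by have [_ _ []] := H1 i.
exists p, U; split => //.
- have hH1 : \forall t \ae mu, forall i, 0 < t < T -> in_H1 a b (ut i t).
    apply: ae_all_ord => i; apply: ae_0T => r s r0 rs sT.
    by have [_ /(_ _ _ r0 rs sT)[[]]] := H1 i.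
  have hw : \forall t \ae mu, forall i, 0 < t < T -> is_wderiv a b (ut i t) (p i t).
    by apply: ae_all_ord => i; have [_ _ []] := H1 i.
  apply: ae_imp (ae_and hH1 (ae_and hw UL)) => t [h1 [h2 h3]] tT i.
  by split; [exact: h1|exact: h2|exact: h3].
- by apply: sum_grad0 => // i; have [] := H1 i.
- by move=> i r0 r1 h1 h2 h3; have [_ B S] := H1 i; exact: (grad_intg2 B S).
move=> i phi hp.
have [XU cU _ [X0 U0]] := HU i.
have dc := dual_continuous hp XU cU.
split.
- have [_ /(_ phi hp) w] := H2 i.
  apply: (time_identity w).
  + move=> t /andP[t0 tT]; apply/cvgrPdist_lt => e e0.
    have tJ : `[0, T[%classic t by rewrite /= in_itv/= (ltW t0).
    have [d d0 Hd] := dc t tJ e e0.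
    have B : \forall s \near nbhs t, `|s - t| < d.
      by exists d => // s /=; rewrite distrC.
    near=> s; rewrite distrC; apply: Hd; last by near: s.
    rewrite /= in_itv/=; apply/andP; split.
      by apply: ltW; near: s; exact: lt_nbhsr.
    by near: s; exact: lt_nbhsl.
  + by apply: ae_imp UL => t Ht tT; rewrite Ht.
  + apply: ae_imp (H4 i phi hp) => t Ht tT; apply/eqP; rewrite -subr_eq0 opprK.
    exact/eqP/Ht.
  + apply: measurable_pairing; first exact: joint_measurable_flux.
    by have [_ [_ [q _ _] _] _] := hp.
- have J0 : `[0, T[%classic (0 : R) by rewrite /= in_itv/= lexx.
  exact: (eq0 _ _ _ hp (XU 0 J0) X0 U0).
- move=> e e0; have J0 : `[0, T[%classic (0 : R) by rewrite /= in_itv/= lexx.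
  have [d d0 Hd] := dc 0 J0 e e0; exists d => // s /andP[s0 sT] sd.
  by apply: Hd; [rewrite /= in_itv/= (ltW s0)|rewrite subr0 gtr0_norm].
Unshelve. all: by end_near. Qed.

End WeakFacts.

(** * Integration by parts in space *)

Section SpaceIBP.
Variables (R : realType) (a b : R).
Hypothesis ab : a < b.
Local Notation mu := (@lebesgue_measure R).
Local Notation mu2 := (mu \x mu)%E.
Implicit Types (F q phi psi : R -> R).

Lemma intg2_prod (u v : R -> R) : mu.-integrable setT (EFin \o u) ->
  mu.-integrable setT (EFin \o v) -> intg2 (fun x y => u x * v y).
Proof.
move=> iu iv.
have mu_ : measurable_fun setT u by apply: intg_measurable iu.
have mv : measurable_fun setT v by apply: intg_measurable iv.
have m2 : meas2 (fun x y => u x * v y).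
  by apply: measurable_funM; apply: measurableT_comp.
have inv := integrable_norm iv; have inu := integrable_norm iu.
have N : intg2 (fun x y => `|u x * v y|).
  apply: intg2_Tonelli => //; first exact: measurableT_comp.
    apply: ae_all => x.
    have -> : (fun y => `|u x * v y|) = (fun y => `|u x| * `|v y|).
      by apply/funext => y; rewrite normrM.
    exact: intgZ.
  have -> : (fun x => \int[mu]_y `|u x * v y|) = (fun x => (\int[mu]_y `|v y|) * `|u x|).
    apply/funext => x; under eq_Rintegral do rewrite normrM.
    by rewrite RintegralZl// mulrC.
  exact: intgZ.
by apply: (@intg_ae_le _ _ _ mu2 _ _ _ measurableT _ N) => //; exact: ae_all.
Qed.

Lemma intg_indic (A : set R) (f : R -> R) : measurable A ->
  mu.-integrable A (EFin \o f) -> mu.-integrable setT (EFin \o (fun s => f s * \1_A s)).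
Proof.
move=> mA; rewrite integrable_mkcond//; apply: eq_integrable => // s _.
by rewrite /= patchE indicE; case: ifPn => sA; rewrite /= ?mulr1 ?mulr0.
Qed.

(* Fubini's theorem on the triangle [y <= x] of the square [c, d]^2. *)
Lemma wderiv_ibp F q phi psi c d : is_wderiv a b F q -> is_wderiv a b phi psi ->
  mu.-integrable `]a, b[%classic (EFin \o F) ->
  mu.-integrable `]a, b[%classic (EFin \o phi) ->
  mu.-integrable `]a, b[%classic (EFin \o (fun x => F x * psi x)) ->
  mu.-integrable `]a, b[%classic (EFin \o (fun x => q x * phi x)) ->
  a < c -> c < d -> d < b ->
  right_lebesgue_pt F c -> right_lebesgue_pt F d ->
  right_lebesgue_pt phi c -> right_lebesgue_pt phi d ->
  \int[mu]_(x in `[c, d]) (F x * psi x) + \int[mu]_(x in `[c, d]) (q x * phi x) =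
  F d * phi d - F c * phi c.
Proof.
move=> wF wp iF ip iFp iqp ac cd db LFc LFd Lpc Lpd.
have [lF lq _] := wF; have [lp ls _] := wp.
have ad : a < d by exact: lt_trans cd.
have cb : c < b by exact: lt_trans db.
have sub : `[c, d]%classic `<=` `]a, b[%classic by apply: subset_itvSoo; rewrite bnd_simp.
have iq : mu.-integrable `[c, d]%classic (EFin \o q) by apply: (locally_integrable_itv lq).
have is_ : mu.-integrable `[c, d]%classic (EFin \o psi) by apply: (locally_integrable_itv ls).
have iFp' : mu.-integrable `[c, d]%classic (EFin \o (fun x => F x * psi x)) by apply: intgS iFp.
have iqp' : mu.-integrable `[c, d]%classic (EFin \o (fun x => q x * phi x)) by apply: intgS iqp.
pose Q y := q y * \1_(`[c, d]%classic) y; pose P x := psi x * \1_(`[c, d]%classic) x.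
have iQ : mu.-integrable setT (EFin \o Q) by exact: intg_indic.
have iP : mu.-integrable setT (EFin \o P) by exact: intg_indic.
have mQ : measurable_fun setT Q by apply: intg_measurable iQ.
have mP : measurable_fun setT P by apply: intg_measurable iP.
pose W x y := P x * Q y * ((y <= x)%R%:R : R).
have mle : meas2 (fun x y => ((y <= x)%R%:R : R)).
  exact: measurable_le_ind.
have mW : meas2 W.
  by apply: measurable_funM => //; apply: measurable_funM; apply: measurableT_comp.
have iW : intg2 W.
  apply: (@intg_ae_le _ _ _ mu2 _ _ _ measurableT _ (integrable_norm (intg2_prod iP iQ))) => //.
  apply: ae_all => z _; rewrite /W normrM ler_piMr//.
  by case: (z.2 <= z.1)%R; rewrite ?normr1 ?normr0.
have goodF := ae_right_lebesgue_pt iF; have goodp := ae_right_lebesgue_pt ip.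
have cc0 : \forall x \ae mu, x != c /\ x != d.
  exists [set c; d]; split.
  - by apply: measurableU; exact: measurable_set1.
  - apply/eqP; rewrite -measure_le0; apply: le_trans (measureU2 _ _ _) _ => //.
    by rewrite /= !lebesgue_measure_set1 adde0.
  - by move=> s /= /not_andP[] /negP; rewrite negbK => /eqP ->; [left|right].
(* The inner integral of q over [c, x] is F x - F c here; in [E2] that of psi over [y, d] is phi d -
   phi y. Equating the two orders gives the formula. *)
have E1 : \int[mu]_x \int[mu]_y W x y =
    \int[mu]_(x in `[c, d]) (F x * psi x) - F c * (phi d - phi c).
  rewrite (is_wderiv_ftc wp ac cd db Lpc Lpd).
  rewrite -RintegralZl// -RintegralB//; last exact: intgZ.
  rewrite [RHS]Rintegral_ind; apply: ae_eq_Rintegral => //.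
  - exact: meas2_Rint.
  - have iD : mu.-integrable `[c, d]%classic (EFin \o (fun x => F x * psi x - F c * psi x)).
      by apply: intgB => //; exact: intgZ.
    by apply: intg_measurable (intg_indic _ iD).
  - apply: ae_imp (ae_and goodF cc0) => x [gF [xc xd]] _.
    transitivity ((F x - F c) * P x); last by rewrite /P; ring.
    have [|xcd] := boolP (x \in `[c, d]%classic); last first.
      have P0 : P x = 0 by rewrite /P indicE (negbTE xcd) mulr0.
      rewrite P0 mulr0 (@eq_Rintegral _ _ _ mu setT (fun=> 0)); last first.
        by move=> y _; rewrite /W P0 !mul0r.
      by rewrite /Rintegral integral0.
    move=> xcd; have PE : P x = psi x by rewrite /P indicE xcd mulr1.
    move: xcd; rewrite inE/= in_itv/= => /andP[cx xd'].
    have cx' : c < x by rewrite lt_def xc.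
    have xab : a < x < b by rewrite (lt_trans ac)//= (le_lt_trans xd').
    rewrite PE (is_wderiv_ftc wF ac cx' _ LFc (gF xab)); last by case/andP: xab.
    have iqx : mu.-integrable `[c, x]%classic (EFin \o q).
      by apply: intgS iq => //; apply: subset_itvl; rewrite bnd_simp.
    rewrite mulrC -RintegralZl// [RHS]Rintegral_ind; apply: eq_Rintegral => y _.
    rewrite /W PE /Q !indicE !mem_setE !in_itv/=.
    have [cy|yc] := leP c y; rewrite /= ?mulr0 ?mul0r//.
    have [yx|xy] := leP y x; rewrite /= ?mulr0//.
    by rewrite (le_trans yx xd')/= !mulr1.
have E2 : \int[mu]_y \int[mu]_x W x y =
    phi d * (F d - F c) - \int[mu]_(y in `[c, d]) (q y * phi y).
  rewrite (is_wderiv_ftc wF ac cd db LFc LFd).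
  rewrite -RintegralZl// -RintegralB//; last exact: intgZ.
  rewrite [RHS]Rintegral_ind; apply: ae_eq_Rintegral => //.
  - exact: (meas2_Rint (meas2_swap mW)).
  - have iD : mu.-integrable `[c, d]%classic (EFin \o (fun y => phi d * q y - q y * phi y)).
      by apply: intgB => //; exact: intgZ.
    by apply: intg_measurable (intg_indic _ iD).
  - apply: ae_imp (ae_and goodp cc0) => y [gp [yc yd]] _.
    transitivity ((phi d - phi y) * Q y); last by rewrite /Q; ring.
    have [|ycd] := boolP (y \in `[c, d]%classic); last first.
      have Q0 : Q y = 0 by rewrite /Q indicE (negbTE ycd) mulr0.
      rewrite Q0 mulr0 (@eq_Rintegral _ _ _ mu setT (fun=> 0)); last first.
        by move=> x _; rewrite /W Q0 mulr0 mul0r.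
      by rewrite /Rintegral integral0.
    move=> ycd; have QE : Q y = q y by rewrite /Q indicE ycd mulr1.
    move: ycd; rewrite inE/= in_itv/= => /andP[cy yd'].
    have yd2 : y < d by rewrite lt_def eq_sym yd.
    have yab : a < y < b by rewrite (lt_le_trans ac)//= (lt_trans yd2).
    rewrite QE (is_wderiv_ftc wp _ yd2 db (gp yab) Lpd); last by case/andP: yab.
    have isx : mu.-integrable `[y, d]%classic (EFin \o psi).
      by apply: intgS is_ => //; apply: subset_itvr; rewrite bnd_simp.
    rewrite mulrC -RintegralZl// [RHS]Rintegral_ind; apply: eq_Rintegral => x _.
    rewrite /W QE /P !indicE !mem_setE !in_itv/=.
    have [yx|xy] := leP y x; rewrite /= ?mulr0//.
    by rewrite (le_trans cy yx)/=; case: (_ <= _); rewrite /= ?mulr1 ?mulr0 ?mul0r// mulrC.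
have := intg2_fubini_swap mW iW; rewrite E1 E2 => H.
move: H => /eqP; rewrite subr_eq => /eqP ->; ring.
Qed.

End SpaceIBP.

(** * Functions that vanish at the ends of the interval *)

Section Ends.
Variables (R : realType) (a b : R).
Hypothesis ab : a < b.
Local Notation mu := (@lebesgue_measure R).
Implicit Types (F q phi psi : R -> R).

Lemma ge0_subset_Rintegral_le (A D : set R) (f : R -> R) : measurable A -> measurable D ->
  A `<=` D -> (forall x, 0 <= f x) -> mu.-integrable D (EFin \o f) ->
  \int[mu]_(x in A) f x <= \int[mu]_(x in D) f x.
Proof.
move=> mA mD AD f0 fi; have fA : mu.-integrable A (EFin \o f) by exact: intgS fi.
rewrite -lee_fin -!Rintegral_EFin//; apply: ge0_subset_integral => //.
- by have [] := elimT (integrableP _ _ _) fi.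
- by move=> x _; rewrite lee_fin.
Qed.

(** A zero trace stated without a continuous representative: in this form it passes from the
    gradients to the flux, which is merely dominated by them ([vanishes_sum]). *)
Definition vanishes_at_ends F := forall e : R, 0 < e -> exists2 d : R, 0 < d &
  \forall x \ae mu, a < x < b -> (x < a + d) || (b - d < x) -> `|F x| <= e.

Lemma zero_trace_vanishes F : zero_trace a b F -> vanishes_at_ends F.
Proof.
move=> [g [cg Fg ga gb]] e e0.
have /(continuous_within_itvP _ ab)[_ ra lb] := cg.
rewrite ga in ra; rewrite gb in lb.
have [d1 /= d10 H1] := (cvgrPdist_le _ _).1 ra e e0.
have [d2 /= d20 H2] := (cvgrPdist_le _ _).1 lb e e0.
exists (Num.min d1 d2); first by rewrite lt_min d10.
apply: ae_imp Fg => x Fg xab; have /andP[ax xb] := xab; rewrite (Fg xab).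
case/orP => h.
  have := H1 x; rewrite /= sub0r normrN; apply => //.
  rewrite ltr0_norm ?subr_lt0// opprB ltrBlDl (lt_le_trans h)// lerD2l.
  by rewrite ge_min lexx.
have := H2 x; rewrite /= sub0r normrN; apply => //.
rewrite gtr0_norm ?subr_gt0// ltrBlDr -ltrBlDl (le_lt_trans _ h)// lerB//.
by rewrite ge_min lexx orbT.
Qed.

Lemma ex_near_end F (e : R) : vanishes_at_ends F -> 0 < e ->
  forall (P : R -> Prop) r, (\forall x \ae mu, a < x < b -> P x) -> 0 < r ->
  (exists c, [/\ a < c < b, c < a + r, P c & `|F c| <= e]) /\
  (exists c, [/\ a < c < b, b - r < c, P c & `|F c| <= e]).
Proof.
move=> vF e0 P r aP r0; have [d d0 Hd] := vF e e0.
have ba : 0 < b - a by rewrite subr_gt0.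
set m := Num.min (Num.min d r) (b - a).
have m0 : 0 < m by rewrite !lt_min d0 r0.
have md : m <= d by rewrite !ge_min lexx.
have mr : m <= r by rewrite !ge_min lexx orbT.
have mb : m <= b - a by rewrite ge_min lexx orbT.
have H := ae_and aP Hd.
split.
- have [||x /andP[x1 x2] [Px Fx]] := @ae_itv_ex _ a (a + m)
    (fun x => (a < x < b -> P x) /\ (a < x < b -> (x < a + d) || (b - d < x) -> `|F x| <= e)).
  + by rewrite ltrDl.
  + by apply: ae_imp H.
  have xab : a < x < b by rewrite x1/=; lra.
  exists x; split => //; [lra|exact: Px|apply: Fx => //; apply/orP; left; lra].
- have [||x /andP[x1 x2] [Px Fx]] := @ae_itv_ex _ (b - m) b
    (fun x => (a < x < b -> P x) /\ (a < x < b -> (x < a + d) || (b - d < x) -> `|F x| <= e)).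
  + by rewrite ltrBlDr ltrDl.
  + by apply: ae_imp H.
  have xab : a < x < b by rewrite x2 andbT; lra.
  exists x; split => //; [lra|exact: Px|apply: Fx => //; apply/orP; right; lra].
Qed.

(** The fundamental theorem of calculus, started at a Lebesgue point near a at which |F| is at most
    e. *)
Lemma wderiv_sup_le F q : is_wderiv a b F q -> vanishes_at_ends F ->
  mu.-integrable `]a, b[%classic (EFin \o F) ->
  mu.-integrable `]a, b[%classic (EFin \o q) ->
  \forall x \ae mu, a < x < b -> `|F x| <= \int[mu]_(x in `]a, b[) `|q x|.
Proof.
move=> w vF iF iq.
have good := ae_right_lebesgue_pt iF.
apply: ae_imp (good) => x + xab => /(_ xab) gx; have /andP[ax xb] := xab.
apply/ler_addgt0Pl => e e0.
have [[c [cab cx gc Fc]] _] := ex_near_end vF e0 good (r := x - a) ltac:(by rewrite subr_gt0).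
have {}cx : c < x by lra.
have /andP[ac _] := cab.
have /eqP := is_wderiv_ftc w ac cx xb gc gx; rewrite subr_eq => /eqP ->.
rewrite addrC; apply: le_trans (ler_normD _ _) _; apply: lerD => //.
have sub : `[c, x]%classic `<=` `]a, b[%classic by apply: subset_itvSoo; rewrite bnd_simp.
have iq' : mu.-integrable `[c, x]%classic (EFin \o q) by apply: intgS iq.
apply: le_trans (le_normr_Rintegral _ _) _ => //.
apply: (@ge0_subset_Rintegral_le _ _ (fun y => `|q y|)) => //; exact: integrable_norm.
Qed.

(** Integration by parts on [c_k, d_k] with Lebesgue points c_k and d_k tending to a and b. The
    boundary terms vanish in the limit because F is small there and phi is bounded. *)
Lemma wderiv_ibp_full F q phi psi : is_wderiv a b F q -> is_wderiv a b phi psi ->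
  vanishes_at_ends F ->
  mu.-integrable `]a, b[%classic (EFin \o F) ->
  mu.-integrable `]a, b[%classic (EFin \o phi) ->
  mu.-integrable `]a, b[%classic (EFin \o psi) ->
  mu.-integrable `]a, b[%classic (EFin \o (fun x => F x * psi x)) ->
  mu.-integrable `]a, b[%classic (EFin \o (fun x => q x * phi x)) ->
  \int[mu]_(x in `]a, b[) (F x * psi x) = - \int[mu]_(x in `]a, b[) (q x * phi x).
Proof.
move=> wF wp vF iF ip ips iFp iqp.
have good := ae_and (ae_right_lebesgue_pt iF) (ae_right_lebesgue_pt ip).
have {}good : \forall x \ae mu, a < x < b -> right_lebesgue_pt F x /\ right_lebesgue_pt phi x.
  by apply: ae_imp good => x [h1 h2] xab; split; [exact: h1|exact: h2].
(* c_k and d_k are taken within a third of the length from opposite ends, so that c_k < d_k. *)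
have ba : 0 < (b - a) / 3 by rewrite divr_gt0// subr_gt0.
have inps := integrable_norm ips.
(* The embedding of dimension one: values of phi at two Lebesgue points differ by at most the
   integral of |psi|. *)
have [B HB] : exists B : R, forall x, a < x < b -> right_lebesgue_pt phi x -> `|phi x| <= B.
  have [c0 c0ab [_ gc0]] := ae_itv_ex ab good.
  exists (`|phi c0| + \int[mu]_(x in `]a, b[) `|psi x|) => x xab gx.
  have K c d : a < c -> c < d -> d < b -> right_lebesgue_pt phi c -> right_lebesgue_pt phi d ->
      `|phi d - phi c| <= \int[mu]_(x in `]a, b[) `|psi x|.
    move=> ac cd db gc gd; rewrite (is_wderiv_ftc wp ac cd db gc gd).
    have sub : `[c, d]%classic `<=` `]a, b[%classic by apply: subset_itvSoo; rewrite bnd_simp.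
    have iq' : mu.-integrable `[c, d]%classic (EFin \o psi) by apply: intgS ips.
    apply: le_trans (le_normr_Rintegral _ _) _ => //.
    apply: (@ge0_subset_Rintegral_le _ _ (fun y => `|psi y|)) => //; exact: integrable_norm.
  rewrite -lerBlDl; apply: le_trans (lerB_dist _ _) _.
  have /andP[ax xb] := xab; have /andP[ac cb] := c0ab.
  have [xc|cx|<-] := ltgtP x c0.
  + by rewrite distrC; apply: K.
  + exact: K.
  + by rewrite subrr normr0 Rintegral_ge0.
have HS (k : nat) : exists cd : R * R, [/\ a < cd.1, cd.2 < b,
    cd.1 < a + (b - a) / 3 / k.+1%:R, b - (b - a) / 3 / k.+1%:R < cd.2 &
    `|\int[mu]_(x in `[cd.1, cd.2]) (F x * psi x + q x * phi x)| <= 2 * B / k.+1%:R].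
  have k0 : 0 < (b - a) / 3 / k.+1%:R by rewrite divr_gt0.
  have k3 : (b - a) / 3 / k.+1%:R <= (b - a) / 3 by exact: seq_div_le.
  have e0 : 0 < 1 / k.+1%:R :> R by [].
  have [[c [cab ca gc Fc]] [d [dab db gd Fd]]] := ex_near_end vF e0 good k0.
  exists (c, d) => /=; have /andP[ac cb] := cab; have /andP[ad db'] := dab; split => //.
  have cd : c < d by move: ca db k3 ba; set k1 := _ / k.+1%:R; lra.
  have sub : `[c, d]%classic `<=` `]a, b[%classic by apply: subset_itvSoo; rewrite bnd_simp.
  have iFp1 : mu.-integrable `[c, d]%classic (EFin \o (fun x => F x * psi x)) by apply: intgS iFp.
  have iqp1 : mu.-integrable `[c, d]%classic (EFin \o (fun x => q x * phi x)) by apply: intgS iqp.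
  rewrite RintegralD//.
  rewrite (wderiv_ibp wF wp)//; [|by case: gc|by case: gd|by case: gc|by case: gd].
  have pc := HB _ cab (proj2 gc); have pd := HB _ dab (proj2 gd).
  apply: le_trans (ler_normB _ _) _; rewrite !normrM.
  have -> : 2 * B / k.+1%:R = 1 / k.+1%:R * B + 1 / k.+1%:R * B by field.
  by apply: lerD; apply: ler_pM.
have [cd {}HS] := choice HS.
pose h x := F x * psi x + q x * phi x.
have ih : mu.-integrable `]a, b[%classic (EFin \o h) by exact: intgD.
have mh : measurable_fun `]a, b[%classic h by apply: intg_measurable ih.
have L : (fun k => \int[mu]_(x in `]a, b[) (h x * \1_(`[(cd k).1, (cd k).2]%classic) x)) @ \oo -->
    \int[mu]_(x in `]a, b[) h x.
  apply: (@Rdominated_cvg _ _ _ mu _ _ _ (fun x => `|h x|)) => //.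
  - by move=> k; apply: measurable_funM => //; exact: measurable_indic.
  - exact: integrable_norm ih.
  - apply: ae_all => x; rewrite /= in_itv/= => /andP[ax xb].
    apply: cvg_near_cst.
    have Na := seq_div_near ((b - a) / 3) (dl := x - a) ltac:(by rewrite subr_gt0).
    have Nb := seq_div_near ((b - a) / 3) (dl := b - x) ltac:(by rewrite subr_gt0).
    near=> k; have [h1 h2 h3 h4 _] := HS k.
    have ka : (b - a) / 3 / k.+1%:R < x - a by near: k.
    have kb : (b - a) / 3 / k.+1%:R < b - x by near: k.
    rewrite indicE mem_set ?mulr1//= in_itv/=; move: h3 h4 ka kb; set k1 := _ / k.+1%:R; move=> *; apply/andP; split; lra.
  - apply: ae_all => x k _; rewrite normrM ler_piMr// indicE.
    by case: (_ \in _); rewrite ?normr1 ?normr0.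
have E k : \int[mu]_(x in `]a, b[) (h x * \1_(`[(cd k).1, (cd k).2]%classic) x) =
    \int[mu]_(x in `[(cd k).1, (cd k).2]) h x.
  have [h1 h2 _ _ _] := HS k.
  have sub : `[(cd k).1, (cd k).2]%classic `<=` `]a, b[%classic.
    by apply: subset_itvSoo; rewrite bnd_simp.
  rewrite (@supp_Rintegral _ _ _ mu `]a, b[%classic `[(cd k).1, (cd k).2]%classic)//.
    by apply: eq_Rintegral => x xcd; rewrite indicE xcd mulr1.
  by move=> x _ xcd; rewrite indicE memNset// mulr0.
have L0 : (fun k => \int[mu]_(x in `]a, b[) (h x * \1_(`[(cd k).1, (cd k).2]%classic) x)) @ \oo -->
    (0 : R).
  apply/cvgrPdist_le => e e0.
  have /cvgrPdist_le/(_ _ e0) := seq_div_cvg0 (2 * B).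
  apply: filterS => k; rewrite !sub0r !normrN E => H.
  have [_ _ _ _ Hk] := HS k; apply: le_trans Hk (le_trans (ler_norm _) H).
have : \int[mu]_(x in `]a, b[) h x = 0 by exact: (cvg_unique _ L L0).
rewrite /h RintegralD// => /eqP.
by rewrite addr_eq0 => /eqP.
Unshelve. all: by end_near. Qed.

End Ends.

(** * Strong solutions *)

Section Pairing.
Variables (R : realType) (a b : R).
Hypothesis ab : a < b.
Local Notation mu := (@lebesgue_measure R).
Implicit Types (f g phi : R -> R).

Lemma vanishes_sum (m : nat) (g : 'I_m -> R -> R) (F : R -> R) (C : R) :
  (forall j, vanishes_at_ends a b (g j)) ->
  (\forall x \ae mu, a < x < b -> `|F x| <= C * \sum_j `|g j x|) ->
  vanishes_at_ends a b F.
Proof.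
move=> vg FC e e0.
have M0 : 0 < `|C| * m%:R + 1 by rewrite ltr_wpDl// mulr_ge0.
have e1 : 0 < e / (`|C| * m%:R + 1) by exact: divr_gt0.
have /choice[d Hd] : forall j, exists d : R, 0 < d /\
    \forall x \ae mu, a < x < b -> (x < a + d) || (b - d < x) -> `|g j x| <= e / (`|C| * m%:R + 1).
  by move=> j; have [d d0 Hd] := vg j _ e1; exists d.
exists (\big[Num.min/1]_j d j).
  by apply: lt_bigmin => // j _; have [] := Hd j.
have Hd' : \forall x \ae mu, forall j, a < x < b -> (x < a + d j) || (b - d j < x) ->
    `|g j x| <= e / (`|C| * m%:R + 1).
  by apply: ae_all_ord => j; have [] := Hd j.
apply: ae_imp (ae_and FC Hd') => x [Fx gx] xab xd.
have gj j : `|g j x| <= e / (`|C| * m%:R + 1).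
  apply: gx => //; have dj := bigmin_le 1 j d.
  by case/orP: xd => h; apply/orP; [left|right]; lra.
apply: le_trans (Fx xab) _.
apply: (@le_trans _ _ (`|C| * (m%:R * (e / (`|C| * m%:R + 1))))).
  apply: (@le_trans _ _ (`|C| * \sum_j `|g j x|)).
    by rewrite ler_wpM2r ?ler_norm// sumr_ge0.
  rewrite ler_wpM2l//.
  apply: le_trans (ler_sum _ (fun j _ => gj j)) _.
  by rewrite sumr_const card_ord mulr_natl.
have -> : `|C| * (m%:R * (e / (`|C| * m%:R + 1))) = e * ((`|C| * m%:R) / (`|C| * m%:R + 1)).
  by field; rewrite gt_eqF.
by rewrite ler_piMr ?(ltW e0)// ler_pdivrMr// mul1r lerDl.
Qed.

Lemma L2_mul_intg f g : in_L2 a b f -> in_L2 a b g ->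
  mu.-integrable `]a, b[%classic (EFin \o (fun x => f x * g x)).
Proof. by move=> /in_L2P[mf f2] /in_L2P[mg g2]; exact: leb_mul_sq. Qed.

Lemma L2pairB f g phi : in_L2 a b f -> in_L2 a b g -> in_L2 a b phi ->
  L2pair a b (fun x => f x - g x) phi = L2pair a b f phi - L2pair a b g phi.
Proof.
move=> hf hg hp; have ifp := L2_mul_intg hf hp; have igp := L2_mul_intg hg hp.
rewrite /L2pair -RintegralB//; apply: eq_Rintegral => x _; exact: mulrBl.
Qed.

(** Young's inequality with weight e in place of Cauchy-Schwarz: the bound is linear in e with a
    factor depending on phi only, as continuity in time asks. *)
Lemma L2pair_le f phi (e : R) : in_H1 a b f -> in_L2 a b phi -> 0 < e ->
  (H1norm a b f <= e%:E)%E ->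
  `|L2pair a b f phi| <= e * ((1 + \int[mu]_(x in `]a, b[) (phi x ^+ 2)) / 2).
Proof.
move=> hf hp e0 Ne; have [hf2 _ hw] := hf.
have /in_L2P[_ f2] := hf2; have /in_L2P[_ p2] := hp.
have fp := L2_mul_intg hf2 hp.
set S := \int[mu]_(x in _) _.
have fe : \int[mu]_(x in `]a, b[) (f x ^+ 2) <= e ^+ 2.
  move: Ne; rewrite /H1norm !L2sqE//; set s := Rintegral _ _ _; set w := Rintegral _ _ _.
  have s0 : 0 <= s by apply: Rintegral_ge0 => x _; exact: sqr_ge0.
  have w0 : 0 <= w by apply: Rintegral_ge0 => x _; exact: sqr_ge0.
  rewrite -EFinD /sqrte lee_fin => H.
  have : Num.sqrt (s + w) ^+ 2 <= e ^+ 2 by rewrite lerXn2r ?nnegrE ?sqrtr_ge0// ltW.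
  by rewrite sqr_sqrtr ?addr_ge0//; lra.
have if' : mu.-integrable `]a, b[%classic (EFin \o (fun x => (2 * e)^-1 * f x ^+ 2)) by exact: intgZ.
have ip' : mu.-integrable `]a, b[%classic (EFin \o (fun x => e / 2 * phi x ^+ 2)) by exact: intgZ.
have nfp := integrable_norm fp.
apply: le_trans (le_normr_Rintegral _ _) _ => //.
apply: (@le_trans _ _ (\int[mu]_(x in `]a, b[) ((2 * e)^-1 * f x ^+ 2 + e / 2 * phi x ^+ 2))).
  apply: le_Rintegral => //; first exact: intgD.
  move=> x _; rewrite -subr_ge0 /=.
  have -> : (2 * e)^-1 * f x ^+ 2 + e / 2 * phi x ^+ 2 - `|f x * phi x| =
     (2 * e)^-1 * (`|f x| - e * `|phi x|) ^+ 2.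
    rewrite normrM -(real_normK (num_real (f x))) -(real_normK (num_real (phi x))).
    by field; rewrite gt_eqF.
  by rewrite mulr_ge0 ?sqr_ge0// invr_ge0 mulr_ge0// ltW.
rewrite RintegralD// !RintegralZl//.
have -> : e * ((1 + S) / 2) = (2 * e)^-1 * e ^+ 2 + e / 2 * S by field; rewrite gt_eqF.
by rewrite lerD2r ler_wpM2l// invr_ge0 mulr_ge0// ltW.
Qed.

Lemma L2pair_eq f g phi : in_H1 a b f -> in_H1 a b g -> in_L2 a b phi ->
  H1norm a b (fun x => f x - g x) = 0%E -> L2pair a b f phi = L2pair a b g phi.
Proof.
move=> hf hg hp N0; apply/eqP; rewrite -subr_eq0 -normr_le0.
have [hf2 _ _] := hf; have [hg2 _ _] := hg.
rewrite -L2pairB//; apply/ler_addgt0Pl => e e0; rewrite addr0.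
have S0 : 0 <= \int[mu]_(x in `]a, b[) (phi x ^+ 2).
  by apply: Rintegral_ge0 => x _; exact: sqr_ge0.
have H : 0 < (1 + \int[mu]_(x in `]a, b[) (phi x ^+ 2)) / 2 by rewrite divr_gt0// ltr_pwDl.
have := @L2pair_le _ phi (e / ((1 + \int[mu]_(x in `]a, b[) (phi x ^+ 2)) / 2)) (in_H1B hf hg) hp.
rewrite N0 mulfVK ?gt_eqF//; apply; first exact: divr_gt0.
by rewrite lee_fin ltW// divr_gt0.
Qed.

Lemma L2pair_continuous (J : set R) (U : R -> R -> R) phi : in_L2 a b phi ->
  (forall t, J t -> in_H1 a b (U t)) ->
  (forall t, J t -> forall e : R, 0 < e -> exists2 d : R, 0 < d &
          forall s, J s -> `|s - t| < d ->
            (H1norm a b (fun y => U s y - U t y)%R < e%:E)%E) ->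
  forall t, J t -> forall e : R, 0 < e -> exists2 d : R, 0 < d &
          forall s, J s -> `|s - t| < d -> `|L2pair a b (U s) phi - L2pair a b (U t) phi| < e.
Proof.
move=> hp UX Uc t Jt e e0.
set S := (1 + \int[mu]_(x in `]a, b[) (phi x ^+ 2)) / 2.
have S0 : 0 < S.
  by rewrite divr_gt0// ltr_pwDl// Rintegral_ge0// => x _; exact: sqr_ge0.
have e1 : 0 < e / (2 * S) by rewrite divr_gt0// mulr_gt0.
have [d d0 Hd] := Uc t Jt _ e1.
exists d => // s Js st; have N := Hd s Js st.
have hs := UX s Js; have ht := UX t Jt.
have [hs2 _ _] := hs; have [ht2 _ _] := ht.
rewrite -L2pairB//; apply: le_lt_trans (L2pair_le (in_H1B hs ht) hp e1 (ltW N)) _.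
rewrite -/S; have -> : e / (2 * S) * S = e / 2 by field; rewrite gt_eqF.
lra.
Qed.

End Pairing.

(** * A strong solution at a fixed time *)

Section StrongSlice.
Variables (R : realType) (n : nat) (a b : R).
Hypotheses (n1 : (1 <= n)%N) (ab : a < b).
Variable K : 'I_n.+1 -> 'I_n.+1 -> R.
Hypothesis hK : 2 * n%:R * Kgap K < Kmean K.
Hypothesis Kp : forall i j, i != j -> 0 < K i j.
Local Notation mu := (@lebesgue_measure R).
Variables (y p v q : 'I_n.+1 -> R -> R).
Let F i x := pflux K (y^~ x) (p^~ x) i.
Hypotheses (hp : forall i, in_L2 a b (p i)) (hv : forall i, in_L2 a b (v i)).
Hypothesis wF : forall i, is_wderiv a b (F i) (q i).
Hypothesis vq : forall i, \forall x \ae mu, a < x < b -> v i x = q i x.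
Hypothesis p0 : forall i, zero_trace a b (p i).
Hypothesis ys : \forall x \ae mu, a < x < b -> in_simplex (y^~ x) /\ \sum_i p i x = 0.

Lemma slice_flux_L2 i : in_L2 a b (F i).
Proof.
apply/in_L2P; split; first by have [[]] := wF i.
have mF : measurable_fun `]a, b[%classic (F i) by have [[]] := wF i.
have ip : mu.-integrable `]a, b[%classic (EFin \o (fun x => \sum_j p j x ^+ 2)).
  by apply: intg_sum => // j; have /in_L2P[] := hp j.
apply: (@intg_ae_le _ _ _ mu _ _
  (fun x => (Kplus K * (2 * n%:R + 2)) ^+ 2 * n.+1%:R * \sum_j p j x ^+ 2)) => //.
- exact: measurable_funX.
- exact: intgZ.
apply: ae_imp ys => x + xab; have xab' : a < x < b by move: xab; rewrite /= in_itv.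
move=> /(_ xab')[sy _]; rewrite ger0_norm ?sqr_ge0//.
exact: (pflux_sq_le n1 _ _ sy Kp).
Qed.

Lemma slice_flux_vanishes i : vanishes_at_ends a b (F i).
Proof.
apply: (@vanishes_sum _ a b n.+1 p _ (Kplus K * (2 * n%:R + 2))).
  by move=> j; exact: zero_trace_vanishes.
apply: ae_imp ys => x + xab => /(_ xab)[sy _].
exact: (pflux_norm_le n1 _ _ sy Kp).
Qed.

Lemma slice_q_L2 i : in_L2 a b (q i).
Proof. by apply: (in_L2_ae_eq (hv i)) (vq i); have [_ []] := wF i. Qed.

(* The flux vanishes at the ends and its derivative is [v], the time derivative of [u]. *)
Lemma slice_flux_le i : \forall x \ae mu, a < x < b ->
  F i x ^+ 2 <= (b - a) * \int[mu]_(x in `]a, b[) (v i x ^+ 2).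
Proof.
have hq := slice_q_L2 i; have iq := in_L2_intg ab hq.
have /in_L2P[mq q2] := hq; have /in_L2P[mv v2] := hv i.
have iF := in_L2_intg ab (slice_flux_L2 i).
apply: ae_imp (wderiv_sup_le ab (wF i) (slice_flux_vanishes i) iF iq) => x + xab => /(_ xab) H.
rewrite -(real_normK (num_real (F i x))).
apply: (@le_trans _ _ ((\int[mu]_(x in `]a, b[) `|q i x|) ^+ 2)).
  by rewrite lerXn2r ?nnegrE// (le_trans _ H).
have inq := integrable_norm iq.
have NQ : (fun x => `|q i x| ^+ 2) = (fun x => q i x ^+ 2).
  by apply/funext => z; rewrite real_normK ?num_real.
have q2' : mu.-integrable `]a, b[%classic (EFin \o (fun x => `|q i x| ^+ 2)).
  by rewrite NQ.
apply: le_trans (Rintegral_sq_le _ inq q2' (measure_ab ab)) _ => //.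
rewrite ler_wpM2l ?subr_ge0 ?(ltW ab)// le_eqVlt; apply/orP; left; apply/eqP.
apply: ae_eq_Rintegral => //.
- by rewrite NQ; exact: measurable_funX.
- exact: measurable_funX.
by apply: ae_imp (vq i) => x' Hx xab'; rewrite real_normK ?num_real// Hx.
Qed.

Lemma slice_grad_le i : \forall x \ae mu, a < x < b ->
  p i x ^+ 2 <= cK K ^- 2 * \sum_j ((b - a) * \int[mu]_(x in `]a, b[) (v j x ^+ 2)).
Proof.
have HF := ae_all_ord slice_flux_le.
apply: ae_imp (ae_and HF ys) => x [Hx sx] xab; have [sy ps] := sx xab.
apply: (@le_trans _ _ (\sum_j (p j x ^+ 2))).
  by rewrite (bigD1 i)//= lerDl sumr_ge0// => j _; exact: sqr_ge0.
apply: le_trans (grad_le_flux n1 hK sy ps) _.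
rewrite ler_wpM2l ?invr_ge0 ?sqr_ge0//.
by apply: ler_sum => j _; exact: Hx.
Qed.

Lemma slice_ibp i phi : in_H1 a b phi ->
  \int[mu]_(x in `]a, b[) (F i x * wderiv a b phi x) = - L2pair a b (v i) phi.
Proof.
move=> [hp2 wp hw].
have hF := slice_flux_L2 i; have hq := slice_q_L2 i.
rewrite (wderiv_ibp_full ab (wF i) wp (slice_flux_vanishes i)).
- congr (- _); apply: ae_eq_Rintegral => //.
  + by apply: measurable_funM; [have [] := hq|have [] := hp2].
  + by apply: measurable_funM; [have [] := hv i|have [] := hp2].
  by apply: ae_imp (vq i) => x Hx; rewrite /= in_itv/= => /Hx ->.
- exact: in_L2_intg.
- exact: in_L2_intg.
- exact: in_L2_intg.
- exact: L2_mul_intg.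
- exact: L2_mul_intg.
Qed.

End StrongSlice.

Section StrongFacts.
Variables (R : realType) (n : nat) (T a b : R).
Hypotheses (n1 : (1 <= n)%N) (T0 : 0 < T) (ab : a < b).
Variable K : 'I_n.+1 -> 'I_n.+1 -> R.
Hypothesis hK : 2 * n%:R * Kgap K < Kmean K.
Hypothesis Kp : forall i j, i != j -> 0 < K i j.
Local Notation mu := (@lebesgue_measure R).

(** The same interface as [weak_solution_integrated], so that the two solutions can be subtracted,
    together with a bound [P2] of the squared gradient, uniform in x and integrable in time. *)
Lemma strong_solution_integrated (u : 'I_n.+1 -> R -> R -> R) (u0 : 'I_n.+1 -> R -> R) :
  strong_solution T a b K u u0 ->
  exists (p : 'I_n.+1 -> R -> R -> R) (U : 'I_n.+1 -> R -> (R -> R) -> R) (P2 : R -> R),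
  [/\ forall i, joint_measurable T a b (u i) /\ joint_measurable T a b (p i),
    \forall t \ae mu, 0 < t < T -> forall i, [/\ in_H1 a b (u i t),
      is_wderiv a b (u i t) (p i t) &
      forall phi, in_H1 a b phi -> U i t phi = L2pair a b (u i t) phi],
    \forall t \ae mu, 0 < t < T -> \forall x \ae mu, a < x < b ->
      in_simplex (fun i => u i t x) /\ \sum_i p i t x = 0,
    [/\ forall t, 0 <= P2 t, mu.-integrable setT (EFin \o P2) &
      \forall t \ae mu, 0 < t < T -> \forall x \ae mu, a < x < b ->
        forall i, p i t x ^+ 2 <= P2 t] &
    forall i phi, in_H1 a b phi -> [/\ forall s t, 0 < s -> s < t -> t < T ->
        U i t phi - U i s phi = - \int[mu]_(r in `[s, t]) \int[mu]_(x in `]a, b[)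
          (flux K u p i r x * wderiv a b phi x),
      U i 0 phi = L2pair a b (u0 i) phi &
      forall e : R, 0 < e -> exists2 d : R, 0 < d &
        forall s, 0 < s < T -> s < d -> `|U i s phi - U i 0 phi| < e]].
Proof.
move=> [p [v [q [H1 [H2 [H3 [H4 [H5 [H6 H7]]]]]]]]].
have [Ut HUt] := choice H7.
set A := `]0, T[%classic.
have mA : measurable A by rewrite /A.
have mu_ i : joint_measurable T a b (u i) by have [] := H1 i.
have mp i : joint_measurable T a b (p i) by have [_ _ []] := H1 i.
have mv i : joint_measurable T a b (v i) by have [] := H2 i.
have mbv i : meas2 (bx a b A (v i)) by exact: (joint_meas2_bx mA (@subset_refl _ _) (mv i)).
have ibv i : intg2 (fun t x => bx a b A (v i) t x ^+ 2).
  have [_ _ [_ fin] _] := H2 i.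
  apply: (bx_intg2 (N := fun t => L2norm a b (v i t) * L2norm a b (v i t))%E mA (@subset_refl _ A) (mbv i) _ fin).
    by move=> t; rewrite mule_ge0 ?sqrte_ge0.
  apply: ae_all => t _; by rewrite -expe2 /L2norm (sqr_sqrte (L2sq_ge0 _ _ _)).
(* The bound of [slice_grad_le], written with the zero extension of v so that it is defined,
   nonnegative and integrable on the whole line. *)
pose P2 t := cK K ^- 2 * \sum_j ((b - a) * \int[mu]_x (bx a b A (v j) t x ^+ 2)).
have P2E t : A t -> P2 t = cK K ^- 2 * \sum_j ((b - a) * \int[mu]_(x in `]a, b[) (v j t x ^+ 2)).
  move=> At; rewrite /P2; congr (_ * _); apply: eq_bigr => j _; congr (_ * _).
  rewrite (@Rintegral_bx _ a b _ _ (fun y _ => y ^+ 2))//; first by rewrite inE.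
  by move=> x; rewrite expr0n.
have aeUp : \forall t \ae mu, forall i, 0 < t < T -> in_H1 a b (u i t).
  apply: ae_all_ord => i; have [_ [[h _] _] _] := H1 i.
  by apply: ae_imp h => t ht tT; have [] := ht ltac:(by rewrite /= in_itv).
have aew : \forall t \ae mu, forall i, 0 < t < T -> is_wderiv a b (u i t) (p i t).
  by apply: ae_all_ord => i; have [_ _ []] := H1 i.
have aeV : \forall t \ae mu, forall i, 0 < t < T -> in_L2 a b (v i t).
  apply: ae_all_ord => i; have [_ _ [[h _] _] _] := H2 i.
  by apply: ae_imp h => t ht tT; have := ht ltac:(by rewrite /= in_itv).
have aeF : \forall t \ae mu, forall i, 0 < t < T -> is_wderiv a b (flux K u p i t) (q i t).
  by apply: ae_all_ord => i; have [] := H4 i.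
have aevq : \forall t \ae mu, forall i, 0 < t < T -> \forall x \ae mu, a < x < b -> v i t x = q i t x.
  apply: ae_all_ord => i.
  have := ae2_sections (P := fun t x => cylinder T a b (t, x) -> v i t x - q i t x = 0).
  move=> /(_ _)[]; first by apply: ae_imp (H5 i) => -[t x].
  move=> N [mN N0 sN]; exists N; split => //; apply: subset_trans sN => t /= + Ht; apply => tT.
  apply: ae_imp Ht => x Hx xab; apply/eqP; rewrite -subr_eq0; apply/eqP/Hx.
  by split; rewrite /= in_itv.
have aetr : \forall t \ae mu, forall i, 0 < t < T -> zero_trace a b (p i t).
  by apply: ae_all_ord => i; exact: H6.
have aes := sum_grad0 H3 (fun i => let: And3 _ _ h := H1 i in h).
have ael2p : \forall t \ae mu, 0 < t < T -> forall i, in_L2 a b (p i t).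
  apply: ae_imp (ae_and aeUp aew) => t [h1 h2] tT i.
  have [_ w' w2] := h1 i tT.
  by apply: (in_L2_ae_eq w2) (is_wderiv_uniq w' (h2 i tT)); have [_ []] := h2 i tT.
have slice : \forall t \ae mu, 0 < t < T ->
   (\forall x \ae mu, a < x < b -> forall i, p i t x ^+ 2 <= P2 t) /\
   (forall i phi, in_H1 a b phi ->
     \int[mu]_(x in `]a, b[) (flux K u p i t x * wderiv a b phi x) = - L2pair a b (v i t) phi).
  apply: ae_imp (ae_and ael2p (ae_and aeV (ae_and aeF (ae_and aevq (ae_and aetr aes))))) =>
    t [h1 [h2 [h3 [h4 [h5 h6]]]]] tT.
  have tA : A t by rewrite /A /= in_itv.
  have G1 := @slice_grad_le R n a b n1 ab K hK Kp (fun i => u i t) (fun i => p i t) (fun i => v i t)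
    (fun i => q i t) (h1 tT) (fun i => h2 i tT) (fun i => h3 i tT) (fun i => h4 i tT)
    (fun i => h5 i tT) (h6 tT).
  have G2 := @slice_ibp R n a b n1 ab K Kp (fun i => u i t) (fun i => p i t) (fun i => v i t)
    (fun i => q i t) (h1 tT) (fun i => h2 i tT) (fun i => h3 i tT) (fun i => h4 i tT)
    (fun i => h5 i tT) (h6 tT).
  split.
    by rewrite P2E//; apply: ae_imp (ae_all_ord G1) => x Hx xab i; exact: Hx.
  by move=> i phi hphi; exact: G2.
pose U i t phi := L2pair a b (Ut i t) phi.
have UL : \forall t \ae mu, forall i, 0 < t < T -> forall phi, in_H1 a b phi ->
    U i t phi = L2pair a b (u i t) phi.
  apply: ae_all_ord => i; have [XU _ h _] := HUt i.
  apply: ae_imp h => t ht /andP[t0 tT] phi [hp _ _].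
  have tJ : `[0, T]%classic t by rewrite /= in_itv/= !ltW.
  have [X N0] := ht tJ; exact: (L2pair_eq (XU t tJ) X hp N0).
exists p, U, P2; split => //.
- apply: ae_imp (ae_and aeUp (ae_and aew UL)) => t [h1 [h2 h3]] tT i.
  by split; [exact: h1|exact: h2|exact: h3].
- split.
  + move=> t; rewrite /P2 mulr_ge0 ?invr_ge0 ?sqr_ge0// sumr_ge0// => j _.
    rewrite mulr_ge0 ?subr_ge0 ?(ltW ab)// Rintegral_ge0// => x _; exact: sqr_ge0.
  + apply: intgZ => //; apply: intg_sum => // j; apply: intgZ => //.
    apply: (intg2_Rint _ (ibv j)); by apply: measurable_funX; exact: mbv.
  + by apply: ae_imp slice => t h tT; have [] := h tT.
move=> i phi hphi; have [XU cU _ [X0 U0]] := HUt i; have [hp2 _ _] := hphi.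
have dc := L2pair_continuous hp2 XU cU.
have J0 : `[0, T]%classic (0 : R) by rewrite /= in_itv/= lexx ltW.
split.
- have [_ _ _ /(_ phi hp2) w] := H2 i.
  apply: (time_identity w).
  + move=> t /andP[t0 tT]; apply/cvgrPdist_lt => e e0.
    have tJ : `[0, T]%classic t by rewrite /= in_itv/= !ltW.
    have [d d0 Hd] := dc t tJ e e0.
    have B : \forall s \near nbhs t, `|s - t| < d.
      by exists d => // s /=; rewrite distrC.
    near=> s; rewrite distrC; apply: Hd; last by near: s.
    rewrite /= in_itv/=; apply/andP; split.
      by apply: ltW; near: s; exact: lt_nbhsr.
    by apply: ltW; near: s; exact: lt_nbhsl.
  + by apply: ae_imp UL => t Ht tT; rewrite -(Ht i tT phi hphi).
  + by apply: ae_imp slice => t Ht tT; have [_ ->//] := Ht tT; rewrite opprK.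
  + apply: measurable_pairing; first exact: joint_measurable_flux.
    by have [_ [_ [g _ _] _] _] := hphi.
- exact: (L2pair_eq (XU 0 J0) X0 hp2 U0).
- move=> e e0; have [d d0 Hd] := dc 0 J0 e e0; exists d => // s /andP[s0 sT] sd.
  by apply: Hd; [rewrite /= in_itv/= !ltW|rewrite subr0 gtr0_norm].
Unshelve. all: by end_near. Qed.

End StrongFacts.

(** * Energy of the weak solution *)

Section Fatou.
Context d (T : measurableType d) (R : realType).
Variable mu : {measure set T -> \bar R}.

Lemma intg_fatou (D : set T) (f_ : nat -> T -> R) (f : T -> R) (M : R) : measurable D ->
  (forall k x, 0 <= f_ k x) -> (forall k, mu.-integrable D (EFin \o f_ k)) ->
  (forall k, \int[mu]_(x in D) f_ k x <= M) -> measurable_fun D f ->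
  (forall x, D x -> (fun k => f_ k x) @ \oo --> f x) ->
  mu.-integrable D (EFin \o f).
Proof.
move=> mD f0 fi fM mf fc.
have E x : D x -> limn_einf (fun k => (f_ k x)%:E) = `|(f x)%:E|%E.
  move=> Dx; have c : (fun k => (f_ k x)%:E) @ \oo --> (f x)%:E.
    by apply: cvg_EFin; [exact: nearW|exact: fc].
  rewrite is_cvg_limn_einfE; last by apply/cvg_ex; exists (f x)%:E.
  rewrite (cvg_lim _ c)// gee0_abs// lee_fin.
  rewrite -(cvg_lim _ (fc x Dx))//; apply: limr_ge; last exact: nearW.
  by apply/cvg_ex; exists (f x); exact: fc.
apply/integrableP; split; first exact/measurable_EFinP.
have := @fatou _ T R mu D mD (fun k => EFin \o f_ k) (fun k => let: conj h _ := elimT (integrableP _ _ _) (fi k) in h)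
  (fun k x _ => ltac:(by rewrite /= lee_fin)).
rewrite (eq_integral (fun x => `|(f x)%:E|%E)); last first.
  by move=> x /set_mem Dx; rewrite -E.
move=> H; apply: le_lt_trans H _.
apply: (@le_lt_trans _ _ M%:E); last by rewrite ltry.
rewrite limn_einf_lim; apply: lime_le; first exact: is_cvg_einfs.
apply: nearW => k; apply: (@le_trans _ _ (\int[mu]_(x in D) (f_ k x)%:E)%E).
  by apply: ereal_inf_lbound; exists k => /=.
by rewrite Rintegral_EFin// lee_fin.
Qed.

End Fatou.

(** * Summation of the energy inequality over the components *)

Section EnergySum.
Variables (R : realType) (a b : R).
Hypothesis ab : a < b.
Local Notation mu := (@lebesgue_measure R).
Local Notation mu2 := (mu \x mu)%E.
Local Notation RR := (measurableTypeR R * measurableTypeR R)%type.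

(** The positive part of f - g brings the inequality into the form treated by [ae2_of_sections]. *)
Lemma ae2_le (f g : R -> R -> R) : meas2 f -> meas2 g ->
  (\forall t \ae mu, \forall x \ae mu, f t x <= g t x) ->
  \forall z \ae mu2, f z.1 z.2 <= g z.1 z.2.
Proof.
move=> mf mg fg; pose h t x := Num.max (f t x - g t x) 0.
have mh : meas2 h by apply: measurable_maxr => //; exact: measurable_funB.
have := ae2_of_sections mh; move=> /(_ _)[].
  apply: ae_imp fg => t; apply: ae_imp => x fg.
  by rewrite /h max_r// subr_le0.
move=> N [mN N0 sN]; exists N; split => //; apply: subset_trans sN => z /= + Hz; apply.
have : f z.1 z.2 - g z.1 z.2 <= h z.1 z.2 by rewrite /h le_max lexx.
by rewrite Hz subr_le0.
Qed.

(** The sum over the components stands inside the integral because coercivity bounds the summed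
    product of flux and gradient, not the single ones. *)
Lemma energy_box_sum (m : nat) (r0 r1 : R) (z p F : 'I_m -> R -> R -> R)
    (U : 'I_m -> R -> (R -> R) -> R) :
  let A := `]r0, r1[%classic in
  let Phi t := \int[mu]_x (\sum_i bx a b A (F i) t x * bx a b A (p i) t x) in
  (forall i, [/\ meas2 (bx a b A (z i)), meas2 (bx a b A (p i)) & meas2 (bx a b A (F i))]) ->
  (forall i, intg2 (fun t x => bx a b A (p i) t x ^+ 2)) ->
  (forall i, intg2 (fun t x => bx a b A (F i) t x ^+ 2)) ->
  (\forall t \ae mu, A t -> \forall x \ae mu, a < x < b -> forall i, `|z i t x| <= 1) ->
  (\forall t \ae mu, A t -> forall i, [/\ in_H1 a b (z i t), is_wderiv a b (z i t) (p i t) &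
    forall phi, in_H1 a b phi -> U i t phi = L2pair a b (z i t) phi]) ->
  (forall i phi s t, in_H1 a b phi -> r0 < s -> s < t -> t < r1 ->
    U i t phi - U i s phi = - \int[mu]_(r in `[s, t]) \int[mu]_(x in `]a, b[)
      (F i r x * wderiv a b phi x)) ->
  intg2 (fun t x => \sum_i bx a b A (F i) t x * bx a b A (p i) t x) /\
  exists2 L : R -> Prop, (\forall r \ae mu, L r) &
    forall r r', L r -> L r' -> r0 < r -> r < r' -> r' < r1 ->
      \sum_i \int[mu]_(x in `]a, b[) (z i r' x ^+ 2) -
      \sum_i \int[mu]_(x in `]a, b[) (z i r x ^+ 2) <=
      - 2 * \int[mu]_(t in `[r, r']) Phi t.
Proof.
move=> A Phi mm ip iF z1 zH UE.
have iFp i : intg2 (fun t x => bx a b A (F i) t x * bx a b A (p i) t x).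
  have [_ m2 m3] := mm i.
  apply: (@intg_mul_sq _ _ _ mu2 setT (fun z : RR => bx a b A (F i) z.1 z.2)
    (fun z : RR => bx a b A (p i) z.1 z.2)) => //; [exact: iF|exact: ip].
have mFp i : meas2 (fun t x => bx a b A (F i) t x * bx a b A (p i) t x).
  by have [_ m2 m3] := mm i; apply: measurable_funM.
split.
  exact: (@intg_sum _ _ _ mu2 setT _ _ (fun i (z : RR) => bx a b A (F i) z.1 z.2 * bx a b A (p i) z.1 z.2)).
have HL i : exists L : R -> Prop, (\forall r \ae mu, L r) /\
    forall r r', L r -> L r' -> r0 < r -> r < r' -> r' < r1 ->
      \int[mu]_(x in `]a, b[) (z i r' x ^+ 2) - \int[mu]_(x in `]a, b[) (z i r x ^+ 2) <=
      - 2 * \int[mu]_(t in `[r, r']) \int[mu]_(x in `]a, b[) (F i t x * p i t x).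
  have [m1 m2 m3] := mm i.
  have [||L aeL H] := energy_box ab m1 m2 m3 (ip i) (iF i) _ _ (UE i); last by exists L.
    by apply: ae_imp z1 => t + At => /(_ At); apply: ae_imp => x h xab; exact: h.
  by apply: ae_imp zH => t h At; exact: h.
have [L {}HL] := choice HL.
have aeI : \forall t \ae mu, forall i, mu.-integrable setT
    (EFin \o (fun x => bx a b A (F i) t x * bx a b A (p i) t x)).
  by apply: ae_all_ord => i; exact: (intg2_ae (iFp i)).
exists (fun r => forall i, L i r).
  by apply: ae_all_ord => i; have [] := HL i.
move=> r r' Lr Lr' r0r rr' r'r1; rewrite -sumrB.
have HI i : mu.-integrable `[r, r']%classic (EFin \o
    (fun t => \int[mu]_x (bx a b A (F i) t x * bx a b A (p i) t x))).
  by apply: intgS (intg2_Rint (mFp i) (iFp i)).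
have E : \int[mu]_(t in `[r, r']) Phi t =
    \sum_i \int[mu]_(t in `[r, r']) \int[mu]_x (bx a b A (F i) t x * bx a b A (p i) t x).
  rewrite -Rintegral_sum//; apply: ae_eq_Rintegral => //.
  - apply: measurable_funTS; apply: meas2_Rint.
    by apply: measurable_sum => i; exact: mFp.
  - apply: measurable_funTS; apply: measurable_sum => i; exact: meas2_Rint.
  - by apply: ae_imp aeI => t It _; rewrite /Phi Rintegral_sum.
rewrite E mulr_sumr; apply: ler_sum => i _.
have [_ H] := HL i; apply: le_trans (H r r' (Lr i) (Lr' i) r0r rr' r'r1) _.
rewrite le_eqVlt; apply/orP; left; apply/eqP; congr (_ * _).
apply: eq_Rintegral => t; rewrite inE/= in_itv/= => /andP[rt tr'].
have At : A t by rewrite /A /= in_itv/= (lt_le_trans r0r rt) (le_lt_trans tr').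
rewrite (@Rintegral_bx _ a b A (F i) (fun y x => y * bx a b A (p i) t x))//.
- by apply: eq_Rintegral => x xab; rewrite bxE// inE.
- by rewrite inE.
- by move=> x; rewrite mul0r.
Qed.

End EnergySum.

Lemma energy_dissipated (R : realFieldType) (I x y z : R) :
  x - y <= - 2 * I -> y <= z -> 0 <= x -> I <= z / 2.
Proof. lra. Qed.

Section WeakEnergy.
Variables (R : realType) (n : nat) (T a b : R).
Hypotheses (n1 : (1 <= n)%N) (T0 : 0 < T) (ab : a < b).
Variable K : 'I_n.+1 -> 'I_n.+1 -> R.
Hypothesis hK : 2 * n%:R * Kgap K < Kmean K.
Hypothesis Kp : forall i j, i != j -> 0 < K i j.
Local Notation mu := (@lebesgue_measure R).
Local Notation mu2 := (mu \x mu)%E.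
Local Notation RR := (measurableTypeR R * measurableTypeR R)%type.
Variables (u p : 'I_n.+1 -> R -> R -> R).
Hypothesis mup : forall i, joint_measurable T a b (u i) /\ joint_measurable T a b (p i).
Hypothesis us : \forall t \ae mu, 0 < t < T -> \forall x \ae mu, a < x < b ->
  in_simplex (fun i => u i t x) /\ \sum_i p i t x = 0.

Lemma flux_intg2 (A : set R) : measurable A -> A `<=` `]0, T[%classic ->
  (forall i, intg2 (fun t x => bx a b A (p i) t x ^+ 2)) ->
  forall i, intg2 (fun t x => bx a b A (flux K u p i) t x ^+ 2).
Proof.
move=> mA AT ip i.
have mbp j : meas2 (bx a b A (p j)) by apply: (@joint_meas2_bx _ T) => //; have [] := mup j.
have mbF : meas2 (bx a b A (flux K u p i)).
  apply: (@joint_meas2_bx _ T) => //; apply: joint_measurable_flux => j; by have [] := mup j.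
pose C := (Kplus K * (2 * n%:R + 2)) ^+ 2 * n.+1%:R.
have C0 : 0 <= C by rewrite mulr_ge0// sqr_ge0.
have iS : intg2 (fun t x => \sum_j bx a b A (p j) t x ^+ 2).
  exact: (@intg_sum _ _ _ mu2 setT _ _ (fun j (z : RR) => bx a b A (p j) z.1 z.2 ^+ 2)).
have mS : meas2 (fun t x => \sum_j bx a b A (p j) t x ^+ 2).
  by apply: measurable_sum => j; apply: measurable_funX; exact: mbp.
have mF2 : meas2 (fun t x => bx a b A (flux K u p i) t x ^+ 2) by exact: measurable_funX.
apply: (@intg_ae_le _ _ _ mu2 _ _ _ measurableT mF2 (intgZ C measurableT iS)).
have := @ae2_le R _ _ mF2 (_ : meas2 (fun t x => C * \sum_j bx a b A (p j) t x ^+ 2)).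
move=> /(_ _ _)[].
- exact: measurable_funM.
- apply: ae_imp us => t Ht.
  have [tA|tA] := pselect (A t); last first.
    apply: ae_all => x; rewrite bx_out// expr0n mulr_ge0// sumr_ge0// => j _.
    exact: sqr_ge0.
  have tT : 0 < t < T by have := AT _ tA; rewrite /= in_itv.
  apply: ae_imp (Ht tT) => x Hx.
  have [xab|xab] := boolP (x \in `]a, b[%classic); last first.
    rewrite {1}/bx (negbTE xab) andbF expr0n mulr_ge0// sumr_ge0// => j _.
    exact: sqr_ge0.
  rewrite (bxE _ (mem_set tA) xab).
  under eq_bigr do rewrite (bxE _ (mem_set tA) xab).
  move: xab; rewrite inE/= in_itv/= => /Hx[sy _].
  exact: (pflux_sq_le n1 _ _ sy Kp).
move=> N [mN N0 sN]; exists N; split => //; apply: subset_trans sN => z /= + Hz; apply => _.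
by rewrite ger0_norm ?sqr_ge0.
Qed.

Variable U : 'I_n.+1 -> R -> (R -> R) -> R.
Hypothesis uH : \forall t \ae mu, 0 < t < T -> forall i, [/\ in_H1 a b (u i t),
      is_wderiv a b (u i t) (p i t) &
      forall phi, in_H1 a b phi -> U i t phi = L2pair a b (u i t) phi].
Hypothesis ip : forall i r0 r1, 0 < r0 -> r0 < r1 -> r1 < T ->
  intg2 (fun t x => bx a b `]r0, r1[%classic (p i) t x ^+ 2).
Hypothesis Uid : forall i phi, in_H1 a b phi -> forall s t, 0 < s -> s < t -> t < T ->
  U i t phi - U i s phi = - \int[mu]_(r in `[s, t]) \int[mu]_(x in `]a, b[)
    (flux K u p i r x * wderiv a b phi x).

Lemma mass_le (y : 'I_n.+1 -> R -> R) :
  (forall i, measurable_fun `]a, b[%classic (y i)) ->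
  (\forall x \ae mu, a < x < b -> in_simplex (fun i => y i x)) ->
  \sum_i \int[mu]_(x in `]a, b[) (y i x ^+ 2) <= n.+1%:R * (b - a).
Proof.
move=> my ys.
have H i : \int[mu]_(x in `]a, b[) (y i x ^+ 2) <= b - a.
  have y1 : \forall x \ae mu, `]a, b[%classic x -> y i x ^+ 2 <= 1.
    apply: ae_imp ys => x Hx; rewrite /= in_itv/= => /Hx[s0 s1].
    rewrite expr_le1// -s1 (bigD1 i)//= lerDl sumr_ge0//.
  have fin : (mu (`]a, b[%classic) < +oo)%E by rewrite measure_ab ?ltry.
  have -> : b - a = \int[mu]_(x in `]a, b[) (1 : R).
    rewrite Rintegral_cst// mul1r; exact/esym/(congr1 fine (measure_ab ab)).
  apply: ae_le_Rintegral => //; last exact: intg_cst.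
  apply: (@intg_bounded _ _ _ mu _ _ 1) => //; first by apply: measurable_funX; exact: my.
  by apply: ae_imp y1 => x Hx xab; rewrite ger0_norm ?sqr_ge0// Hx.
apply: le_trans (ler_sum _ (fun i _ => H i)) _.
by rewrite sumr_const card_ord mulr_natl.
Qed.

(** By coercivity, 2 [cK] times the integral is at most the energy at time r, itself at most (n + 1)
    (b - a) since the components lie in [0, 1]. Nothing in the bound depends on r0 and r1. *)
Lemma weak_energy (r0 r1 : R) : 0 < r0 -> r0 < r1 -> r1 < T ->
  exists2 L : R -> Prop, (\forall r \ae mu, L r) &
    forall r r', L r -> L r' -> r0 < r -> r < r' -> r' < r1 ->
      \int[mu]_(t in `[r, r']) \int[mu]_x (\sum_i bx a b `]r0, r1[%classic (p i) t x ^+ 2) <=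
      n.+1%:R * (b - a) / (2 * cK K).
Proof.
move=> r00 r01 r1T.
set A := `]r0, r1[%classic.
have mA : measurable A by rewrite /A.
have AT : A `<=` `]0, T[%classic by apply: subset_itvW; rewrite ltW.
have AT' t : A t -> 0 < t < T by move/AT; rewrite /= in_itv.
have ipA i : intg2 (fun t x => bx a b A (p i) t x ^+ 2) by exact: ip.
have iFA := flux_intg2 mA AT ipA.
have mbu j : meas2 (bx a b A (u j)) by apply: (@joint_meas2_bx _ T) => //; have [] := mup j.
have mbp j : meas2 (bx a b A (p j)) by apply: (@joint_meas2_bx _ T) => //; have [] := mup j.
have mbF i : meas2 (bx a b A (flux K u p i)).
  apply: (@joint_meas2_bx _ T) => //; apply: joint_measurable_flux => j; by have [] := mup j.
have [|||iPhi [L aeL HL]] := @energy_box_sum R a b ab n.+1 r0 r1 u p (flux K u p) U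
  (fun i => And3 (mbu i) (mbp i) (mbF i)) ipA iFA.
- apply: ae_imp us => t Ht /AT' tT; apply: ae_imp (Ht tT) => x Hx /Hx[[s0 s1] _] i.
  by rewrite ger0_norm// -s1 (bigD1 i)//= lerDl sumr_ge0.
- by apply: ae_imp uH => t Ht /AT' tT; exact: Ht.
- move=> i phi s t hphi r0s st tr1; apply: Uid => //; first exact: lt_trans r0s.
  exact: lt_trans r1T.
exists (fun r => L r /\ (r0 < r < r1 -> \sum_i \int[mu]_(x in `]a, b[) (u i r x ^+ 2) <= n.+1%:R * (b - a))).
  apply: ae_and => //; apply: ae_imp (ae_and us uH) => t [h1 h2] tA.
  have tT : 0 < t < T by apply: AT'; rewrite /A /= in_itv.
  apply: mass_le; first by move=> i; have [[[]]] := h2 tT i.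
  by apply: ae_imp (h1 tT) => x Hx /Hx[].
move=> r r' [Lr mr] [Lr' _] r0r rr' r'r1.
have := HL r r' Lr Lr' r0r rr' r'r1; set I := Rintegral _ _ _.
have {}mr := mr ltac:(by rewrite r0r (lt_trans rr')).
have S0 : 0 <= \sum_i \int[mu]_(x in `]a, b[) (u i r' x ^+ 2).
  by apply: sumr_ge0 => i _; apply: Rintegral_ge0 => x _; exact: sqr_ge0.
move=> HI.
have {mr S0}HI : I <= n.+1%:R * (b - a) / 2.
  exact: energy_dissipated HI mr S0.
have c0 := cK_gt0 hK.
have -> : n.+1%:R * (b - a) / (2 * cK K) = (cK K)^-1 * (n.+1%:R * (b - a) / 2).
  by field; rewrite gt_eqF.
apply: (@le_trans _ _ ((cK K)^-1 * I)); last by rewrite ler_wpM2l ?invr_ge0 ?(ltW c0).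
have iS : intg2 (fun t x => \sum_j bx a b A (p j) t x ^+ 2).
  exact: (@intg_sum _ _ _ mu2 setT _ _ (fun j (z : RR) => bx a b A (p j) z.1 z.2 ^+ 2)).
have mS : meas2 (fun t x => \sum_j bx a b A (p j) t x ^+ 2).
  by apply: measurable_sum => j; apply: measurable_funX; exact: mbp.
have mP : meas2 (fun t x => \sum_i bx a b A (flux K u p i) t x * bx a b A (p i) t x).
  by apply: measurable_sum => j; apply: measurable_funM; [exact: mbF|exact: mbp].
have sub : `[r, r']%classic `<=` A.
  by rewrite /A; apply: subset_itvSoo; rewrite bnd_simp.
have iP' := intg2_Rint mP iPhi.
have iPr : mu.-integrable `[r, r']%classic (EFin \o (fun t => \int[mu]_x (\sum_i bx a b A (flux K u p i) t x * bx a b A (p i) t x))).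
  by apply: intgS iP'.
rewrite /I -RintegralZl//; apply: ae_le_Rintegral => //.
- by apply: intgS (intg2_Rint mS iS).
- exact: intgZ.
apply: ae_imp (ae_and (intg2_ae iPhi) (ae_and (intg2_ae iS) us)) => t [h1 [h2 h3]] /sub tA.
rewrite -RintegralZl//; apply: ae_le_Rintegral => //; first exact: intgZ.
apply: ae_imp (h3 (AT' _ tA)) => x Hx _.
have [xab|xab] := boolP (x \in `]a, b[%classic); last first.
  rewrite !big1 ?mulr0// => i _; rewrite /bx (negbTE xab) andbF ?expr0n ?mul0r//.
under eq_bigr do rewrite (bxE _ (mem_set tA) xab).
under [in leRHS]eq_bigr do rewrite !(bxE _ (mem_set tA) xab).
move: xab; rewrite inE/= in_itv/= => /Hx[sy p0].
rewrite ler_pdivlMl//.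
exact: (@pflux_coercive _ _ K n1 _ _ sy p0).
Qed.

(* A weak solution has its gradient in L^2 only locally in time; the energy bound is
   uniform in the time interval. *)
Lemma weak_grad_intg2 i : intg2 (fun t x => bx a b `]0, T[%classic (p i) t x ^+ 2).
Proof.
set M := n.+1%:R * (b - a) / (2 * cK K).
have T3 : 0 < T / 3 by rewrite divr_gt0.
pose h (I : R * R) (z : R * R) : R := \sum_j bx a b `[I.1, I.2]%classic (p j) z.1 z.2 ^+ 2.
have mh (I : R * R) : `[I.1, I.2]%classic `<=` `]0, T[%classic ->
    meas2 (fun t x => \sum_j bx a b `[I.1, I.2]%classic (p j) t x ^+ 2).
  move=> sub; apply: measurable_sum => j; apply: measurable_funX.
  by apply: (@joint_meas2_bx _ T) => //; have [] := mup j.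
(* Good times within (T / 3) / (k + 1) of 0 and of T, with a bound M common to all k; Fatou's lemma
   then reaches all of ]0, T[. *)
have Hk (k : nat) : exists I : R * R, [/\ 0 < I.1 < T / 3 / k.+1%:R, T - T / 3 / k.+1%:R < I.2 < T,
    mu2.-integrable setT (EFin \o h I) & \int[mu2]_z h I z <= M].
  have := seq_div_gt0 k T3; have := seq_div_le k T3; set q := _ / _ => q1 q0.
  have [||| L aeL HL] := @weak_energy (q / 2) (T - q / 2); [lra|lra|lra|].
  have [r rq Lr] := @ae_itv_ex _ (q / 2) q L ltac:(lra) ltac:(by apply: ae_imp aeL).
  have [r' rq' Lr'] := @ae_itv_ex _ (T - q) (T - q / 2) L ltac:(lra) ltac:(by apply: ae_imp aeL).
  move: rq rq' => /andP[r1 r2] /andP[r1' r2'].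
  have rr' : r < r' by lra.
  have := HL r r' Lr Lr' r1 rr' r2'; rewrite -/M.
  set A := `](q / 2), (T - q / 2)[%classic => HM.
  have mA : measurable A by rewrite /A.
  have sub : `[r, r']%classic `<=` A.
    by rewrite /A; apply: subset_itvSoo; rewrite bnd_simp.
  have subT : `[r, r']%classic `<=` `]0, T[%classic.
    by apply: subset_itvSoo; rewrite bnd_simp; lra.
  have ipA j : intg2 (fun t x => bx a b A (p j) t x ^+ 2) by apply: ip; lra.
  have mhI := mh (r, r') subT.
  have ih : mu2.-integrable setT (EFin \o h (r, r')).
    have iS : intg2 (fun t x => \sum_j bx a b A (p j) t x ^+ 2).
      exact: (@intg_sum _ _ _ mu2 setT _ _ (fun j (z : RR) => bx a b A (p j) z.1 z.2 ^+ 2)).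
    apply: (@intg_ae_le _ _ _ mu2 _ _ _ measurableT mhI iS); apply: ae_all => z _.
    rewrite ger0_norm; last by apply: sumr_ge0 => j _; exact: sqr_ge0.
    apply: ler_sum => j _; rewrite /bx; case: ifPn => [/andP[/set_mem/sub/mem_set -> ->]//|_].
    by rewrite expr0n sqr_ge0.
  exists (r, r') => /=; split => //; [by rewrite r2 andbT; lra|by rewrite r1'/=; lra|].
  rewrite -(intg2_fubini mhI ih); apply: le_trans HM.
  rewrite (supp_Rintegral mu (@subsetT _ `[r, r']%classic)).
    rewrite le_eqVlt; apply/orP; left; apply/eqP.
    apply: eq_Rintegral => t /set_mem tr; apply: eq_Rintegral => x _.
    by apply: eq_bigr => j _; rewrite /bx /= (mem_set tr) (mem_set (sub _ tr)).
  move=> t _ tr; rewrite (@eq_Rintegral _ _ _ mu setT (fun=> 0)); first by rewrite /Rintegral integral0.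
  by move=> x _; rewrite big1// => j _; rewrite bx_out// expr0n.
have [I {}Hk] := choice Hk.
have mf : meas2 (fun t x => \sum_j bx a b `]0, T[%classic (p j) t x ^+ 2).
  apply: measurable_sum => j; apply: measurable_funX.
  by apply: (@joint_meas2_bx _ T) => //; have [] := mup j.
have iS : intg2 (fun t x => \sum_j bx a b `]0, T[%classic (p j) t x ^+ 2).
  apply: (@intg_fatou _ _ _ mu2 setT (fun k => h (I k)) _ M) => //.
  - by move=> k z; apply: sumr_ge0 => j _; exact: sqr_ge0.
  - by move=> k; have [_ _ ? _] := Hk k.
  - by move=> k; have [_ _ _ ?] := Hk k.
  - move=> -[t x] _ /=; apply: cvg_near_cst.
    have [tT|tT] := pselect (`]0, T[%classic t); last first.
      apply: nearW => k; rewrite /h /=; apply: eq_bigr => j _.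
      rewrite !bx_out//; apply: contra_not tT; have [/andP[h1 h2] /andP[h3 h4] _ _] := Hk k.
      rewrite /= !in_itv/= => /andP[h5 h6]; apply/andP; split.
        exact: lt_le_trans h5.
      exact: le_lt_trans h4.
    have /andP[t0 t1] : 0 < t < T by move: tT; rewrite /= in_itv.
    have Na := seq_div_near (T / 3) t0.
    have Nb := seq_div_near (T / 3) (dl := T - t) ltac:(by rewrite subr_gt0).
    near=> k; have [/andP[h1 h2] /andP[h3 h4] _ _] := Hk k.
    have ka : T / 3 / k.+1%:R < t by near: k.
    have kb : T / 3 / k.+1%:R < T - t by near: k.
    rewrite /h /=; apply: eq_bigr => j _; rewrite /bx (mem_set tT) mem_set//= in_itv/=.
    move: h2 h3 ka kb; set q := _ / k.+1%:R; move=> *; apply/andP; split; lra.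
have mp2 : meas2 (fun t x => bx a b `]0, T[%classic (p i) t x ^+ 2).
  apply: measurable_funX; by apply: (@joint_meas2_bx _ T) => //; have [] := mup i.
apply: (@intg_ae_le _ _ _ mu2 _ _ _ measurableT mp2 iS); apply: ae_all => z _.
rewrite ger0_norm ?sqr_ge0// (bigD1 i)//= lerDl sumr_ge0// => j _; exact: sqr_ge0.
Unshelve. all: by end_near. Qed.

End WeakEnergy.

(** * Uniqueness *)

Section Extension.
Variables (R : realType) (T a b : R).
Hypotheses (T0 : 0 < T) (ab : a < b).
Local Notation mu := (@lebesgue_measure R).
Local Notation mu2 := (mu \x mu)%E.
Local Notation RR := (measurableTypeR R * measurableTypeR R)%type.
Local Notation A0 := (`]0, T[%classic : set R).
Implicit Types (f g : R -> R -> R).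

Definition ext0 f t x : R := if 0 < t then f t x else 0.

Lemma bx_ext0 f : bx a b `](-1), T[%classic (ext0 f) = bx a b A0 f.
Proof.
apply/funext => t; apply/funext => x; rewrite /bx /ext0 !mem_setE !in_itv/=.
have [t0|t0] := ltP 0 t; rewrite /= ?if_same//.
by rewrite (_ : -1 < t)// (lt_trans _ t0)// ltrN10.
Qed.

Lemma bxB f g : bx a b A0 (fun t x => f t x - g t x) =
  (fun t x => bx a b A0 f t x - bx a b A0 g t x).
Proof. by apply/funext => t; apply/funext => x; rewrite /bx; case: ifPn; rewrite ?subr0. Qed.

Lemma intg2_sqB f g : meas2 f -> meas2 g -> intg2 (fun t x => f t x ^+ 2) ->
  intg2 (fun t x => g t x ^+ 2) -> intg2 (fun t x => (f t x - g t x) ^+ 2).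
Proof.
move=> mf mg i_f ig.
have m : meas2 (fun t x => (f t x - g t x) ^+ 2).
  by apply: measurable_funX; exact: measurable_funB.
have iS : intg2 (fun t x => 2 * (f t x ^+ 2 + g t x ^+ 2)).
  by apply: (@intgZ _ _ _ mu2) => //; exact: (@intgD _ _ _ mu2).
apply: (@intg_ae_le _ _ _ mu2 _ _ _ measurableT m iS); apply: ae_all => z _.
rewrite ger0_norm ?sqr_ge0//; have := sqr_ge0 (f z.1 z.2 + g z.1 z.2); nra.
Qed.

Lemma intg2_sq_bound f (m : R -> R) : meas2 (bx a b A0 f) -> (forall t, 0 <= m t) ->
  mu.-integrable setT (EFin \o m) ->
  (\forall t \ae mu, 0 < t < T -> \forall x \ae mu, a < x < b -> f t x ^+ 2 <= m t) ->
  intg2 (fun t x => bx a b A0 f t x ^+ 2).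
Proof.
move=> mf m0 im H.
have iS := intg2_prod im (integrable_indic_itv a b false true).
have mm : measurable_fun setT m by apply: intg_measurable im.
have mS : meas2 (fun t x => m t * (\1_(`]a, b[%classic) x : R)).
  apply: measurable_funM; first exact: measurableT_comp.
  apply: measurableT_comp => //; exact: measurable_indic.
have m2 : meas2 (fun t x => bx a b A0 f t x ^+ 2) by exact: measurable_funX.
apply: (@intg_ae_le _ _ _ mu2 _ _ _ measurableT m2 iS).
have := ae2_le m2 mS; move=> /(_ _)[].
  apply: ae_imp H => t Ht; have [tT|tT] := boolP (t \in A0); last first.
    apply: ae_all => x; rewrite /bx (negbTE tT) expr0n mulr_ge0//.
  have tT' : 0 < t < T by move: tT; rewrite inE/= in_itv.
  apply: ae_imp (Ht tT') => x Hx; have [xab|xab] := boolP (x \in `]a, b[%classic); last first.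
    by rewrite /bx (negbTE xab) andbF expr0n mulr_ge0.
  rewrite (bxE _ tT xab) indicE xab mulr1; apply: Hx.
  by move: xab; rewrite inE/= in_itv.
move=> N [mN N0 sN]; exists N; split => //; apply: subset_trans sN => z /= + Hz; apply => _.
by rewrite ger0_norm ?sqr_ge0.
Qed.

Lemma pair_intg f (psi : R -> R) : meas2 (bx a b A0 f) ->
  intg2 (fun t x => bx a b A0 f t x ^+ 2) -> in_L2 a b psi ->
  (\forall t \ae mu, 0 < t < T -> mu.-integrable `]a, b[%classic (EFin \o (fun x => f t x * psi x))) /\
  mu.-integrable A0 (EFin \o (fun t => \int[mu]_(x in `]a, b[) (f t x * psi x))).
Proof.
move=> mf i_f /in_L2P[mpsi ipsi].
pose h x := psi x * (\1_(`]a, b[%classic) x : R).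
have mh : measurable_fun setT h.
  have ipsi1 : mu.-integrable `]a, b[%classic (EFin \o psi) by apply: (in_L2_intg ab); exact/in_L2P.
  by apply: intg_measurable (intg_indic _ ipsi1).
have ih : mu.-integrable setT (EFin \o (fun x => h x ^+ 2)).
  have -> : (fun x => h x ^+ 2) = (fun x => psi x ^+ 2 * (\1_(`]a, b[%classic) x : R)).
    apply/funext => x; rewrite /h indicE.
    by case: (_ \in _); rewrite ?mulr1 ?mulr0 ?expr0n.
  exact: intg_indic.
have i1 : mu.-integrable setT (EFin \o (\1_A0 : R -> R)) by exact: integrable_indic_itv.
have iS : intg2 (fun t x => bx a b A0 f t x ^+ 2 + (\1_A0 t : R) * h x ^+ 2).
  have i2 := intg2_prod i1 ih.
  exact: (@intgD _ _ _ mu2 setT _ (fun z : RR => (\1_A0 z.1 : R) * h z.2 ^+ 2) measurableT i_f i2).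
have mP : meas2 (fun t x => bx a b A0 f t x * h x).
  by apply: measurable_funM => //; exact: measurableT_comp.
have iP : intg2 (fun t x => bx a b A0 f t x * h x).
  apply: (@intg_ae_le _ _ _ mu2 _ _ _ measurableT mP iS); apply: ae_all => -[t x] _ /=.
  rewrite normrM indicE; have [tA|tA] := boolP (t \in A0); last first.
    by rewrite /bx (negbTE tA) normr0 mul0r expr0n/= mul0r addr0.
  rewrite mul1r -(real_normK (num_real (bx _ _ _ _ _ _))) -(real_normK (num_real (h x))).
  have := sqr_ge0 (`|bx a b A0 f t x| - `|h x|).
  have := sqr_ge0 (`|bx a b A0 f t x| + `|h x|); nra.
have E t x : t \in A0 -> bx a b A0 f t x * h x = f t x * psi x * (\1_(`]a, b[%classic) x : R).
  move=> tA; rewrite /h /bx tA/= indicE; case: (x \in _); rewrite /= ?mulr1//.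
  by rewrite mul0r mulr0.
split.
  apply: ae_imp (intg2_ae iP) => t It tT.
  have tA : t \in A0 by rewrite inE/= in_itv.
  have It' : mu.-integrable `]a, b[%classic (EFin \o (fun x => bx a b A0 f t x * h x)).
    by apply: intgS It.
  move: It'; apply: eq_integrable => // x xab; rewrite /= E// indicE xab mulr1//.
have iP0 : mu.-integrable A0 (EFin \o (fun t => \int[mu]_x (bx a b A0 f t x * h x))).
  by apply: intgS (intg2_Rint mP iP).
move: iP0; apply: eq_integrable => // t tA /=; congr EFin.
rewrite [RHS]Rintegral_ind; apply: eq_Rintegral => x _; exact: E.
Qed.

(* The zero extension to [t <= 0] still satisfies the integrated equation, because the
   initial value is zero. *)
Lemma extend_identity (V H : R -> R) : mu.-integrable A0 (EFin \o H) ->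
  (forall s t, 0 < s -> s < t -> t < T -> V t - V s = - \int[mu]_(r in `[s, t]) H r) ->
  (forall e : R, 0 < e -> exists2 d : R, 0 < d & forall s, 0 < s < T -> s < d -> `|V s| < e) ->
  forall s t, -1 < s -> s < t -> t < T ->
    (if 0 < t then V t else 0) - (if 0 < s then V s else 0) =
    - \int[mu]_(r in `[s, t]) (if 0 < r then H r else 0).
Proof.
move=> iH VH V0.
(* The identity on [s, t] with s tending to 0 along [sk]: V s tends to 0, and H is integrable up to
   time 0. *)
have X t : 0 < t -> t < T -> V t = - \int[mu]_(r in `]0, t]) H r.
  move=> t0 tT; pose sk (k : nat) := t / 2 / k.+1%:R.
  have t2 : 0 < t / 2 by rewrite divr_gt0.
  have sk0 k : 0 < sk k by exact: seq_div_gt0.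
  have skt k : sk k < t by rewrite (le_lt_trans (seq_div_le k t2))//; lra.
  have sub : `]0, t]%classic `<=` A0 by apply: subset_itvl; rewrite bnd_simp.
  have iHt : mu.-integrable `]0, t]%classic (EFin \o H) by apply: intgS iH.
  have mHt : measurable_fun `]0, t]%classic H by apply: intg_measurable iHt.
  have L : (fun k => \int[mu]_(r in `]0, t]) (H r * \1_(`[sk k, t]%classic) r)) @ \oo -->
      \int[mu]_(r in `]0, t]) H r.
    apply: (@Rdominated_cvg _ _ _ mu _ _ _ (fun x => `|H x|)) => //.
    - by move=> k; apply: measurable_funM => //; exact: measurable_indic.
    - exact: integrable_norm iHt.
    - apply: ae_all => r; rewrite /= in_itv/= => /andP[r0 rt].
      apply: cvg_near_cst; have N := seq_div_near (t / 2) r0.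
      near=> k; rewrite indicE mem_set ?mulr1//= in_itv/= rt andbT ltW//.
      by near: k.
    - apply: ae_all => x k _; rewrite normrM ler_piMr// indicE.
      by case: (_ \in _); rewrite ?normr1 ?normr0.
  have L1 : (fun k => V (sk k) - V t) @ \oo --> \int[mu]_(r in `]0, t]) H r.
    rewrite (_ : (fun k => V (sk k) - V t) =
       (fun k => \int[mu]_(r in `]0, t]) (H r * \1_(`[sk k, t]%classic) r)))//.
    apply/funext => k; rewrite -opprB VH// opprK.
    rewrite [RHS](@supp_Rintegral _ _ _ mu _ `[sk k, t]%classic)//.
    - by apply: eq_Rintegral => r rs; rewrite indicE rs mulr1.
    - by apply: subset_itvr; rewrite bnd_simp.
    - by move=> r _ rs; rewrite indicE memNset// mulr0.
  have L2 : (fun k => V (sk k) - V t) @ \oo --> - V t.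
    rewrite -[X in _ --> X]add0r; apply: cvgB; last exact: cvg_cst.
    apply/cvgrPdist_lt => e e0; have [d d0 Hd] := V0 e e0.
    have N := seq_div_near (t / 2) d0.
    near=> k; rewrite sub0r normrN; apply: Hd; last by near: k.
    by rewrite sk0 (lt_trans (skt k)).
  have E : \int[mu]_(r in `]0, t]) H r = - V t by exact: (cvg_unique _ L1 L2).
  by rewrite E opprK.
move=> s t s1 st tT.
have [s0|s0] := ltP 0 s.
  rewrite (lt_trans s0 st) VH//; congr (- _); apply: eq_Rintegral => r.
  by rewrite inE/= in_itv/= => /andP[sr _]; rewrite (lt_le_trans s0 sr).
rewrite subr0; have [t0|t0] := ltP 0 t.
  rewrite X//; congr (- _).
  rewrite [RHS](@supp_Rintegral _ _ _ mu _ `]0, t]%classic)//.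
  - by apply: eq_Rintegral => r; rewrite inE/= in_itv/= => /andP[-> _].
  - by apply: subset_itvr; rewrite bnd_simp.
  - move=> r; rewrite /= !in_itv/= => /andP[_ rt]; rewrite rt andbT => /negP.
    by move=> /negbTE ->.
rewrite (@eq_Rintegral _ _ _ mu _ (fun=> 0)); first by rewrite /Rintegral integral0 oppr0.
move=> r; rewrite inE/= in_itv/= => /andP[_ rt]; rewrite ifF//.
by apply/negbTE; rewrite -leNgt (le_trans rt).
Unshelve. all: by end_near. Qed.

Lemma Rintegral_sq_eq0 (f : R -> R) : mu.-integrable setT (EFin \o (fun x => f x ^+ 2)) ->
  \int[mu]_x (f x ^+ 2) = 0 -> \forall x \ae mu, f x = 0.
Proof.
move=> i0 f0.
have [mf _] := elimT (integrableP _ _ _) i0.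
have : ae_eq mu setT (EFin \o (fun x => f x ^+ 2)) (cst 0%E).
  apply/(ae_eq_integral_abs _ measurableT mf).
  transitivity (\int[mu]_x (f x ^+ 2)%:E)%E.
    by apply: eq_integral => x _; rewrite /= ger0_norm ?sqr_ge0.
  by rewrite (Rintegral_EFin measurableT i0) f0.
apply: ae_imp => x /(_ I) [] /eqP; rewrite sqrf_eq0 => /eqP //.
Qed.

End Extension.

(** * The difference of the two solutions *)

Section Uniqueness.
Variables (R : realType) (n : nat) (T a b : R).
Hypotheses (n1 : (1 <= n)%N) (T0 : 0 < T) (ab : a < b).
Variable K : 'I_n.+1 -> 'I_n.+1 -> R.
Hypothesis hK : 2 * n%:R * Kgap K < Kmean K.
Hypothesis Kp : forall i j, i != j -> 0 < K i j.
Local Notation mu := (@lebesgue_measure R).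
Local Notation mu2 := (mu \x mu)%E.
Local Notation RR := (measurableTypeR R * measurableTypeR R)%type.
Local Notation A0 := (`]0, T[%classic : set R).
Variables (u p ut pt : 'I_n.+1 -> R -> R -> R) (P2 : R -> R).
Variables U Ut : 'I_n.+1 -> R -> (R -> R) -> R.
Hypothesis mup : forall i, joint_measurable T a b (u i) /\ joint_measurable T a b (p i).
Hypothesis mut : forall i, joint_measurable T a b (ut i) /\ joint_measurable T a b (pt i).
Hypothesis us : \forall t \ae mu, 0 < t < T -> \forall x \ae mu, a < x < b ->
  in_simplex (fun i => u i t x) /\ \sum_i p i t x = 0.
Hypothesis uts : \forall t \ae mu, 0 < t < T -> \forall x \ae mu, a < x < b ->
  in_simplex (fun i => ut i t x) /\ \sum_i pt i t x = 0.
Hypothesis uH : \forall t \ae mu, 0 < t < T -> forall i, [/\ in_H1 a b (u i t),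
      is_wderiv a b (u i t) (p i t) &
      forall phi, in_H1 a b phi -> U i t phi = L2pair a b (u i t) phi].
Hypothesis utH : \forall t \ae mu, 0 < t < T -> forall i, [/\ in_H1 a b (ut i t),
      is_wderiv a b (ut i t) (pt i t) &
      forall phi, in_H1 a b phi -> Ut i t phi = L2pair a b (ut i t) phi].
Hypothesis P20 : forall t, 0 <= P2 t.
Hypothesis iP2 : mu.-integrable setT (EFin \o P2).
Hypothesis pP2 : \forall t \ae mu, 0 < t < T -> \forall x \ae mu, a < x < b ->
        forall i, p i t x ^+ 2 <= P2 t.
Hypothesis ipt : forall i, intg2 (fun t x => bx a b A0 (pt i) t x ^+ 2).
Hypothesis Uid : forall i phi, in_H1 a b phi -> forall s t, 0 < s -> s < t -> t < T ->
  U i t phi - U i s phi = - \int[mu]_(r in `[s, t]) \int[mu]_(x in `]a, b[)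
    (flux K u p i r x * wderiv a b phi x).
Hypothesis Utid : forall i phi, in_H1 a b phi -> forall s t, 0 < s -> s < t -> t < T ->
  Ut i t phi - Ut i s phi = - \int[mu]_(r in `[s, t]) \int[mu]_(x in `]a, b[)
    (flux K ut pt i r x * wderiv a b phi x).
Hypothesis U0 : forall i phi, in_H1 a b phi -> forall e : R, 0 < e -> exists2 d : R, 0 < d &
  forall s, 0 < s < T -> s < d -> `|U i s phi - Ut i s phi| < e.

Let D i t x := flux K u p i t x - flux K ut pt i t x.
Let w i t x := u i t x - ut i t x.
Let g i t x := p i t x - pt i t x.

Let mbu i : meas2 (bx a b A0 (u i)).
Proof. by apply: (@joint_meas2_bx _ T) => //; have [] := mup i. Qed.
Let mbp i : meas2 (bx a b A0 (p i)).
Proof. by apply: (@joint_meas2_bx _ T) => //; have [] := mup i. Qed.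
Let mbut i : meas2 (bx a b A0 (ut i)).
Proof. by apply: (@joint_meas2_bx _ T) => //; have [] := mut i. Qed.
Let mbpt i : meas2 (bx a b A0 (pt i)).
Proof. by apply: (@joint_meas2_bx _ T) => //; have [] := mut i. Qed.
Let mbF i : meas2 (bx a b A0 (flux K u p i)).
Proof. by apply: (@joint_meas2_bx _ T) => //; apply: joint_measurable_flux => j; have [] := mup j. Qed.
Let mbFt i : meas2 (bx a b A0 (flux K ut pt i)).
Proof. by apply: (@joint_meas2_bx _ T) => //; apply: joint_measurable_flux => j; have [] := mut j. Qed.
Let mbw i : meas2 (bx a b A0 (w i)).
Proof. by rewrite bxB; apply: measurable_funB; [exact: mbu|exact: mbut]. Qed.
Let mbg i : meas2 (bx a b A0 (g i)).
Proof. by rewrite bxB; apply: measurable_funB; [exact: mbp|exact: mbpt]. Qed.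
Let mbD i : meas2 (bx a b A0 (D i)).
Proof. by rewrite bxB; apply: measurable_funB; [exact: mbF|exact: mbFt]. Qed.

Let ip i : intg2 (fun t x => bx a b A0 (p i) t x ^+ 2).
Proof.
apply: (intg2_sq_bound (mbp i) P20 iP2).
by apply: ae_imp pP2 => t h tT; apply: ae_imp (h tT) => x Hx xab; exact: Hx.
Qed.

Let iF i : intg2 (fun t x => bx a b A0 (flux K u p i) t x ^+ 2).
Proof. by apply: (flux_intg2 n1 Kp mup us) => //; exact: ip. Qed.

Let iFt i : intg2 (fun t x => bx a b A0 (flux K ut pt i) t x ^+ 2).
Proof. by apply: (flux_intg2 n1 Kp mut uts) => //; exact: ipt. Qed.

Let ig i : intg2 (fun t x => bx a b A0 (g i) t x ^+ 2).
Proof. by rewrite bxB; apply: intg2_sqB. Qed.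

Let iD i : intg2 (fun t x => bx a b A0 (D i) t x ^+ 2).
Proof. by rewrite bxB; apply: intg2_sqB. Qed.

Let simplex_le1 (y : 'I_n.+1 -> R) i : in_simplex y -> 0 <= y i <= 1.
Proof. by move=> [y0 y1]; rewrite y0/= -y1 (bigD1 i)//= lerDl sumr_ge0. Qed.

Let w1 : \forall t \ae mu, 0 < t < T -> \forall x \ae mu, a < x < b -> forall i, `|w i t x| <= 1.
Proof.
apply: ae_imp (ae_and us uts) => t [h1 h2] tT.
apply: ae_imp (ae_and (h1 tT) (h2 tT)) => x [k1 k2] xab i.
have [s1 _] := k1 xab; have [s2 _] := k2 xab.
have /andP[] := simplex_le1 i s1; have /andP[] := simplex_le1 i s2.
by rewrite ler_norml /w; lra.
Qed.

(** Square integrability of both fluxes up to t = 0 makes the paired fluxes integrable in time,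
    which is what [extend_identity] requires. *)
Lemma diff_identity i phi s t : in_H1 a b phi -> -1 < s -> s < t -> t < T ->
  (if 0 < t then U i t phi - Ut i t phi else 0) -
  (if 0 < s then U i s phi - Ut i s phi else 0) =
  - \int[mu]_(r in `[s, t]) \int[mu]_(x in `]a, b[) (ext0 (D i) r x * wderiv a b phi x).
Proof.
move=> hphi s1 st tT; have [_ _ hw] := hphi.
have [aeD iHD] := pair_intg ab (mbD i) (iD i) hw.
have [aeF iHF] := pair_intg ab (mbF i) (iF i) hw.
have [aeFt iHFt] := pair_intg ab (mbFt i) (iFt i) hw.
have -> : \int[mu]_(r in `[s, t]) \int[mu]_(x in `]a, b[) (ext0 (D i) r x * wderiv a b phi x) =
    \int[mu]_(r in `[s, t]) (if 0 < r then \int[mu]_(x in `]a, b[) (D i r x * wderiv a b phi x) else 0).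
  apply: eq_Rintegral => r _; rewrite /ext0; case: ifPn => // _.
  rewrite (@eq_Rintegral _ _ _ mu _ (fun=> 0)); first by rewrite /Rintegral integral0.
  by move=> x _; rewrite mul0r.
apply: (extend_identity (V := fun t => U i t phi - Ut i t phi) iHD) => //; last exact: U0.
move=> s' t' s'0 st' tT'.
have sub : `[s', t']%classic `<=` A0 by apply: subset_itvSoo; rewrite bnd_simp.
have -> : \int[mu]_(r in `[s', t']) \int[mu]_(x in `]a, b[) (D i r x * wderiv a b phi x) =
    \int[mu]_(r in `[s', t']) (\int[mu]_(x in `]a, b[) (flux K u p i r x * wderiv a b phi x) -
      \int[mu]_(x in `]a, b[) (flux K ut pt i r x * wderiv a b phi x)).
  have iHD' : mu.-integrable `[s', t']%classic (EFin \o
    (fun r => \int[mu]_(x in `]a, b[) (D i r x * wderiv a b phi x))) by apply: intgS iHD.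
  have iHF' : mu.-integrable `[s', t']%classic (EFin \o
    (fun r => \int[mu]_(x in `]a, b[) (flux K u p i r x * wderiv a b phi x))) by apply: intgS iHF.
  have iHFt' : mu.-integrable `[s', t']%classic (EFin \o
    (fun r => \int[mu]_(x in `]a, b[) (flux K ut pt i r x * wderiv a b phi x))) by apply: intgS iHFt.
  apply: ae_eq_Rintegral => //.
  - by apply: intg_measurable iHD'.
  - by apply: measurable_funB; [apply: intg_measurable iHF'|apply: intg_measurable iHFt'].
  apply: ae_imp (ae_and aeF aeFt) => r [h1 h2] /sub; rewrite /= in_itv/= => rT.
  rewrite -(RintegralB _ (h1 rT) (h2 rT))//; apply: eq_Rintegral => x _.
  by rewrite /D mulrBl.
rewrite RintegralB//; [|by apply: intgS iHF|by apply: intgS iHFt].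
transitivity ((U i t' phi - U i s' phi) - (Ut i t' phi - Ut i s' phi)); first by ring.
by rewrite (@Uid i _ hphi _ _ s'0 st' tT') (@Utid i _ hphi _ _ s'0 st' tT') opprK opprB addrC.
Qed.

Let E t := \sum_i \int[mu]_x (bx a b A0 (w i) t x ^+ 2).

Let EE t : A0 t -> E t = \sum_i \int[mu]_(x in `]a, b[) (w i t x ^+ 2).
Proof.
move=> tA; apply: eq_bigr => i _.
rewrite (@Rintegral_bx _ a b _ _ (fun y _ => y ^+ 2))//; first by rewrite inE.
by move=> x; rewrite expr0n.
Qed.

Let iw i : intg2 (fun t x => bx a b A0 (w i) t x ^+ 2).
Proof.
apply: (intg2_sq_bound (m := \1_A0) (mbw i)).
- by move=> t; rewrite indicE.
- exact: integrable_indic_itv.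
- apply: ae_imp w1 => t h tT; apply: ae_imp (h tT) => x Hx xab.
  rewrite indicE mem_set; last by rewrite /= in_itv.
  by rewrite -(real_normK (num_real (w i t x))) expr_le1// Hx.
Qed.

Let C := n%:R ^+ 2 * Kplus K ^+ 2 / cK K.

Lemma Phi_ge : \forall t \ae mu, 0 < t < T ->
  - (C * P2 t * E t) <= \int[mu]_x (\sum_i bx a b A0 (D i) t x * bx a b A0 (g i) t x).
Proof.
have iDg i : intg2 (fun t x => bx a b A0 (D i) t x * bx a b A0 (g i) t x).
  apply: (@intg_mul_sq _ _ _ mu2 setT (fun z : RR => bx a b A0 (D i) z.1 z.2)
    (fun z : RR => bx a b A0 (g i) z.1 z.2)) => //; [exact: mbD|exact: mbg|exact: iD|exact: ig].
have aeI : \forall t \ae mu, forall i, mu.-integrable setT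
    (EFin \o (fun x => bx a b A0 (D i) t x * bx a b A0 (g i) t x)).
  by apply: ae_all_ord => i; exact: (intg2_ae (iDg i)).
have aeW : \forall t \ae mu, forall i, mu.-integrable setT
    (EFin \o (fun x => bx a b A0 (w i) t x ^+ 2)).
  by apply: ae_all_ord => i; exact: (intg2_ae (iw i)).
apply: ae_imp (ae_and aeI (ae_and aeW (ae_and us (ae_and uts pP2)))) =>
  t [h1 [h2 [h3 [h4 h5]]]] tT.
have iS1 : mu.-integrable setT (EFin \o (fun x => \sum_i bx a b A0 (w i) t x ^+ 2)).
  by apply: intg_sum.
have -> : - (C * P2 t * E t) = \int[mu]_x (- (C * P2 t) * \sum_i bx a b A0 (w i) t x ^+ 2).
  by rewrite RintegralZl// Rintegral_sum// mulNr.
apply: ae_le_Rintegral => //; first exact: intgZ.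
  by apply: intg_sum.
apply: ae_imp (ae_and (h3 tT) (ae_and (h4 tT) (h5 tT))) => x [k1 [k2 k3]] _.
have tA : t \in A0 by rewrite inE/= in_itv.
have [xab|xab] := boolP (x \in `]a, b[%classic); last first.
  rewrite !big1 ?mulr0// => i _; rewrite /bx (negbTE xab) andbF ?expr0n ?mul0r//.
under eq_bigr do rewrite (bxE _ tA xab).
under [in leRHS]eq_bigr do rewrite !(bxE _ tA xab).
move: xab; rewrite inE/= in_itv/= => xab.
have [s1 sp] := k1 xab; have [s2 spt] := k2 xab.
rewrite mulNr; apply: (@dissipation _ _ K n1 hK Kp _ _ _ _ _ s2 sp spt) => i.
exact: k3.
Qed.

(** [energy_box_sum] is applied to the zero extension on ]-1, T[, where -1 could be any negative
    number: good times have full measure, so ]-1, 0[ contains one, and the energy there is 0.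
    Comparison with a good time t > 0 is the integral inequality of [gronwall]. *)
Lemma energy_vanishes : \forall t \ae mu, 0 < t < T -> E t = 0.
Proof.
have bxA i : bx a b `](-1), T[%classic (ext0 (w i)) = bx a b A0 (w i) by exact: bx_ext0.
have bxAg i : bx a b `](-1), T[%classic (ext0 (g i)) = bx a b A0 (g i) by exact: bx_ext0.
have bxAD i : bx a b `](-1), T[%classic (ext0 (D i)) = bx a b A0 (D i) by exact: bx_ext0.
pose V i t phi := if 0 < t then U i t phi - Ut i t phi else 0.
have := @energy_box_sum R a b ab n.+1 (-1) T (fun i => ext0 (w i))
    (fun i => ext0 (g i)) (fun i => ext0 (D i)) V.
move=> /(_ _ _ _ _ _ _)[].
- by move=> i; rewrite bxA bxAg bxAD; split; [exact: mbw|exact: mbg|exact: mbD].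
- by move=> i; rewrite bxAg; exact: ig.
- by move=> i; rewrite bxAD; exact: iD.
- apply: ae_imp w1 => t Ht; rewrite /= in_itv/= => /andP[_ tT].
  have [t0|t0] := ltP 0 t.
    by apply: ae_imp (Ht ltac:(by rewrite t0)) => x Hx xab i; rewrite /ext0 t0; exact: Hx.
  by apply: ae_all => x _ i; rewrite /ext0 ltNge t0 normr0.
- apply: ae_imp (ae_and uH utH) => t [h1 h2]; rewrite /= in_itv/= => /andP[_ tT] i.
  rewrite /V /ext0; have [t0|t0] := ltP 0 t; last first.
    split; [exact: in_H1_0|exact: is_wderiv0|move=> phi _].
    rewrite /L2pair; under eq_Rintegral do rewrite mul0r.
    by rewrite /Rintegral integral0.
  have t0T : 0 < t < T by rewrite t0.
  have [a1 a2 a3] := h1 t0T i; have [b1 b2 b3] := h2 t0T i.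
  split; [exact: in_H1B|exact: is_wderivB|move=> phi hphi].
  have [c1 _ _] := a1; have [c2 _ _] := b1; have [c3 _ _] := hphi.
  by rewrite L2pairB// a3// b3.
- by move=> i phi s t hphi s1 st tT; exact: diff_identity.
move=> iPhi [L aeL HL].
have iPhi' : intg2 (fun t x => \sum_i bx a b A0 (D i) t x * bx a b A0 (g i) t x).
  by move: iPhi; under eq_fun do under eq_fun do under eq_bigr do rewrite bxAD bxAg.
pose Phi t := \int[mu]_x (\sum_i bx a b A0 (D i) t x * bx a b A0 (g i) t x).
have mPhi2 : meas2 (fun t x => \sum_i bx a b A0 (D i) t x * bx a b A0 (g i) t x).
  by apply: measurable_sum => i; apply: measurable_funM; [exact: mbD|exact: mbg].
have iPhiT : mu.-integrable setT (EFin \o Phi) by exact: (intg2_Rint mPhi2 iPhi').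
have PhiE : (fun t => \int[mu]_x (\sum_i bx a b `](-1), T[%classic (ext0 (D i)) t x *
    bx a b `](-1), T[%classic (ext0 (g i)) t x)) = Phi.
  apply/funext => t; apply: eq_Rintegral => x _; apply: eq_bigr => i _.
  by rewrite bxAD bxAg.
have Phi0 t : t <= 0 -> Phi t = 0.
  move=> t0; rewrite /Phi (@eq_Rintegral _ _ _ mu _ (fun=> 0)).
    by rewrite /Rintegral integral0.
  move=> x _; rewrite big1// => i _; rewrite bx_out ?mul0r//= in_itv/=.
  by rewrite ltNge t0.
have [r /andP[r1 r0] Lr] := @ae_itv_ex _ (-1) 0 L (ltrN10 _) ltac:(by apply: ae_imp aeL).
have mE : measurable_fun setT E.
  apply: measurable_sum => i; apply: meas2_Rint; apply: measurable_funX; exact: mbw.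
have E0 t : 0 <= E t.
  by apply: sumr_ge0 => i _; apply: Rintegral_ge0 => x _; exact: sqr_ge0.
pose M := n.+1%:R * (b - a).
have M0 : 0 < M by rewrite mulr_gt0// subr_gt0.
have EM : \forall t \ae mu, 0 < t < T -> E t <= M.
  have aeW : \forall t \ae mu, forall i, mu.-integrable setT
      (EFin \o (fun x => bx a b A0 (w i) t x ^+ 2)).
    by apply: ae_all_ord => i; exact: (intg2_ae (iw i)).
  apply: ae_imp (ae_and aeW w1) => t [iWt Ht] tT; rewrite /E /M.
  have fin : (mu (`]a, b[%classic) < +oo)%E by rewrite measure_ab ?ltry.
  have H i : \int[mu]_x (bx a b A0 (w i) t x ^+ 2) <= b - a.
    rewrite (@supp_Rintegral _ _ _ mu setT `]a, b[%classic)//; last first.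
      by move=> x _ xab; rewrite /bx (memNset xab) andbF expr0n.
    have -> : b - a = \int[mu]_(x in `]a, b[) (1 : R).
      by rewrite Rintegral_cst// mul1r; exact/esym/(congr1 fine (measure_ab ab)).
    apply: ae_le_Rintegral => //; [by apply: intgS (iWt i)|exact: intg_cst|].
    apply: ae_imp (Ht tT) => x Hx xab; have tA0 : t \in A0 by rewrite inE/= in_itv.
    rewrite (bxE _ tA0 (mem_set xab)).
    rewrite -(real_normK (num_real (w i t x))) expr_le1//; apply: Hx; by move: xab; rewrite /= in_itv.
  apply: le_trans (ler_sum _ (fun i _ => H i)) _.
  by rewrite sumr_const card_ord mulr_natl.
(* [gronwall] asks for a bound at every time, while E t <= M is known only at almost every t. *)
pose e t := Num.min (E t) M.
have me : measurable_fun setT e by apply: measurable_minr.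
have eM t : 0 <= e t <= M by rewrite le_min E0 (ltW M0)/= ge_min lexx orbT.
have eE : \forall t \ae mu, 0 < t < T -> e t = E t.
  by apply: ae_imp EM => t Ht tT; rewrite /e min_l// Ht.
have C0 : 0 <= C.
  by rewrite /C divr_ge0 ?(ltW (cK_gt0 hK))// mulr_ge0// sqr_ge0.
(* The factor 2 is that of the energy inequality; C P2 is the constant of [dissipation]. *)
pose m t := 2 * C * P2 t.
have m0 t : 0 <= m t by rewrite mulr_ge0// mulr_ge0.
have im : mu.-integrable setT (EFin \o m) by exact: intgZ.
have mm : measurable_fun setT m by apply: intg_measurable im.
have ime : mu.-integrable setT (EFin \o (fun t => m t * e t)).
  apply: (@intg_ae_le _ _ _ mu _ _ (fun t => M * m t)) => //.
  - exact: measurable_funM.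
  - exact: intgZ.
  - apply: ae_all => t _; have /andP[e0 e1] := eM t.
    rewrite ger0_norm; last exact: (mulr_ge0 (m0 t) e0).
    by rewrite mulrC ler_wpM2r.
have G := gronwall T0 me eM m0 im.
suff : \forall t \ae mu, 0 < t < T -> e t = 0.
  by move=> He; apply: ae_imp (ae_and He eE) => t [h1 h2] tT; rewrite -h2// h1.
apply: G; apply: ae_imp (ae_and aeL eE) => t [Lt Et] /andP[t0 tT].
have rt : r < t by exact: lt_trans t0.
have tA : A0 t by rewrite /= in_itv/= t0.
have := HL r t Lr Lt r1 rt tT.
rewrite PhiE [X in _ - X]big1; last first.
  move=> i _; rewrite (@eq_Rintegral _ _ _ mu _ (fun=> 0)); first by rewrite /Rintegral integral0.
  by move=> x _; rewrite /ext0 ltNge (ltW r0) expr0n.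
rewrite subr0; have -> : \sum_i \int[mu]_(x in `]a, b[) (ext0 (w i) t x ^+ 2) = E t.
  by rewrite EE//; apply: eq_bigr => i _; rewrite /ext0 t0.
rewrite Et ?t0// => /le_trans; apply.
rewrite (@supp_Rintegral _ _ _ mu _ `[0, t]%classic)//; last 2 first.
- by apply: subset_itvr; rewrite bnd_simp ltW.
- move=> s; rewrite /= !in_itv/= => /andP[_ st]; rewrite st andbT => /negP; rewrite -ltNge => s0.
  by apply: Phi0; exact: ltW.
have iPt : mu.-integrable `[0, t]%classic (EFin \o Phi) by apply: intgS iPhiT.
have imt : mu.-integrable `[0, t]%classic (EFin \o (fun t => m t * e t)) by apply: intgS ime.
rewrite -RintegralZl//; apply: ae_le_Rintegral => //; first exact: intgZ.
apply: ae_imp (ae_and Phi_ge eE) => s [Hs es]; rewrite /= in_itv/= => /andP[s0 st].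
have [s0'|s0'] := ltP 0 s; last first.
  have := Phi0 s s0'; rewrite /Phi => ->; rewrite mulr0 mulr_ge0//; by have /andP[] := eM s.
have sT : 0 < s < T by rewrite s0' (le_lt_trans st).
rewrite es// /m; have := Hs sT; rewrite -/(Phi s).
have -> : 2 * C * P2 s * E s = 2 * (C * P2 s * E s) by rewrite !mulrA.
by move: (C * P2 s * E s) (Phi s) => x y h; rewrite mulNr -mulrN ler_wpM2l// lerNl.
Qed.

Lemma diff_vanishes i : \forall z \ae mu2, cylinder T a b z -> u i z.1 z.2 = ut i z.1 z.2.
Proof.
suff : \forall z \ae mu2, bx a b A0 (w i) z.1 z.2 = 0.
  move=> [N [mN N0 sN]]; exists N; split => //; apply: subset_trans sN => z /= + Hz; apply => -[h1 h2].
  by apply/eqP; rewrite -subr_eq0; apply/eqP; move: Hz; rewrite bxE ?inE.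
apply: ae2_of_sections (mbw i) _.
apply: ae_imp (ae_and (intg2_ae (iw i)) energy_vanishes) => t [It Et].
have [tA|tA] := pselect (A0 t); last by apply: ae_all => x; rewrite bx_out.
have tT : 0 < t < T by move: tA; rewrite /= in_itv.
apply: Rintegral_sq_eq0 => //; apply/eqP.
have J j : 0 <= \int[mu]_x (bx a b A0 (w j) t x ^+ 2).
  by apply: Rintegral_ge0 => x _; exact: sqr_ge0.
have := Et tT; rewrite /E => /eqP.
by rewrite psumr_eq0// => /allP/(_ i (mem_index_enum i)).
Qed.

End Uniqueness.

Unset Implicit Arguments.

Theorem corollary2p5 (R : realType) (n : nat) (hn : (1 <= n)%N)
    (T a b : R) (hT : 0 < T) (hab : a < b)
    (K : 'I_n.+1 -> 'I_n.+1 -> R)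
    (hKpos : forall i j, i != j -> 0 < K i j)
    (hKsym : forall i j, i != j -> K i j = K j i)
    (hK : 2 * n%:R * Kgap K < Kmean K)
    (u0 : 'I_n.+1 -> R -> R)
    (hu0 : forall i, in_H1 a b (u0 i))
    (hu0P : \forall x \ae lmeas R, a < x < b -> in_simplex (fun i => u0 i x))
    (ut : 'I_n.+1 -> R -> R -> R) (ut0 : 'I_n.+1 -> R -> R)
    (hut : weak_solution T a b K ut ut0)
    (u : 'I_n.+1 -> R -> R -> R)
    (hu : strong_solution T a b K u u0)
    (hinit : forall i, \forall x \ae lmeas R, a < x < b -> u0 i x = ut0 i x) :
  forall i, \forall z \ae lmeas2 R, cylinder T a b z ->
    u i z.1 z.2 = ut i z.1 z.2.
Proof.
have hut0 i : in_L2 a b (ut0 i).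
  by have [_ [_ [_ [_ [_ [_ /(_ i)[]]]]]]] := hut.
have [pt [Ut [mut utH uts ipt Utid]]] := weak_solution_integrated hT hut.
have [p [U [P2 [mup uH us [P20 iP2 pP2] Uid]]]] := strong_solution_integrated hn hT hab hK hKpos hu.
have iptT := weak_grad_intg2 hn hT hab hK hKpos mut uts utH ipt
  (fun i phi hphi => let: And3 h _ _ := Utid i phi hphi in h).
apply: (diff_vanishes hn hT hab hK hKpos mup mut us uts uH utH P20 iP2 pP2 iptT
  (fun i phi hphi => let: And3 h _ _ := Uid i phi hphi in h)
  (fun i phi hphi => let: And3 h _ _ := Utid i phi hphi in h)).
(* What is left is that the two continuous representatives, evaluated at phi, come together as t
   tends to 0: their values at 0 are the pairings with u0 and ut0, which agree a.e. *)
move=> i phi hphi e e0.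
have [_ Ui Uc] := Uid i phi hphi; have [_ Uti Utc] := Utid i phi hphi.
have [d1 d10 H1] := Uc _ (divr_gt0 e0 (ltr0n R 2)).
have [d2 d20 H2] := Utc _ (divr_gt0 e0 (ltr0n R 2)).
have E : U i 0 phi = Ut i 0 phi.
  rewrite Ui Uti /L2pair; have [[mphi _] _ _] := hphi.
  have [[m0 _] _ _] := hu0 i; have [mt0 _] := hut0 i.
  apply: ae_eq_Rintegral => //; [exact: measurable_funM|exact: measurable_funM|].
  by apply: ae_imp (hinit i) => x Hx; rewrite /= in_itv/= => /Hx ->.
exists (Num.min d1 d2); first by rewrite lt_min d10.
move=> s sT; rewrite lt_min => /andP[s1 s2].
have -> : U i s phi - Ut i s phi = (U i s phi - U i 0 phi) - (Ut i s phi - Ut i 0 phi).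
  by rewrite E; ring.
rewrite (splitr e); apply: le_lt_trans (ler_normB _ _) _.
by apply: ltrD; [exact: H1|exact: H2].
Qed.
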